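(* Let $L$ be a finite-dimensional Lie algebra over a field of characteristic zero. Then $L$ is an almost-algebraic $A$-algebra if and only if $L$ is elementary.
   Context: The Frattini ideal $\phi(B)$ of a Lie algebra $B$ is the largest ideal of $B$ contained in every maximal subalgebra of $B$. $L$ is elementary if $\phi(B)=0$ for every subalgebra $B$ of $L$. $L$ is an $A$-algebra if every nilpotent subalgebra of $L$ is abelian. A linear Lie algebra $L\le \mathrm{gl}(V)$ is almost algebraic if it contains the semisimple and nilpotent Jordan components of each of its elements; an abstract Lie algebra $L$ is almost algebraic if $\mathrm{ad}\,L\le\mathrm{gl}(L)$ is almost algebraic. *)

(* Defs.v *)
From HB Require Import structures.
From mathcomp Require Import all_boot all_order all_algebra.
Set Implicit Arguments.
Unset Strict Implicit.
Unset Printing Implicit Defensive.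
Import GRing.Theory.
Local Open Scope ring_scope.

Section Lie.
Variables (F : fieldType) (L : vectType F) (br : L -> L -> L).

Definition lie_algebra : Prop :=
  [/\ forall (a : F) (x y z : L), br (a *: x + y) z = a *: br x z + br y z,
      forall (a : F) (x y z : L), br x (a *: y + z) = a *: br x y + br x z,
      forall x : L, br x x = 0
    & forall x y z : L, br x (br y z) + br y (br z x) + br z (br x y) = 0].

Definition subalgebra (B : {vspace L}) : Prop :=
  forall x y, x \in B -> y \in B -> br x y \in B.

Definition ideal_of (B I : {vspace L}) : Prop :=
  (I <= B)%VS /\ forall x y, x \in B -> y \in I -> br x y \in I.

Definition maximal_subalgebra (B M : {vspace L}) : Prop :=
  [/\ subalgebra M, (M <= B)%VS, M != B &
      forall K : {vspace L}, subalgebra K -> (M <= K)%VS -> (K <= B)%VS ->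
        K = M \/ K = B].

Definition is_frattini (B I : {vspace L}) : Prop :=
  [/\ ideal_of B I,
      (forall M, maximal_subalgebra B M -> (I <= M)%VS) &
      forall J, ideal_of B J -> (forall M, maximal_subalgebra B M -> (J <= M)%VS) ->
        (J <= I)%VS].

Definition elementary : Prop :=
  forall B : {vspace L}, subalgebra B ->
    forall I, is_frattini B I -> I = 0%VS.

(* [B, C] : the subspace spanned by all brackets [x, y], x in B, y in C
   (by bilinearity, spanned by brackets of basis vectors). *)
Definition brackets (B C : {vspace L}) : {vspace L} :=
  <<[seq br x y | x <- vbasis B, y <- vbasis C]>>%VS.

Definition lcs (B : {vspace L}) (k : nat) : {vspace L} :=
  iter k (brackets B) B.

Definition nilpotent_subalgebra (B : {vspace L}) : Prop :=
  subalgebra B /\ exists k, lcs B k = 0%VS.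

Definition abelian_subalgebra (B : {vspace L}) : Prop :=
  forall x y, x \in B -> y \in B -> br x y = 0.

Definition A_algebra : Prop :=
  forall B : {vspace L}, nilpotent_subalgebra B -> abelian_subalgebra B.

Definition semisimple_endo (s : 'End(L)) : Prop :=
  forall U : {vspace L}, (s @: U <= U)%VS ->
    exists W : {vspace L},
      [/\ (s @: W <= W)%VS, (U :&: W = 0)%VS & (U + W = fullv)%VS].

Definition nilpotent_endo (n : 'End(L)) : Prop :=
  exists k, forall v : L, iter k n v = 0.

Definition jordan_components (a s n : 'End(L)) : Prop :=
  [/\ forall v, a v = s v + n v,
      forall v, s (n v) = n (s v),
      semisimple_endo s & nilpotent_endo n].

Definition in_adL (f : 'End(L)) : Prop :=
  exists y : L, forall v, f v = br y v.

Definition almost_algebraic : Prop :=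
  forall (a s n : 'End(L)), in_adL a -> jordan_components a s n ->
    in_adL s /\ in_adL n.

End Lie.

(* Main.v *)
Require Import Defs.
From HB Require Import structures.
From mathcomp Require Import all_boot all_order all_algebra all_field.
From mathcomp Require Import ring zify.
From Stdlib Require Import Classical FunctionalExtensionality.
(* Let [N] be the largest abelian ideal of a subalgebra [B], and [R/N] the centre of
   [B/N]. In an A-algebra [B/R] is semisimple, so Weyl's theorem, in a form allowing
   [R] to act through commuting semisimple operators, splits the modules at hand.
   If [L] is moreover almost algebraic, elements of [R] act semisimply on [N] (a
   nilpotent Jordan component would produce a Heisenberg subalgebra), so [N] is
   completely reducible and has a complementary subalgebra. An ideal [I] contained in
   all maximal subalgebras then meets [N], hence [R], trivially; and an ideal [J] with
   [I + J = B], orthogonal to [I] modulo [R], must be [B], so that [I = 0].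
   Conversely, in an elementary algebra every ideal of a subalgebra has a
   complementary subalgebra, since a minimal supplement meets it in an ideal lying in
   all maximal subalgebras. The nilpotent Jordan component of [ad x] is a derivation,
   and splitting the modules it generates in [End L] shows that it is inner. *)
Set Implicit Arguments.
Unset Strict Implicit.
Unset Printing Implicit Defensive.
Import GRing.Theory Num.Theory.
Local Open Scope ring_scope.

(** * Polynomials in an endomorphism and Jordan components *)

(** The field need not contain eigenvalues, so semisimplicity of an operator is tested by a
    separable polynomial annihilating it. Scalars are extended only to compare Jordan parts of a
    matrix and of its adjoint action, and to prove Cartan's criterion. The main tool is then
    [module_split]: a module is the direct sum of its invariants and the span of its brackets.
    Applied to suitable spaces of endomorphisms it yields Levi complements, complementary ideals and
    inner derivations, an invariant being an equivariant projection or a corrected derivation. The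
    obstacle is the radical [R], which need not act trivially: on each auxiliary module its
    operators must commute with the action and have the same kernel as their squares. Separable
    polynomials provide this in one direction, the absence of Heisenberg subalgebras in the other.
    No quotient is formed: statements are relative to a pair of subspaces [P <= M], or to an ideal
    [R] modulo which [B] is semisimple. *)

Section Extremal.
Variables (F : fieldType) (V : vectType F).
Implicit Types (P : {vspace V} -> Prop) (U W : {vspace V}).

Lemma max_vspace P U0 : P U0 ->
  exists U, [/\ P U, (U0 <= U)%VS & forall W, P W -> (U <= W)%VS -> W = U].
Proof.
move En: (\dim {:V} - \dim U0)%N => n; elim/ltn_ind: n => n IHn in U0 En *.
move=> PU0; have [[W [PW sUW neq]]|none] :=
  classic (exists W, [/\ P W, (U0 <= W)%VS & W != U0]).
  have ltd : (\dim U0 < \dim W)%N.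
    rewrite ltn_neqAle dimvS // andbT; apply: contra neq => /eqP dd.
    by rewrite eq_sym eqEdim sUW dd leqnn.
  have leW : (\dim W <= \dim {:V})%N by rewrite dimvS ?subvf.
  have [|U [PU sWU maxU]] := IHn (\dim {:V} - \dim W)%N _ W erefl PW.
    by rewrite -En ltn_sub2l // (leq_trans ltd).
  by exists U; split=> //; apply: subv_trans sWU.
exists U0; split=> // W PW sUW; apply/eqP/negPn/negP => neq.
by case: none; exists W.
Qed.

Lemma min_vspace P U0 : P U0 ->
  exists U, [/\ P U, (U <= U0)%VS & forall W, P W -> (W <= U)%VS -> W = U].
Proof.
move En: (\dim U0) => n; elim/ltn_ind: n => n IHn in U0 En *.
move=> PU0; have [[W [PW sWU neq]]|none] :=
  classic (exists W, [/\ P W, (W <= U0)%VS & W != U0]).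
  have ltd : (\dim W < \dim U0)%N.
    rewrite ltn_neqAle dimvS // andbT; apply: contra neq => /eqP dd.
    by rewrite eqEdim sWU dd leqnn.
  have [|U [PU sUW minU]] := IHn (\dim W) _ W erefl PW; first by rewrite -En.
  by exists U; split=> //; apply: subv_trans sWU.
exists U0; split=> // W PW sUW; apply/eqP/negPn/negP => neq.
by case: none; exists W.
Qed.

(** A maximal subspace inside the predicate contains every vector satisfying it, since its line
    could be added. Subspaces cut out by linear conditions are named this way throughout. *)
Lemma vspace_of_pred (Q : V -> Prop) :
  Q 0 -> (forall a u v, Q u -> Q v -> Q (a *: u + v)) ->
  exists U : {vspace V}, forall v, v \in U <-> Q v.
Proof.
move=> Q0 QL; pose P U := forall v, v \in U -> Q v.
have P0 : P 0%VS by move=> v; rewrite memv0 => /eqP->.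
have [U [PU _ maxU]] := max_vspace P0.
exists U => v; split; first exact: PU.
move=> Qv; have /maxU eqU : P (<[v]> + U)%VS.
  move=> w /memv_addP[_ /vlineP[k ->] [u Uu ->]]; apply: QL => //.
  exact: PU.
by rewrite -eqU ?addvSr // (subvP (addvSl _ _)) ?memv_line.
Qed.

Lemma subvP_neq U W : (U <= W)%VS -> U != W -> exists2 v, v \in W & v \notin U.
Proof.
move=> sUW neq; apply/subvPn; apply: contra neq => sWU.
by rewrite eqEsubv sUW.
Qed.

End Extremal.

(** * Evaluation of polynomials at an endomorphism *)

Section PolyEval.
Variables (F : fieldType) (V : vectType F).
Implicit Types (a b c : 'End(V)) (p q : {poly F}) (u v : V).

Definition powf a i : 'End(V) := iter i (fun f => a \o f)%VF \1%VF.
Definition evp a p : 'End(V) := \sum_(i < size p) p`_i *: powf a i.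

Lemma powfE a i v : powf a i v = iter i a v.
Proof. by elim: i => [|i IH] /=; rewrite ?id_lfunE ?comp_lfunE ?IH. Qed.

Lemma evpE n a p : (size p <= n)%N -> evp a p = \sum_(i < n) p`_i *: powf a i.
Proof.
move=> le; rewrite /evp (big_ord_widen n (fun i => p`_i *: powf a i)) //.
rewrite [RHS](bigID (fun i : 'I_n => (i < size p)%N)) /= [X in _ + X]big1 ?addr0 //.
by move=> i; rewrite -leqNgt => le'; rewrite nth_default // scale0r.
Qed.

Lemma evpD a p q : evp a (p + q) = evp a p + evp a q.
Proof.
pose n := maxn (size p) (size q).
rewrite !(@evpE n) ?leq_maxl ?leq_maxr ?(leq_trans (size_polyD _ _)) //.
by rewrite -big_split; apply: eq_bigr => i _; rewrite coefD scalerDl.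
Qed.

Lemma evpZ a k p : evp a (k *: p) = k *: evp a p.
Proof.
rewrite !(@evpE (size p)) ?size_scale_leq // scaler_sumr.
by apply: eq_bigr => i _; rewrite coefZ scalerA.
Qed.

Lemma evpN a p : evp a (- p) = - evp a p.
Proof. by rewrite -scaleN1r evpZ scaleN1r. Qed.

Lemma evpB a p q : evp a (p - q) = evp a p - evp a q.
Proof. by rewrite evpD evpN. Qed.

Lemma evp0 a : evp a 0 = 0.
Proof. by rewrite /evp size_poly0 big_ord0. Qed.

Lemma evpC a k v : evp a k%:P v = k *: v.
Proof.
by rewrite (@evpE 1) ?size_polyC_leq1 // big_ord1 coefC /= scale_lfunE id_lfunE.
Qed.

Lemma evp1 a v : evp a 1 v = v.
Proof. by rewrite evpC scale1r. Qed.

Lemma evpMX a p v : evp a (p * 'X) v = evp a p (a v).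
Proof.
rewrite (@evpE (size p).+1) ?(leq_trans (size_polyMleq _ _)) ?size_polyX ?addn2 //.
rewrite big_ord_recl coefMX /= scale0r add0r !sum_lfunE.
apply: eq_bigr => i _; rewrite !scale_lfunE coefMX /=.
by rewrite comp_lfunE !powfE -iterS iterSr.
Qed.

Lemma evpX a v : evp a 'X v = a v.
Proof. by rewrite -['X]mul1r evpMX evp1. Qed.

Lemma evp_comm a p v : evp a p (a v) = a (evp a p v).
Proof.
rewrite !sum_lfunE linear_sum; apply: eq_bigr => i _.
by rewrite !scale_lfunE linearZ !powfE -iterS iterSr.
Qed.

Lemma evpM a p q v : evp a (p * q) v = evp a p (evp a q v).
Proof.
elim/poly_ind: q => [|q c IH] in v *; first by rewrite mulr0 !evp0 zero_lfunE linear0.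
rewrite mulrDr mulrA !evpD !add_lfunE !evpMX IH linearD; congr (_ + _).
by rewrite mulrC mul_polyC evpZ scale_lfunE !evpC linearZ.
Qed.

Lemma evp_exp a p n v : evp a (p ^+ n) v = iter n (evp a p) v.
Proof.
elim: n v => [|n IH] v; first by rewrite expr0 evp1.
by rewrite exprS evpM IH.
Qed.

Lemma evp_dvd a p q : p %| q -> evp a p = 0 -> evp a q = 0.
Proof.
case/dvdpP => r -> p0; apply/lfunP => v.
by rewrite evpM p0 !zero_lfunE linear0.
Qed.

Lemma evp_stable a p (U : {vspace V}) :
  (forall v, v \in U -> a v \in U) -> forall v, v \in U -> evp a p v \in U.
Proof.
move=> sU; elim/poly_ind: p => [|p c IH] v Uv.
  by rewrite evp0 zero_lfunE mem0v.
by rewrite evpD add_lfunE evpMX evpC memvD ?memvZ // IH // sU.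
Qed.

Lemma evp_comp a p q : evp a (p \Po q) = evp (evp a q) p.
Proof.
apply/lfunP; elim/poly_ind: p => [|p c IH] v; first by rewrite comp_poly0 !evp0.
by rewrite comp_poly_MXaddC !evpD !add_lfunE !evpC evpMX evpM IH.
Qed.

Lemma evp_kill a : exists2 p : {poly F}, p != 0 & evp a p = 0.
Proof.
pose n := (\dim {:'End(V)}).+1; pose X := [tuple powf a i | i < n].
have nfree : ~ free X.
  rewrite /free size_tuple => /eqP E.
  by have := dimvS (subvf <<X>>); rewrite E ltnn.
have [k [sum0 nz]] : exists k : 'I_n -> F,
    \sum_(i < n) k i *: X`_i = 0 /\ ~ (forall i, k i = 0).
  apply: NNPP => none; apply: nfree; apply/freeP => k sum0 i.
  by apply: NNPP => nz; apply: none; exists k; split=> // all0; apply: nz.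
exists (\poly_(i < n) k (inord i)).
  apply/eqP => p0; apply: nz => i.
  have := congr1 (fun p : {poly F} => p`_i) p0.
  by rewrite coef_poly ltn_ord inord_val coef0.
rewrite (@evpE n) ?size_poly // -[RHS]sum0; apply: eq_bigr => i _.
by rewrite coef_poly ltn_ord inord_val -tnth_nth tnth_mktuple.
Qed.

End PolyEval.

(** * Separable polynomials and Newton's iteration *)

Section SeparablePoly.
Variables (F : fieldType) (charF0 : [pchar F] =i pred0).
Implicit Types (p q d g h : {poly F}).

Lemma natr_neq0 n : (n.+1%:R : F) != 0.
Proof. by have /pcharf0P-> := charF0. Qed.

Lemma deriv_neq0 p : (1 < size p)%N -> p^`() != 0.
Proof.
move=> gt1; apply/eqP => p0; have := congr1 (fun r : {poly F} => r`_((size p).-2)) p0.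
rewrite coef_deriv coef0 => /eqP; have [n Dn] : exists n, size p = n.+2.
  by case: (size p) gt1 => [|[|n]] // _; exists n.
rewrite Dn /= -mulr_natr mulf_eq0 (negPf (natr_neq0 _)) orbF.
apply/negP; rewrite -[n.+1]/(n.+2.-1) -Dn -lead_coefE lead_coef_eq0.
by rewrite -size_poly_eq0 Dn.
Qed.

Lemma separable_poly_coprime p :
  (forall u v, u * v %| p -> coprimep u v) -> separable_poly p.
Proof.
by move=> H; apply/separable_polyP; split=> // u _; apply: deriv_neq0.
Qed.

(** Take [q] of least size among the divisors of [p] having a power divisible by [p]. If [u * v]
    divides [q] and [d] is the gcd of [u] and [v], then [q = w * d * d] and [w * d] also qualifies,
    so [d] is a unit. *)
Lemma separable_radical p : p != 0 ->
  exists q, exists2 m, separable_poly q & q %| p /\ p %| q ^+ m.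
Proof.
move=> nz_p.
pose P n := exists2 q : {poly F}, size q = n & q %| p /\ exists m, p %| q ^+ m.
have [n [[q sq [qp [m pqm]]] minn]] : exists n, P n /\ forall k, P k -> (n <= k)%N.
  have: P (size p) by exists p => //; split=> //; exists 1%N; rewrite expr1.
  move: (size p) => n; elim/ltn_ind: n => n IH Pn.
  have [[k [lt Pk]]|none] := classic (exists k, (k < n)%N /\ P k).
    exact: IH lt Pk.
  by exists n; split=> // k Pk; rewrite leqNgt; apply/negP => lt; apply: none; exists k.
exists q, m => //; apply: separable_poly_coprime => u v uvq.
have nz_q : q != 0 by apply: contraNneq nz_p => q0; move: qp; rewrite q0 dvd0p.
set d := gcdp u v; have nz_d : d != 0.
  apply: contraNneq nz_q => d0; move: uvq.
  by move/eqP: d0; rewrite gcdp_eq0 => /andP[/eqP-> _]; rewrite mul0r dvd0p.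
have [w Dq] : exists w, q = w * d * d.
  have : d * d %| q by apply: dvdp_trans uvq; rewrite dvdp_mul ?dvdp_gcdl ?dvdp_gcdr.
  by case/dvdpP => w ->; exists w; rewrite mulrA.
have nz_w : w * d != 0 by apply: contraNneq nz_q; rewrite Dq => ->; rewrite mul0r.
have /minn : P (size (w * d)).
  exists (w * d) => //; split; first by apply: dvdp_trans qp; rewrite Dq dvdp_mulr.
  exists (2 * m)%N; apply: dvdp_trans pqm _; rewrite exprM dvdp_exp2r // Dq expr2.
  have -> : w * d * (w * d) = w * (w * d * d) by ring.
  exact: dvdp_mull.
rewrite -sq Dq (size_mul nz_w nz_d) /coprimep -/d.
move: nz_w nz_d; rewrite -!size_poly_gt0.
case: (size (w * d)%R) (size d) => // k [|[|j]] // _ _.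
by move=> le; have : False by lia.
Qed.

(** Write [d = e * c] with [c] the gcd of [d] and [q]. Separability makes [e] prime to [c], hence to
    [q], yet [e] divides a power of [q]; so [e] is a unit. *)
Lemma separable_dvd_exp d q m : separable_poly d -> d %| q ^+ m -> d %| q.
Proof.
move=> sd dqm; have nz_d := separable_poly_neq0 sd.
set c := gcdp d q; have /dvdpP[e De] : c %| d by apply: dvdp_gcdl.
have /separable_polyP[cop _] := sd.
have ec : coprimep e c by apply: cop; rewrite -De.
have eq1 : coprimep e q.
  apply/coprimepP => f fe fq; move/coprimepP: ec; apply=> //.
  by rewrite dvdp_gcd fq andbT De dvdp_mulr.
have : e %| q ^+ m by apply: dvdp_trans dqm; rewrite De dvdp_mulr.
rewrite -[q ^+ m]mulr1 Gauss_dvdpr ?coprimep_expr // => e1.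
rewrite De; apply: dvdp_trans (dvdp_gcdr d q); rewrite -/c.
by rewrite -[X in _ %| X]mul1r dvdp_mul.
Qed.

Lemma comp_poly_taylor2 q g h : exists w,
  q \Po (g + h) = q \Po g + h * (q^`() \Po g) + h ^+ 2 * w.
Proof.
elim/poly_ind: q => [|q c [w IH]].
  by exists 0; rewrite derivC !comp_poly0 !mulr0 !addr0.
exists (q^`() \Po g + w * (g + h)).
rewrite derivD derivM derivX derivC !comp_poly_MXaddC IH addr0 mulr1.
by rewrite !(comp_polyD, comp_polyM) comp_polyX; ring.
Qed.

(** The Jordan decomposition by Newton's iteration: if [p] annihilates [a], then $g(a)$ is a root of
    the separable [q] and $a - g(a)$ is nilpotent. *)
Lemma jordan_poly p : p != 0 -> exists q g, exists2 m,
  separable_poly q & p %| q \Po g /\ p %| ('X - g) ^+ m.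
Proof.
move=> nz_p; have [q [m sq [qp pqm]]] := separable_radical nz_p.
have [[u v] /= bez] : exists uv, uv.1 * q + uv.2 * q^`() = 1.
  move: sq; rewrite unlock => /Bezout_eq1_coprimepP[[u v] /= E].
  by exists (u, v).
suff [g [qg qX]] : exists g, q ^+ m.+1 %| q \Po g /\ q %| 'X - g.
  exists q, g, m => //; split; last by apply: dvdp_trans pqm _; rewrite dvdp_exp2r.
  by apply: dvdp_trans qg; apply: dvdp_trans pqm _; rewrite dvdp_exp2l.
elim: m {pqm} => [|k [g [qg qX]]].
  by exists 'X; rewrite comp_polyXr expr1 subrr dvdp0.
(* The Newton step: [v] inverts the derivative of [q] modulo [q], so the new value of [q] is a
   multiple of [Q ^+ 2]. *)
pose Q := q \Po g; exists (g + - ((v \Po g) * Q)); split; last first.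
  rewrite opprD opprK addrA dvdp_add // dvdp_mull //.
  by apply: dvdp_trans qg; rewrite exprS dvdp_mulr.
have [w ->] := comp_poly_taylor2 q g (- ((v \Po g) * Q)).
have -> : q \Po g + - ((v \Po g) * Q) * (q^`() \Po g) +
    (- ((v \Po g) * Q)) ^+ 2 * w =
    Q ^+ 2 * ((u \Po g) + (v \Po g) ^+ 2 * w).
  have : (u \Po g) * Q + (v \Po g) * (q^`() \Po g) = 1.
    by rewrite -!comp_polyM -comp_polyD bez comp_polyC.
  rewrite -/Q => E; rewrite -[X in X + _ + _]mulr1 -E; ring.
rewrite dvdp_mulr // expr2; apply: dvdp_trans (dvdp_mul qg qg).
by rewrite -exprD dvdp_exp2l //; lia.
Qed.

End SeparablePoly.

(** * Commuting operators and nilpotent differences *)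

Section Operators.
Variables (F : fieldType) (V : vectType F).
Implicit Types (a b c s n t w : 'End(V)) (p q : {poly F}) (u v : V).

Definition commf a b := forall v, a (b v) = b (a v).

Lemma commf_sym a b : commf a b -> commf b a.
Proof. by move=> ab v; rewrite ab. Qed.

Lemma commf_evp a b p : commf a b -> commf (evp a p) b.
Proof.
move=> ab; elim/poly_ind: p => [|p c IH] v.
  by rewrite evp0 !zero_lfunE linear0.
by rewrite !evpD !add_lfunE !evpMX !evpC ab IH linearD linearZ.
Qed.

Lemma commf_evp2 a p q : commf (evp a p) (evp a q).
Proof. by move=> v; rewrite -!evpM mulrC. Qed.

Lemma commf_iter a b k v : commf a b -> iter k a (b v) = b (iter k a v).
Proof. by move=> ab; elim: k => //= k ->; rewrite ab. Qed.

Lemma iter_lin a k : linear (iter k a).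
Proof. by elim: k => [|k IH] x u v //=; rewrite IH linearP. Qed.

Lemma iter0 a k : iter k a 0 = 0.
Proof. by elim: k => //= k ->; rewrite linear0. Qed.

Lemma evp_taylor2 a b p : commf a b -> exists w, [/\ commf w a, commf w b &
  forall v, evp a p v =
    evp b p v + evp b p^`() ((a - b) v) + (a - b) ((a - b) (w v))].
Proof.
move=> ab; pose d := a - b.
have dE v : d v = a v - b v by rewrite add_lfunE opp_lfunE.
have da : commf d a by move=> v; rewrite !dE linearB /= ab.
have db : commf d b by move=> v; rewrite !dE linearB /= ab.
have bd : commf b d by apply: commf_sym.
rewrite -/d; move: d dE da db bd => d dE da db bd.
have Ea u : a u = b u + d u by rewrite dE addrC subrK.
elim/poly_ind: p => [|p c [w [wa wb IH]]].
  exists 0; split=> v; rewrite ?zero_lfunE ?linear0 //.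
  by rewrite !evp0 !zero_lfunE !addr0.
exists ((w \o a)%VF + evp b p^`()); split=> v.
- by rewrite !(add_lfunE, comp_lfunE) wa (commf_evp _ (commf_sym ab)) linearD.
- by rewrite !(add_lfunE, comp_lfunE) ab wb evp_comm linearD.
rewrite derivD derivM derivX derivC addr0 mulr1 !evpD !add_lfunE !evpMX !evpC.
rewrite IH !comp_lfunE !linearD /=.
have -> : evp b p (a v) = evp b p (b v) + evp b p (d v) by rewrite Ea linearD.
have -> : evp b p^`() (d (a v)) = evp b p^`() (b (d v)) + d (d (evp b p^`() v)).
  by rewrite Ea !linearD /= db -!(commf_evp _ bd).
rewrite -!addrA; congr (_ + _).
rewrite [RHS]addrCA addrCA; congr (_ + _).
by rewrite [RHS]addrCA; congr (_ + _); rewrite addrC addrAC addrC addrA.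
Qed.

Definition nilf a := exists k, forall v, iter k a v = 0.

Lemma nilf_sub n t : commf n t -> nilf n -> nilf t -> nilf (n - t).
Proof.
move=> nt [k kn] [l lt]; exists (k + l)%N => v.
have : iter k n v = 0 /\ iter l t v = 0 by [].
move En: (k + l)%N => N; elim: N => [|N IH] in k l v En {kn lt} *.
  by case: k l En => [|//] [|//] _ [].
rewrite iterSr add_lfunE opp_lfunE => -[kv lv].
rewrite [n v - _]addrC -[- t v]scaleN1r iter_lin.
case: k En kv => [|k] En kv.
  by rewrite [v]kv !linear0 !iter0 scaler0 addr0.
case: l En lv => [|l] En lv.
  by rewrite [v]lv !linear0 !iter0 scaler0 addr0.
rewrite (IH k.+1 l) ?(IH k l.+1) ?scaler0 ?addr0 //.
- by lia.
- by split; [rewrite -iterSr | rewrite (commf_iter _ _ (commf_sym nt)) lv linear0].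
- by lia.
- by split; [rewrite (commf_iter _ _ nt) kv linear0 | rewrite -iterSr].
Qed.

Lemma nilf_evp_diff a b p : commf a b -> nilf (a - b) -> evp b p = 0 ->
  nilf (evp a p).
Proof.
move=> ab [k nk] b0; have [w [wa wb E]] := evp_taylor2 p ab.
have commd c : commf c a -> commf c b -> commf c (a - b).
  by move=> ca cb v; rewrite !add_lfunE !opp_lfunE linearB /= ca cb.
have wd := commd w wa wb; pose g : 'End(V) := evp b p^`() + ((a - b) \o w)%VF.
have da : commf (a - b) a by move=> v; rewrite !add_lfunE !opp_lfunE linearB /= ab.
have db : commf (a - b) b by move=> v; rewrite !add_lfunE !opp_lfunE linearB /= ab.
have gd : commf g (a - b).
  apply: commd => v; rewrite /g [LHS]add_lfunE [in RHS]add_lfunE !comp_lfunE linearD.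
    by rewrite wa da (commf_evp _ (commf_sym ab)).
  by rewrite wb db evp_comm.
have Eg v : evp a p v = (a - b) (g v).
  rewrite E b0 zero_lfunE add0r [g v]add_lfunE comp_lfunE [RHS]linearD /=.
  by rewrite -(commd _ (commf_evp _ (commf_sym ab)) (@evp_comm _ _ b _)).
exists k => v; suff -> : iter k (evp a p) v = iter k (a - b) (iter k g v).
  exact: nk.
elim: {nk} k v => // k IH v; rewrite iterS IH Eg /=; congr ((a - b) _).
by rewrite (commf_iter _ _ (commf_sym gd)).
Qed.

(** For $d = a - b$ the Taylor expansion reads $q'(b) d = - d^2 w$, and Bezout inverts $q'(b)$; so
    $d^{k+2} = 0$ implies $d^{k+1} = 0$. *)
Lemma evp_separable_uniq a b q : separable_poly q -> commf a b ->
  nilf (a - b) -> evp a q = 0 -> evp b q = 0 -> a = b.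
Proof.
move=> sq ab [k nk] a0 b0; have [w [wa wb E]] := evp_taylor2 q ab.
move: sq; rewrite unlock => /Bezout_eq1_coprimepP[[x y] /= bez].
set d := a - b in nk E.
have commd c : commf c a -> commf c b -> commf c d.
  by move=> ca cb v; rewrite !add_lfunE !opp_lfunE linearB /= ca cb.
suff d0 v : d v = 0 by apply/subr0_eq/lfunP => v; rewrite d0 zero_lfunE.
elim: k v nk => [|[|k] IH] v nk; [by rewrite [d v]nk | exact: nk |].
apply: IH => {}v; have : evp b q^`() (iter k.+1 d v) = 0.
  have := E (iter k d v); rewrite a0 b0 !zero_lfunE add0r => /esym/eqP.
  rewrite addr_eq0 => /eqP->.
  rewrite -(commf_iter _ _ (commf_sym (commd w wa wb))) -!iterS.
  by rewrite nk oppr0.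
move=> z; rewrite -[LHS](evp1 b) -bez evpD add_lfunE !evpM b0 zero_lfunE z.
by rewrite !linear0 addr0.
Qed.

(* If [r, psi] = c and c commutes with r, then [q(r), psi] = q'(r) c. *)
Lemma double_commutator0 (r psi : 'End(V)) q (N : {vspace V}) (c : V -> V) :
  separable_poly q ->
  {in N, forall u, r u \in N} -> {in N, forall u, psi u \in N} ->
  {in N, forall u, evp r q u = 0} ->
  {in N, forall u, c u = r (psi u) - psi (r u)} ->
  {in N, forall u, r (c u) = c (r u)} ->
  {in N, forall u, c u = 0}.
Proof.
move=> sq rN psiN q0 cE rc.
have cN u : u \in N -> c u \in N by move=> Nu; rewrite cE // memvB ?rN ?psiN ?rN.
have stN p u : u \in N -> evp r p u \in N by apply: evp_stable.
have key p u : u \in N ->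
  evp r p (psi u) - psi (evp r p u) = evp r p^`() (c u).
  elim/poly_ind: p u => [|p k IH] u Nu.
    by rewrite deriv0 !evp0 !zero_lfunE linear0 subrr.
  rewrite derivD derivM derivX derivC addr0 mulr1 !evpD !add_lfunE !evpMX !evpC.
  rewrite linearD linearZ /= opprD addrACA subrr addr0.
  rewrite rc // -IH ?rN // [RHS]addrC addrA; congr (_ - _).
  by rewrite cE // linearB /= subrK.
have D0 u : u \in N -> evp r q^`() (c u) = 0.
  by move=> Nu; rewrite -key // !q0 ?psiN // linear0 subrr.
move: sq; rewrite unlock => /Bezout_eq1_coprimepP[[x y] /= bez] u Nu.
rewrite -[LHS](evp1 r) -bez evpD add_lfunE !evpM D0 // linear0 addr0.
by rewrite q0 ?cN // linear0.
Qed.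

(** [t] is injective on [t @: M], so by dimension it maps this space onto itself, and [t m] is the
    image of some [t m1]. *)
Lemma ker_im_split t (M : {vspace V}) :
  {in M, forall v, t v \in M} -> {in M, forall v, t (t v) = 0 -> t v = 0} ->
  {in M, forall m, exists m0 m1, [/\ m0 \in M, m1 \in M, t m0 = 0 & m = m0 + t m1]}.
Proof.
move=> tM t2 m Mm.
have sub : (t @: M <= M)%VS by apply/subvP => _ /memv_imgP[v Mv ->]; apply: tM.
have eqi : (t @: (t @: M) = t @: M)%VS.
  apply/eqP; rewrite eqEdim limgS //= (limg_dim_eq (f := t) (U := (t @: M)%VS)) //.
  apply/eqP; rewrite -subv0; apply/subvP => _ /memv_capP[/memv_imgP[v Mv ->]].
  by rewrite memv_ker memv0 => /eqP/(t2 _ Mv)->.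
have : t m \in (t @: (t @: M))%VS by rewrite eqi memv_img.
case/memv_imgP => _ /memv_imgP[m1 Mm1 ->] E.
exists (m - t m1), m1; split; rewrite ?subrK ?memvB ?tM //.
by rewrite linearB /= E subrr.
Qed.

End Operators.

(** * Semisimple endomorphisms and uniqueness of Jordan components *)

Section Semisimple.
Variables (F : fieldType) (V : vectType F).
Implicit Types (a b c s n t w : 'End(V)) (p q : {poly F}) (u v : V).

Lemma linfunE (U W : vectType F) (f : U -> W) : linear f -> linfun f =1 f.
Proof.
move=> Hf; pose ff : {linear U -> W} := HB.pack f (GRing.isLinear.Build _ _ _ _ f Hf).
exact: (lfunE ff).
Qed.

Definition comm_endo a : 'End('End(V)) :=
  linfun (fun f : 'End(V) => (a \o f)%VF - (f \o a)%VF).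

Lemma comm_endoE a b : comm_endo a b = (a \o b)%VF - (b \o a)%VF.
Proof.
apply: (@linfunE _ _ (fun f : 'End(V) => (a \o f)%VF - (f \o a)%VF)) => k f g.
rewrite comp_lfunDl comp_lfunDr -comp_lfunZl -comp_lfunZr scalerBr.
by rewrite opprD addrACA.
Qed.

Lemma comm_endovE a b v : comm_endo a b v = a (b v) - b (a v).
Proof. by rewrite comm_endoE add_lfunE opp_lfunE !comp_lfunE. Qed.

(** The commutator of [s] with [projv U] lies in the space [M] of maps into [U] vanishing on [U].
    There the commutator with [s] has the same kernel as its square, so this defect is the
    commutator of some [b] up to a term commuting with [s]. The projection [projv U - b] then
    commutes with [s], and its kernel is the complement. *)
Lemma separable_semisimple s q : separable_poly q -> evp s q = 0 ->
  semisimple_endo s.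
Proof.
move=> sq s0 U /subvP sU0.
have sU v : v \in U -> s v \in U by move=> Uv; apply: sU0; apply: memv_img.
have [M HM] : exists M : {vspace 'End(V)}, forall f : 'End(V), f \in M <->
    (forall v, f v \in U) /\ (forall v, v \in U -> f v = 0).
  apply: vspace_of_pred => [|k f g [fU f0] [gU g0]].
    by split=> v; rewrite ?zero_lfunE ?mem0v.
  split=> v; rewrite add_lfunE scale_lfunE; first by rewrite memvD ?memvZ.
  by move=> Uv; rewrite f0 ?g0 // scaler0 addr0.
have tM : {in M, forall f, comm_endo s f \in M}.
  move=> f /HM[fU f0]; apply/HM; split=> v; rewrite comm_endovE.
    by rewrite memvB ?sU.
  by move=> Uv; rewrite !f0 ?sU // linear0 subrr.
have t2 f : comm_endo s (comm_endo s f) = 0 -> comm_endo s f = 0.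
  move=> f0; apply/lfunP => v; rewrite zero_lfunE.
  apply: (@double_commutator0 F V s f q fullv (comm_endo s f)) (memvf v) => // u _;
    rewrite ?memvf ?s0 ?zero_lfunE //; first exact: comm_endovE.
  by apply/eqP; rewrite -subr_eq0 -comm_endovE f0 zero_lfunE.
pose pi := projv U; have Mpi : comm_endo s pi \in M.
  apply/HM; split=> v; rewrite comm_endovE; first by rewrite memvB ?sU ?memv_proj.
  by move=> Uv; rewrite !projv_id ?sU // subrr.
have [a [b [_ Mb a0 Epi]]] := ker_im_split tM (fun f _ => @t2 f) Mpi.
pose f := pi - b; have f0 : comm_endo s f = 0.
  by apply: t2; rewrite linearB /= Epi addrK a0.
have fU v : f v \in U.
  by rewrite add_lfunE opp_lfunE memvB ?memv_proj //; case/HM: Mb.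
have fid v : v \in U -> f v = v.
  by move=> Uv; rewrite add_lfunE opp_lfunE projv_id //; case/HM: Mb => _ ->; rewrite ?subr0.
have sf v : f (s v) = s (f v).
  apply/esym/eqP; rewrite -subr_eq0 -comm_endovE f0 zero_lfunE //.
exists (lker f); split.
- apply/subvP => _ /memv_imgP[v kv ->]; move: kv; rewrite !memv_ker sf => /eqP->.
  by rewrite linear0.
- apply/eqP; rewrite -subv0; apply/subvP => v /memv_capP[Uv].
  by rewrite memv_ker memv0 fid.
apply/eqP; rewrite eqEsubv subvf; apply/subvP => v _.
rewrite -(subrK (f v) v) addrC memv_add // memv_ker linearB /= (fid (f v)) //.
by rewrite subrr.
Qed.

(** A stable complement in [N] of the kernel of [evp a p] carries an operator both injective and
    nilpotent, hence is zero. *)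
Lemma semisimple_nilf0 a p (N : {vspace V}) :
  {in N, forall v, a v \in N} ->
  (forall U, (U <= N)%VS -> {in U, forall v, a v \in U} -> exists W,
     [/\ (W <= N)%VS, {in W, forall v, a v \in W},
         (U :&: W = 0)%VS & (N <= U + W)%VS]) ->
  nilf (evp a p) -> {in N, forall v, evp a p v = 0}.
Proof.
move=> aN ss [k nk].
have [||W [sWN aW UW0 sN]] := ss (N :&: lker (evp a p))%VS.
- exact: capvSl.
- move=> v /memv_capP[Nv]; rewrite !memv_cap aN //= !memv_ker evp_comm => /eqP->.
  by rewrite linear0.
suff W0 : W = 0%VS.
  move=> v Nv; have := subvP sN v Nv; rewrite W0 addv0 => /memv_capP[_].
  by rewrite memv_ker => /eqP.
apply/eqP; rewrite -subv0; apply/subvP => v Wv; rewrite memv0; apply/eqP.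
have {nk} := nk v; elim: k v Wv => [//|k IH] v Wv; rewrite iterSr => z.
have fW : evp a p v \in W by apply: evp_stable.
have /IH-/(_ z) f0 := fW.
suff : v \in (N :&: lker (evp a p) :&: W)%VS by rewrite UW0 memv0 => /eqP.
by rewrite !memv_cap (subvP sWN) // memv_ker f0 eqxx.
Qed.

(** [s - evp a g] is a difference of commuting nilpotents, so [evp s q] is nilpotent, and zero
    because [s] is semisimple. Then [s] and [evp a g] are commuting roots of [q] with nilpotent
    difference. *)
Lemma jordan_components_unique a s n q g m :
  jordan_components a s n -> separable_poly q ->
  evp a (q \Po g) = 0 -> evp a (('X - g) ^+ m) = 0 -> s = evp a g.
Proof.
move=> [aE sn ss nn] sq q0 X0.
have as_ : commf a s by move=> v; rewrite !aE linearD /= sn.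
have an : commf a n by move=> v; rewrite !aE linearD /= sn.
have nE v : n v = a v - s v by rewrite aE addrAC subrr add0r.
set s0 := evp a g; have ss0 : commf s s0 by apply/commf_sym/commf_evp.
have dn : nilf (s - s0).
  have -> : s - s0 = evp a ('X - g) - n.
    apply/lfunP => v; rewrite !(add_lfunE, opp_lfunE) nE evpB add_lfunE opp_lfunE.
    by rewrite evpX opprB [RHS]addrC addrA subrK.
  apply: nilf_sub => //; first exact: commf_evp.
  by exists m => v; rewrite -evp_exp X0 zero_lfunE.
rewrite evp_comp -/s0 in q0; apply: (evp_separable_uniq sq) => //.
apply/lfunP => v; rewrite zero_lfunE.
suff H : {in fullv, forall u, evp s q u = 0} by apply: H; rewrite memvf.
apply: semisimple_nilf0 => [u _||]; first by rewrite memvf.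
  move=> U _ sU; have [|W [sW UW0 UWf]] := ss U.
    by apply/subvP => _ /memv_imgP[u Uu ->]; apply: sU.
  exists W; split=> //; rewrite ?subvf ?UWf // => u Wu.
  by apply: (subvP sW); apply: memv_img.
exact: nilf_evp_diff dn q0.
Qed.

End Semisimple.

(** * Nilpotency from traces *)

Section MatrixTrace.
Variables (F : fieldType) (n : nat).
Implicit Types (t e z : 'M[F]_n.+1).

(** The projection onto the part where [t] is invertible: the characteristic polynomial is
    ['X^k * q] with [q] prime to ['X], and Bezout separates the two factors. *)
Lemma fitting_idempotent t : exists w : {poly F}, let e := t * horner_mx t w in
  e * e = e /\ exists k, ((1 - e) * t) ^+ k = 0.
Proof.
have [k [q nq Dx]] := multiplicity_XsubC (char_poly t) 0.
rewrite subr0 in Dx; rewrite (monic_neq0 (char_poly_monic t)) /= in nq.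
(* The exponent [k.+1] provides the factor [t] of [e] even when [k] is zero. *)
have /Bezout_eq1_coprimepP[[u v] /= bez] : coprimep ('X ^+ k.+1) q.
  by rewrite coprimep_expl // coprimep_sym coprimepX.
pose h : {rmorphism {poly F} -> 'M[F]_n.+1} := horner_mx t; have hX : h 'X = t by apply: horner_mx_X.
have kill p : 'X ^+ k * q %| p -> h p = 0.
  case/dvdpP => r ->; rewrite rmorphM /= [_ * q]mulrC -Dx.
  by rewrite /h /= Cayley_Hamilton mulr0.
have De : t * h (u * 'X^k) = h (u * 'X^(k.+1)).
  by rewrite -{1}hX -rmorphM /= exprS mulrCA.
exists (u * 'X^k); rewrite -/h /= De.
have D1 : 1 - h (u * 'X^(k.+1)) = h (v * q).
  by rewrite -(rmorph1 h) -bez rmorphD addrAC subrr add0r.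
split.
  apply/eqP; rewrite -subr_eq0 -[X in _ - X]mulr1 -mulrBr -opprB D1 mulrN oppr_eq0.
  rewrite -rmorphM kill //; have -> : u * 'X^(k.+1) * (v * q) = u * 'X * v * ('X^k * q).
    by rewrite exprS; ring.
  exact: dvdp_mull.
exists k.+1; rewrite D1 -{1}hX -rmorphM -rmorphXn kill //.
have -> : (v * q * 'X) ^+ k.+1 = v * q * 'X * (v * q) ^+ k * 'X^k.
  by rewrite exprS [in LHS]exprMn; ring.
have -> : v * q * 'X * (v * q) ^+ k * 'X^k = (v * 'X * (v * q) ^+ k) * ('X^k * q) by ring.
exact: dvdp_mull.
Qed.

(** Over polynomials [x - Z] divides $x^k - Z^k = x^k$; by determinants the characteristic
    polynomial is a power of ['X]. *)
Lemma nilpotent_trace0 z k : z ^+ k = 0 -> \tr z = 0.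
Proof.
move=> zk; pose Z := map_mx polyC z; pose x : 'M[{poly F}]_n.+1 := 'X%:M.
have cxZ : GRing.comm x Z by apply: comm_scalar_mx.
have Zk : Z ^+ k = 0 by rewrite /Z -rmorphXn /= zk map_mx0.
have : char_poly z %| ('X - 0%:P) ^+ (k * n.+1).
  rewrite subr0; have := subrXX_comm k cxZ.
  rewrite Zk subr0 -[x ^+ k](rmorphXn (@scalar_mx _ n.+1)) /= => /(congr1 determinant).
  rewrite det_mulmx det_scalar -exprM => ->; exact: dvdp_mulr.
case/dvdp_exp_XsubCP => j _; rewrite subr0 => E.
have {}E : char_poly z = 'X^j.
  by apply/eqP; rewrite -eqp_monic ?char_poly_monic ?monicXn.
apply/eqP; rewrite -oppr_eq0 -char_poly_trace // E coefXn.
have := size_char_poly z; rewrite E size_polyXn => -[->].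
by rewrite /= (ltn_eqF (ltnSn n)).
Qed.

Hypothesis charF0 : [pchar F] =i pred0.

Lemma idempotent_trace0 e : e * e = e -> \tr e = 0 -> e = 0.
Proof.
move=> ee tr0; pose C := col_base e; pose R := row_base e.
have CR : C *m R = e by apply: mulmx_base.
have RC : R *m C = 1%:M.
  apply: (row_free_inj (row_base_free e)); apply: (row_full_inj (col_base_full e)).
  by rewrite mul1mx -/R -/C CR -mulmxA CR mulmxA CR.
have : \tr e = (\rank e)%:R by rewrite -{1}CR mxtrace_mulC RC mxtrace1.
rewrite tr0 => /esym/eqP; have /pcharf0P-> := charF0.
by rewrite mxrank_eq0 => /eqP.
Qed.

(** The Fitting idempotent of [z] is a combination of positive powers of [z], so its trace vanishes;
    that trace is its rank, which characteristic zero detects. *)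
Lemma trace_powers0_nilpotent z : (forall k, \tr (z ^+ k.+1) = 0) ->
  exists k, z ^+ k = 0.
Proof.
move=> tr0; have [w [ee [k nil]]] := fitting_idempotent z.
set e := z * _ in ee nil; suff e0 : e = 0 by exists k; rewrite e0 subr0 mul1r in nil.
apply: idempotent_trace0 => //.
rewrite /e -{1}(horner_mx_X z) -rmorphM /=.
rewrite -[w]coefK poly_def mulr_sumr rmorph_sum linear_sum big1 // => i _.
rewrite -scalerAr -exprS /= horner_mxZ linearZ /= rmorphXn /= horner_mx_X tr0.
by rewrite mulr0.
Qed.

End MatrixTrace.

(** * Splitting fields and rational relations *)

Lemma irreducible_factor (F : fieldType) (p : {poly F}) : (1 < size p)%N ->
  exists2 r, r %| p & irreducible_poly r.
Proof.
move En: (size p) => n; elim/ltn_ind: n => n IH in p En *; move=> gt1.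
have [[q [q1 qp qn]]|none] :=
  classic (exists q : {poly F}, [/\ size q != 1%N, q %| p & ~~ (q %= p)]).
  have nz_p : p != 0 by rewrite -size_poly_eq0 En; lia.
  have nz_q : q != 0 by apply: contraNneq nz_p => q0; move: qp; rewrite q0 dvd0p.
  have lt : (size q < n)%N.
    by rewrite -En ltn_neqAle (dvdp_size_eqp qp) qn dvdp_leq.
  have [|r rq irr] := IH (size q) lt q erefl.
    by move: nz_q q1; rewrite -size_poly_eq0; lia.
  by exists r => //; apply: dvdp_trans qp.
exists p; rewrite ?dvdpp //; split; first by rewrite En.
move=> q q1 qp; apply/negPn/negP => qn; apply: none; by exists q.
Qed.

(* The functionals replace finiteness of the extension: they compose in towers. *)
Lemma splitting_extension (F : fieldType) (p : {poly F}) : p != 0 ->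
  exists (E : fieldType) (i : {rmorphism F -> E}),
    (exists zs, map_poly i p %= \prod_(z <- zs) ('X - z%:P)) /\
    (forall c : E, c != 0 -> exists t : E -> F,
      [/\ {morph t : x y / x + y}, forall a x, t (i a * x) = a * t x & t c != 0]).
Proof.
move En: (size p) => n; elim: n => [|n IH] in F p En *.
  by move/eqP: En; rewrite size_poly_eq0 => /eqP->; rewrite eqxx.
move=> nz_p; have [le1|gt1] := leqP (size p) 1.
  exists F, idfun; split.
    exists [::]; rewrite big_nil -size_poly_eq1 size_map_poly.
    by rewrite eqn_leq le1 size_poly_gt0.
  by move=> c nzc; exists id; split.
have [r rp irr] := irreducible_factor gt1.
have [K _ [x rx _]] := irredp_FAdjoin irr.
pose i : {rmorphism F -> K} := in_alg K.
have /factor_theorem[q Dq] : root (map_poly i p) x.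
  by rewrite -(divpK rp) rmorphM rootM rx orbT.
have nz_q : q != 0.
  by apply: contraNneq nz_p => q0; rewrite -(map_poly_eq0 i) Dq q0 mul0r.
have sq : size q = n.
  apply/eqP; rewrite -eqSS -En -(size_map_poly i p) Dq.
  by rewrite size_Mmonic ?monicXsubC // size_XsubC addn2.
have [E [j [[zs Ezs] sepE]]] := IH _ q sq nz_q.
exists E, (j \o i : {rmorphism F -> E}); split.
  exists (j x :: zs); rewrite map_poly_comp Dq rmorphM /= big_cons mulrC.
  by rewrite map_polyXsubC eqp_mull.
move=> c /sepE[t [tD tZ nz]].
have [k nzk] : exists k, coord (vbasis {:K}) k (t c) != 0.
  apply: NNPP => none; case/negP: nz; rewrite (coord_vbasis (memvf (t c))).
  rewrite big1 // => k _; have [->|nzk] := eqVneq (coord (vbasis {:K}) k (t c)) 0.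
    by rewrite scale0r.
  by case: none; exists k.
exists (coord (vbasis {:K}) k \o t); split=> // [u v|a u] /=.
  by rewrite tD linearD.
by rewrite tZ /i /= mulr_algl linearZ.
Qed.

Section RationalDual.
Variables (E : fieldType) (charE0 : [pchar E] =i pred0).

Lemma intr_neq0 (m : int) : m != 0 -> (m%:~R : E) != 0.
Proof.
by case: m => [[|k]|k] // _; rewrite ?NegzE ?mulrNz ?oppr_eq0; apply: natr_neq0.
Qed.

Definition ratE (r : rat) : E := (numq r)%:~R / (denq r)%:~R.

Lemma ratE_frac (a b : int) : b != 0 -> ratE (a%:~R / b%:~R) = a%:~R / b%:~R.
Proof.
move=> nzb; set r := a%:~R / _; have nzd := denq_neq0 r.
apply/eqP; rewrite /ratE eqr_div ?intr_neq0 // -!intrM; apply/eqP; congr (_%:~R).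
apply: (@intr_inj rat); rewrite !intrM.
have nzb' : b%:~R != 0 :> rat by rewrite intr_eq0.
have nzd' : (denq r)%:~R != 0 :> rat by rewrite intr_eq0.
apply/eqP; rewrite -eqr_div // divq_num_den.
by [].
Qed.

Lemma ratE_add : {morph ratE : x y / x + y}.
Proof.
move=> x y; rewrite -[x]divq_num_den -[y]divq_num_den.
set a := numq x; set b := denq x; set c := numq y; set d := denq y.
have [nzb nzd] : b != 0 /\ d != 0 by split; apply: denq_neq0.
have nzQ (k : int) : k != 0 -> (k%:~R : rat) != 0 by rewrite intr_eq0.
have -> : a%:~R / b%:~R + c%:~R / d%:~R = (a * d + c * b)%:~R / (b * d)%:~R :> rat.
  by rewrite addf_div ?nzQ // intrD !intrM.
rewrite !ratE_frac ?mulf_neq0 // addf_div ?intr_neq0 //.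
by rewrite intrD !intrM.
Qed.

Lemma ratE_mul : {morph ratE : x y / x * y}.
Proof.
move=> x y; rewrite -[x]divq_num_den -[y]divq_num_den.
set a := numq x; set b := denq x; set c := numq y; set d := denq y.
have [nzb nzd] : b != 0 /\ d != 0 by split; apply: denq_neq0.
have -> : a%:~R / b%:~R * (c%:~R / d%:~R) = (a * c)%:~R / (b * d)%:~R :> rat.
  by rewrite mulf_div !intrM.
rewrite !ratE_frac ?mulf_neq0 // mulf_div.
by rewrite !intrM.
Qed.

Lemma ratE_int (m : int) : ratE m%:~R = m%:~R.
Proof. by have := @ratE_frac m 1 isT; rewrite !divr1. Qed.

(* [c] is a rational vector orthogonal to all rational relations of [lam];
   positive definiteness over the rationals makes the pairing nonzero. *)
Lemma rational_dual n (lam : 'I_n -> E) : (exists i, lam i != 0) ->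
  exists c : 'I_n -> E, \sum_i c i * lam i != 0 /\
   forall a : 'I_n -> int, \sum_i (a i)%:~R * lam i = 0 ->
     \sum_i (a i)%:~R * c i = 0.
Proof.
move=> [i0 nz0].
have ratE0 : ratE 0 = 0 by rewrite (ratE_int 0).
have [U HU] : exists U : {vspace 'rV[rat]_n}, forall a, a \in U <->
    \sum_i ratE (a 0 i) * lam i = 0.
  apply: vspace_of_pred => [|k u v u0 v0].
    by rewrite big1 // => i _; rewrite mxE ratE0 mul0r.
  under eq_bigr => i _ do rewrite !mxE ratE_add ratE_mul mulrDl -mulrA.
  rewrite big_split -mulr_sumr /=. by rewrite u0 mulr0 add0r v0.
pose M := \matrix_(i < \dim U) (vbasis U)`_i.
pose f : 'Hom('rV[rat]_n, 'rV[rat]_(\dim U)) := linfun (mulmxr M^T).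
have fE c : f c = c *m M^T by rewrite lfunE.
have [c kc nzc] : exists2 c, c \in lker f & c != 0.
  exists (vpick (lker f)); first exact: memv_pick.
  rewrite vpick0 -dimv_eq0 -lt0n.
  have := limg_ker_dim f fullv; rewrite capfv dimvf dim_matrix mul1r => D.
  have : (\dim (f @: fullv) <= \dim U)%N.
    by rewrite (leq_trans (dimvS (subvf _))) // dimvf dim_matrix mul1r.
  have : (\dim U < n)%N.
    have := dimv_leqif_eq (subvf U); rewrite dimvf dim_matrix mul1r => D'.
    rewrite (ltn_leqif D'); apply: contra nz0 => /eqP eqU.
    have : delta_mx 0 i0 \in U by rewrite eqU memvf.
    move/HU; rewrite (bigD1 i0) //= big1 ?addr0 => [|i ne].
      by rewrite mxE !eqxx (ratE_int 1) mul1r => ->.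
    by rewrite mxE (negPf ne) ratE0 mul0r.
  by lia.
have orth u : u \in U -> \sum_i c 0 i * u 0 i = 0.
  move=> /coord_vbasis->; under eq_bigr => i _ do rewrite summxE mulr_sumr.
  rewrite exchange_big big1 // => j _.
  under eq_bigr => i _ do rewrite mxE mulrCA.
  rewrite -mulr_sumr; suff -> : \sum_i c 0 i * (vbasis U)`_j 0 i = 0 by rewrite mulr0.
  move: kc; rewrite memv_ker fE => /eqP/matrixP/(_ 0 j); rewrite mxE [RHS]mxE => E0.
  by rewrite -[RHS]E0; apply: eq_bigr => i _; rewrite !mxE.
exists (fun i => ratE (c 0 i)); split.
  apply: contra nzc => /eqP/HU/orth c0; apply/eqP/rowP => i; rewrite mxE.
  apply/eqP; rewrite -sqrf_eq0; apply/eqP; move: i (erefl true) => i _.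
  by apply: (psumr_eq0P _ c0) => // j _; rewrite -expr2 sqr_ge0.
move=> a a0; pose u : 'rV[rat]_n := \row_i (a i)%:~R.
have /orth : u \in U.
  by apply/HU; rewrite -[RHS]a0; apply: eq_bigr => i _; rewrite mxE ratE_int.
move/(congr1 ratE); rewrite ratE0 (big_morph ratE ratE_add ratE0) => E0; rewrite -[RHS]E0.
by apply: eq_bigr => i _; rewrite ratE_mul mxE ratE_int mulrC.
Qed.

End RationalDual.

Lemma interpolation (E : fieldType) (s : seq E) (v : E -> E) :
  exists p : {poly E}, {in s, forall z, p.[z] = v z}.
Proof.
elim: s => [|a s [p Hp]]; first by exists 0.
have [as_|nas] := boolP (a \in s).
  by exists p => z; rewrite inE => /predU1P[->|]; apply: Hp.
pose w := \prod_(z <- s) ('X - z%:P).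
have wa : w.[a] != 0 by rewrite -rootE root_prod_XsubC.
exists (p + ((v a - p.[a]) / w.[a]) *: w) => z; rewrite inE hornerD hornerZ.
case/predU1P => [->|zs]; first by rewrite divfK // addrC subrK.
have /rootP-> : root w z by rewrite root_prod_XsubC.
by rewrite mulr0 addr0 Hp.
Qed.

(** * The adjoint action on matrices and its Jordan parts *)

Section AdMatrix.
Variables (F : fieldType) (n : nat).
Implicit Types (x y Y : 'M[F]_n.+1) (p : {poly F}).

Definition adm x : 'End('M[F]_n.+1) := linfun (fun Y => x * Y - Y * x).

Lemma admE x Y : adm x Y = x * Y - Y * x.
Proof.
apply: (@linfunE _ _ _ (fun Y => x * Y - Y * x)) => k A B.
by rewrite mulrDr mulrDl -scalerAr -scalerAl scalerBr opprD addrACA.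
Qed.

Lemma admB x y Y : adm (x - y) Y = adm x Y - adm y Y.
Proof.
rewrite !admE mulrBl mulrBr !opprB addrACA [RHS]addrACA; congr (_ + _).
by rewrite addrC.
Qed.

Lemma commf_adm x y : x * y = y * x -> commf (adm x) (adm y).
Proof.
move=> xy Y; rewrite !admE !mulrBr !mulrBl !mulrA !opprB xy.
have -> : Y * x * y = Y * y * x by rewrite -!mulrA xy.
by rewrite addrACA [RHS]addrACA [- _ - _]addrC.
Qed.

Lemma nilf_adm x k : x ^+ k = 0 -> nilf (adm x).
Proof.
move=> xk; pose l : 'End('M[F]_n.+1) := linfun (mulmx x).
pose r : 'End('M[F]_n.+1) := linfun (mulmxr x).
have lE Y : l Y = x * Y by rewrite lfunE.
have rE Y : r Y = Y * x by rewrite lfunE.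
have -> : adm x = l - r.
  by apply/lfunP => Y; rewrite admE add_lfunE opp_lfunE lE rE.
apply: nilf_sub; first by move=> Y; rewrite !rE !lE mulrA.
  exists k => Y; suff -> j : iter j l Y = x ^+ j * Y by rewrite xk mul0r.
  by elim: j => [|j /= ->]; rewrite ?mul1r // lE mulrA exprS.
exists k => Y; suff -> j : iter j r Y = Y * x ^+ j by rewrite xk mulr0.
by elim: j => [|j /= ->]; rewrite ?mulr1 // rE -mulrA exprSr.
Qed.

(** In an eigenbasis of [x] the adjoint action multiplies the entry of index $i, j$ by $d_i -
    d_j$. *)
Lemma adm_diag (P : 'M[F]_n.+1) (d : 'rV[F]_n.+1) x p (Z : 'M[F]_n.+1) :
  P \in unitmx -> x = invmx P *m diag_mx d *m P ->
  evp (adm x) p (invmx P *m Z *m P) =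
  invmx P *m (\matrix_(i, j) (p.[d 0 i - d 0 j] * Z i j)) *m P.
Proof.
move=> uP Dx; elim/poly_ind: p Z => [|p c IH] Z.
  rewrite evp0 zero_lfunE (_ : \matrix_(i, j) _ = 0) ?mulmx0 ?mul0mx //.
  by apply/matrixP => i j; rewrite !mxE horner0 mul0r.
rewrite evpD add_lfunE evpMX evpC.
have -> : adm x (invmx P *m Z *m P) =
    invmx P *m (\matrix_(i, j) ((d 0 i - d 0 j) * Z i j)) *m P.
  have mulP A B : invmx P *m A *m P * (invmx P *m B *m P) = invmx P *m (A *m B) *m P.
    by rewrite -mulmxE !mulmxA (mulmxK uP).
  rewrite admE Dx !mulP -mulmxBl -mulmxBr; congr (_ *m _ *m _).
  apply/matrixP => i j; rewrite mul_diag_mx mul_mx_diag !mxE mulrBl.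
  by rewrite [Z i j * _]mulrC.
rewrite IH scalemxAl scalemxAr -mulmxDl -mulmxDr; congr (_ *m _ *m _).
by apply/matrixP => i j; rewrite !mxE hornerMXaddC; ring.
Qed.

End AdMatrix.

Section ExtendScalars.
Variables (F E : fieldType) (i : {rmorphism F -> E}) (n : nat).
Implicit Types (x y Y : 'M[F]_n.+1) (p : {poly F}).

Lemma map_evp_adm x p Y :
  map_mx i (evp (adm x) p Y) = evp (adm (map_mx i x)) (map_poly i p) (map_mx i Y).
Proof.
elim/poly_ind: p Y => [|p c IH] Y; first by rewrite rmorph0 !evp0 !zero_lfunE map_mx0.
rewrite rmorphD rmorphM /= map_polyX map_polyC !evpD !add_lfunE !evpMX !evpC.
by rewrite map_mxD map_mxZ IH !admE map_mxB !map_mxM.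
Qed.

Lemma evp_adm_extend x p : evp (adm x) p = 0 ->
  evp (adm (map_mx i x)) (map_poly i p) = 0.
Proof.
move=> p0; apply/lfunP => Y; rewrite zero_lfunE [Y]matrix_sum_delta.
rewrite linear_sum big1 // => j _; rewrite linear_sum big1 // => k _.
by rewrite linearZ /= -(map_delta_mx i) -map_evp_adm p0 zero_lfunE map_mx0 scaler0.
Qed.

Lemma evp_adm_extend_eq x y p : (forall Y, evp (adm x) p Y = adm y Y) ->
  evp (adm (map_mx i x)) (map_poly i p) = adm (map_mx i y).
Proof.
move=> Eg; apply/lfunP => Z; rewrite [Z]matrix_sum_delta.
rewrite !linear_sum; apply: eq_bigr => j _; rewrite !linear_sum; apply: eq_bigr => k _.
by rewrite !linearZ /= -(map_delta_mx i) -map_evp_adm Eg !admE map_mxB !map_mxM.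
Qed.

End ExtendScalars.

Section JordanAd.
Variables (F : fieldType) (charF0 : [pchar F] =i pred0) (n : nat).
Implicit Types (x y Y : 'M[F]_n.+1) (p q g : {poly F}).

Lemma separable_diagonalizable (E : fieldType) (s : 'M[E]_n.+1) (q : {poly E}) zs :
  separable_poly q -> q %= \prod_(z <- zs) ('X - z%:P) -> horner_mx s q = 0 ->
  exists P d, P \in unitmx /\ s = invmx P *m diag_mx d *m P.
Proof.
move=> sq Eq s0.
have uzs : uniq zs by rewrite -separable_prod_XsubC -(eqp_separable Eq).
have /diagonalizableP[P uP] : exists2 rs, uniq rs &
    mxminpoly s %| \prod_(x <- rs) ('X - x%:P).
  by exists zs; rewrite // -(eqp_dvdr _ Eq) mxminpoly_min.
move/(diagonalizable_forLR uP) => [d Ds]; exists P, d; split=> //.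
by rewrite Ds mxpoly.conjVmx.
Qed.

Lemma adm_diag_kill (E : fieldType) (s P : 'M[E]_n.+1) d : P \in unitmx ->
  s = invmx P *m diag_mx d *m P ->
  exists2 r, separable_poly r & evp (adm s) r = 0.
Proof.
move=> uP Ds; pose zs := undup [seq d 0 i - d 0 j | i <- enum 'I_n.+1, j <- enum 'I_n.+1].
exists (\prod_(z <- zs) ('X - z%:P)); first by rewrite separable_prod_XsubC undup_uniq.
apply/lfunP => Y; have -> : Y = invmx P *m (P *m Y *m invmx P) *m P.
  by rewrite !mulmxA mulVmx // mul1mx -mulmxA mulVmx // mulmx1.
rewrite (adm_diag _ _ uP Ds) zero_lfunE (_ : \matrix_(i, j) _ = 0) ?mulmx0 ?mul0mx //.
apply/matrixP => i j; rewrite !mxE.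
have /rootP-> : root (\prod_(z <- zs) ('X - z%:P)) (d 0 i - d 0 j); last by rewrite mul0r.
rewrite root_prod_XsubC mem_undup; apply/allpairsP.
by exists (i, j); rewrite !mem_enum.
Qed.

Lemma horner_mx_comp x p q : horner_mx x (p \Po q) = horner_mx (horner_mx x q) p.
Proof.
elim/poly_ind: p => [|p c IH]; first by rewrite comp_poly0 !rmorph0.
by rewrite comp_poly_MXaddC !rmorphD !rmorphM /= IH !horner_mx_C horner_mx_X.
Qed.

(** One [g] is computed for the product of the characteristic polynomial of [x] and an annihilator
    of [adm x], so it gives the semisimple part of both. Over a splitting field [horner_mx x g] is
    diagonalizable, so a separable polynomial kills its adjoint action, and uniqueness identifies
    this action with [evp (adm x) g]. *)
Lemma jordan_adm x : exists q g, exists2 m, separable_poly q &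
  [/\ horner_mx x (q \Po g) = 0, horner_mx x (('X - g) ^+ m) = 0 &
      forall Y, evp (adm x) g Y = adm (horner_mx x g) Y].
Proof.
have [p nzp p0] := evp_kill (adm x).
have nzc : char_poly x * p != 0 by rewrite mulf_neq0 // monic_neq0 ?char_poly_monic.
have [q [g [m sq [dq dX]]]] := jordan_poly charF0 nzc.
have hkill r : char_poly x * p %| r -> horner_mx x r = 0.
  case/dvdpP => c ->; rewrite mulrCA rmorphM /=.
  by rewrite Cayley_Hamilton mul0r.
have akill r : char_poly x * p %| r -> evp (adm x) r = 0.
  by move=> d; apply: evp_dvd p0; apply: dvdp_trans d; rewrite dvdp_mull.
exists q, g, m => //; split; try exact: hkill.
move=> Y; have nzq := separable_poly_neq0 sq.
have [E [i [[zs Ezs] _]]] := splitting_extension nzq.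
have charE0 : [pchar E] =i pred0 by move=> k; rewrite (fmorph_pchar i) charF0.
pose xE := map_mx i x; pose gE := map_poly i g; pose qE := map_poly i q.
set s := horner_mx x g; pose sE := map_mx i s.
have DsE : sE = horner_mx xE gE by rewrite /sE /s map_horner_mx.
have sqE : separable_poly qE by rewrite separable_map.
have comm_xs : x * s = s * x.
  by rewrite /s -{1 4}(horner_mx_X x) -!rmorphM mulrC.
have sE0 : horner_mx sE qE = 0.
  by rewrite -map_horner_mx -horner_mx_comp hkill // map_mx0.
have [P [d [uP Ds]]] := separable_diagonalizable sqE Ezs sE0.
have [r sr r0] := adm_diag_kill uP Ds.
have nzrq : r * qE != 0 by rewrite mulf_neq0 ?separable_poly_neq0.
(* Uniqueness needs one separable polynomial annihilating both operators. *)
have [q0 [k sq0 [_ dq0]]] := separable_radical charE0 nzrq.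
have rq0 : r %| q0.
  by apply: (separable_dvd_exp sr (m := k)); apply: dvdp_trans dq0; apply: dvdp_mulr.
have qq0 : qE %| q0.
  by apply: (separable_dvd_exp sqE (m := k)); apply: dvdp_trans dq0; apply: dvdp_mull.
have commE : commf (adm xE) (adm sE).
  by apply: commf_adm; rewrite /xE /sE -!rmorphM comm_xs.
apply: (@map_mx_inj _ _ i); rewrite map_evp_adm -/gE admE map_mxB !map_mxM -/sE -admE.
suff -> : evp (adm xE) gE = adm sE by [].
apply/esym; apply: (evp_separable_uniq sq0).
- exact/commf_sym/commf_evp.
- have -> : adm sE - evp (adm xE) gE = evp (adm xE) ('X - gE) - adm (xE - sE).
    apply/lfunP => Z; rewrite !(add_lfunE, opp_lfunE) evpB add_lfunE opp_lfunE evpX.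
    by rewrite admB opprB [RHS]addrC addrA subrK.
  apply: nilf_sub.
  + apply: commf_evp; apply: commf_adm.
    by rewrite mulrBl mulrBr /xE /sE -!rmorphM comm_xs.
  + exists m => Z; rewrite -evp_exp.
    have := @evp_adm_extend _ _ i _ _ _ (akill _ dX).
    by rewrite rmorphXn rmorphB /= map_polyX => ->; rewrite zero_lfunE.
  apply: (@nilf_adm _ _ _ m).
  have := hkill _ dX; rewrite rmorphXn rmorphB /= horner_mx_X -/s => /(congr1 (map_mx i)).
  by rewrite rmorphXn /= map_mxB map_mx0.
- exact: evp_dvd r0.
apply: (evp_dvd qq0); rewrite -evp_comp.
by rewrite /qE /gE -(map_comp_poly i); apply: evp_adm_extend; apply: akill.
Qed.

End JordanAd.

Lemma evp_ker (F : fieldType) (V : vectType F) (a : 'End(V)) p v : a v = 0 -> evp a p v = p.[0] *: v.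
Proof.
move=> av; elim/poly_ind: p => [|p c IH]; first by rewrite evp0 zero_lfunE horner0 scale0r.
rewrite evpD add_lfunE evpMX evpC av linear0 add0r.
by rewrite hornerMXaddC mulr0 add0r.
Qed.

Section TraceWitness.
Variables (F : fieldType) (charF0 : [pchar F] =i pred0) (n : nat).
Implicit Types (x y Y : 'M[F]_n.+1) (p q g : {poly F}).

(* Cartan's criterion rests on this replica of the semisimple part of [x]: over
   a splitting field, [y] has rational eigenvalues depending additively on those
   of [x]; an F-linear functional brings [y] back to F. *)
Lemma trace_witness x : ~ (exists k, x ^+ k = 0) ->
  exists y p, \tr (x *m y) != 0 /\ forall Y, adm y Y = evp (adm x) p (adm x Y).
Proof.
move=> nnil; have [q [g [m sq [q0 X0 Eg]]]] := jordan_adm charF0 x.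
have [E [i [[zs Ezs] sepE]]] := splitting_extension (separable_poly_neq0 sq).
have charE0 : [pchar E] =i pred0 by move=> k; rewrite (fmorph_pchar i) charF0.
pose xE := map_mx i x; pose gE := map_poly i g; pose qE := map_poly i q.
set s := horner_mx x g in Eg; pose sE := map_mx i s.
have sqE : separable_poly qE by rewrite separable_map.
have sE0 : horner_mx sE qE = 0.
  by rewrite -map_horner_mx -horner_mx_comp q0 map_mx0.
have [P [d [uP Ds]]] := separable_diagonalizable sqE Ezs sE0.
have comm_xs : x * s = s * x.
  by rewrite /s -{1 4}(horner_mx_X x) -!rmorphM mulrC.
have nil : (x - s) ^+ m = 0.
  by have := X0; rewrite rmorphXn rmorphB /= horner_mx_X.
have [j nzj] : exists j, d 0 j != 0.
  apply: NNPP => none; apply: nnil; exists m.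
  suff s0 : s = 0 by rewrite -nil s0 subr0.
  apply: (@map_mx_inj _ _ i); rewrite -/sE Ds map_mx0 (_ : diag_mx d = 0).
    by rewrite mulmx0 mul0mx.
  apply/matrixP => k l; rewrite !mxE; have [->|nz] := eqVneq (d 0 k) 0.
    by rewrite mul0rn.
  by case: none; exists k.
have [c [nzc Hc]] := @rational_dual E charE0 _ (fun k => d 0 k) (ex_intro _ j nzj).
(* A coincidence between eigenvalue differences is an integral relation, so it passes to [c];
   interpolation can then send $d_k - d_l$ to $c_k - c_l$. *)
have rel4 k1 k2 k3 k4 : d 0 k1 - d 0 k2 = d 0 k3 - d 0 k4 ->
    c k1 - c k2 = c k3 - c k4.
  pose a k : int := (k == k1)%:R - (k == k2)%:R - (k == k3)%:R + (k == k4)%:R.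
  have aE (f : 'I_n.+1 -> E) : \sum_k (a k)%:~R * f k = f k1 - f k2 - f k3 + f k4.
    have one l : \sum_k ((k == l)%:R%:~R) * f k = f l.
      rewrite (bigD1 l) //= big1 ?addr0 ?eqxx ?mul1r // => k /negPf->.
      by rewrite mul0r.
    under eq_bigr => k _ do rewrite /a intrD !intrB mulrDl !mulrBl.
    by rewrite big_split /= !sumrB !one.
  move=> E4; have := Hc a; rewrite !aE => H.
  have {}H : c k1 - c k2 - c k3 + c k4 = 0.
    apply: H; have -> : d 0 k1 - d 0 k2 - d 0 k3 + d 0 k4 =
      (d 0 k1 - d 0 k2) - (d 0 k3 - d 0 k4) by ring.
    by rewrite E4 subrr.
  by apply: subr0_eq; rewrite -[RHS]H; ring.
have [p Hp] := interpolation
  [seq d 0 k - d 0 l | k <- enum 'I_n.+1, l <- enum 'I_n.+1]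
  (fun z => if [pick kl : 'I_n.+1 * 'I_n.+1 | d 0 kl.1 - d 0 kl.2 == z] is Some kl
            then c kl.1 - c kl.2 else 0).
have {}Hp k l : p.[d 0 k - d 0 l] = c k - c l.
  rewrite Hp; last by apply/allpairsP; exists (k, l); rewrite !mem_enum.
  case: pickP => [[k' l'] /= /eqP /rel4 //|/(_ (k, l))/=]; by rewrite eqxx.
pose yE := invmx P *m diag_mx (\row_k c k) *m P.
have adyE Z : adm yE Z = evp (adm sE) p Z.
  have -> : Z = invmx P *m (P *m Z *m invmx P) *m P.
    by rewrite !mulmxA mulVmx // mul1mx -mulmxA mulVmx // mulmx1.
  rewrite (adm_diag _ _ uP Ds) -[adm yE _]evpX (adm_diag _ _ uP (erefl yE)).
  congr (_ *m _ *m _); apply/matrixP => k l; rewrite mxE [RHS]mxE Hp hornerX.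
  by rewrite !mxE.
have EgE : evp (adm xE) gE = adm sE by apply: evp_adm_extend_eq.
have adyE2 Z : adm yE Z = evp (adm xE) (p \Po gE) Z by rewrite evp_comp EgE.
(* Both adjoint actions kill the identity matrix, which forces the constant term to vanish. *)
have [f Df] : exists f, p \Po gE = f * 'X.
  have : root (p \Po gE) 0.
    have := adyE2 1; rewrite evp_ker ?admE ?mulr1 ?mul1r ?subrr //.
    by move/esym/eqP; rewrite scaler_eq0 oner_eq0 orbF.
  by case/factor_theorem => f; rewrite subr0; exists f.
have adyx Z : adm yE Z = evp (adm xE) f (adm xE Z) by rewrite -evpMX -Df.
pose nE := map_mx i (x - s).
have nil_ny : (nE * yE) ^+ m = 0.
  suff com : nE * yE = yE * nE.
    by rewrite exprMn_comm // /nE -rmorphXn nil /= map_mx0 mul0r.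
  have com_ns : nE * sE = sE * nE.
    by rewrite /nE /sE -!rmorphM /= mulrBl mulrBr comm_xs.
  have := @admE _ _ yE nE; rewrite adyE evp_ker ?admE ?com_ns ?subrr //.
  have p0 : p.[0] = 0 by have := Hp j j; rewrite !subrr.
  by rewrite p0 scale0r => /esym/eqP; rewrite subr_eq0 => /eqP.
have trE : \tr (xE *m yE) != 0.
  have -> : xE *m yE = sE * yE + nE * yE.
    by rewrite -mulrDl /nE rmorphB /= addrC subrK.
  rewrite linearD /= (nilpotent_trace0 nil_ny) addr0 Ds /yE.
  rewrite -mulmxE !mulmxA (mulmxK uP) -[_ *m diag_mx d *m _]mulmxA mxtrace_mulC.
  rewrite mulKVmx // mulmx_diag mxtrace_diag.
  by under eq_bigr => k _ do rewrite !mxE mulrC.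
have {adyx trE} [w [trE adyx]] : exists w, \tr (xE *m w) != 0 /\
    forall Z, adm w Z = evp (adm xE) f (adm xE Z) by exists yE.
(* Descent to [F]: [t] is applied to the entries of [w] and to the coefficients of [f]; as [x] has
   entries in [F], the trace and the adjoint identity survive. *)
have [t [tD tZ nzt]] := sepE _ trE.
have t0 : t 0 = 0 by apply: (addrI (t 0)); rewrite -tD !addr0.
have tsum I (r : seq I) (h : I -> E) : t (\sum_(k <- r) h k) = \sum_(k <- r) t (h k).
  exact: (big_morph t tD t0).
pose pF := \poly_(k < size f) t f`_k.
have map_powf k Z : map_mx i (powf (adm x) k Z) = powf (adm xE) k (map_mx i Z).
  rewrite !powfE; elim: k => //= k IH.
  by rewrite -IH !admE map_mxB !map_mxM.
exists (map_mx t w), pF; split.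
  suff -> : \tr (x *m map_mx t w) = t (\tr (xE *m w)) by [].
  rewrite /mxtrace tsum; apply: eq_bigr => k _; rewrite !mxE tsum.
  by apply: eq_bigr => l _; rewrite !mxE tZ.
move=> Y; set Z := adm x Y.
have E1 : adm w (map_mx i Y) = \sum_(k < size f) f`_k *: map_mx i (powf (adm x) k Z).
  rewrite adyx -[adm xE _](_ : map_mx i Z = _); last first.
    by rewrite /Z !admE map_mxB !map_mxM.
  rewrite /evp sum_lfunE; apply: eq_bigr => k _.
  by rewrite scale_lfunE map_powf.
rewrite (@evpE _ _ (size f)) ?size_poly // sum_lfunE.
apply/matrixP => a b; have := congr1 t (congr1 (fun M : 'M[E]_n.+1 => M a b) E1).
rewrite summxE tsum summxE => E2.
transitivity (t (adm w (map_mx i Y) a b)); last first.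
  rewrite E2; apply: eq_bigr => k _.
  by rewrite scale_lfunE coef_poly ltn_ord !mxE mulrC tZ mulrC.
have tB u v : t (u - v) = t u - t v.
  by rewrite tD -[- v]mulN1r -(rmorph1 i) -rmorphN tZ mulN1r.
rewrite !admE !mxE tB !tsum; congr (_ - _); apply: eq_bigr => k _; rewrite !mxE.
  by rewrite mulrC -tZ mulrC.
by rewrite tZ.
Qed.

End TraceWitness.

(** * Engel's theorem and Cartan's criterion *)

Section Engel.
Variables (F : fieldType) (T : vectType F) (b : 'Hom(T, 'End(T))).
Hypothesis b_alt : forall x, b x x = 0.

Lemma alt_anti x y : b x y = - b y x.
Proof.
have := b_alt (x + y); rewrite [b (x + y)]linearD add_lfunE !linearD /= !b_alt add0r addr0.
by move/eqP; rewrite addrC addr_eq0 => /eqP->; rewrite opprK.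
Qed.

Lemma hom_linear1 (V : vectType F) (r : 'Hom(T, 'End(V))) x k y v :
  r (x + k *: y) v = r x v + k *: r y v.
Proof. by rewrite linearD linearZ add_lfunE scale_lfunE. Qed.

(** Being relative to [P], the statement applies by induction to a maximal proper subalgebra [H]
    acting on [G] modulo [H]. This gives [y] outside [H] with [[H, y]] in [H], so that [G = H +
    <[y]>]. A vector sent into [P] by [H] keeps this property under [y]; its last iterate under [y]
    outside [P] is the vector sought. *)
Lemma engel (G : {vspace T}) :
  {in G &, forall x y, b x y \in G} ->
  {in G, forall g, exists k, {in G, forall x, iter k (b g) x = 0}} ->
  {in G & &, forall x y z, b (b x y) z = b x (b y z) - b y (b x z)} ->
  forall (V : vectType F) (r : 'Hom(T, 'End(V))) (M P : {vspace V}),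
  (P <= M)%VS -> P != M ->
  {in G & M, forall g v, r g v \in M} -> {in G & P, forall g v, r g v \in P} ->
  (forall x y m, x \in G -> y \in G -> m \in M ->
     r (b x y) m - (r x (r y m) - r y (r x m)) \in P) ->
  {in G, forall g, exists k, {in M, forall m, iter k (r g) m \in P}} ->
  exists v, [/\ v \in M, v \notin P & {in G, forall g, r g v \in P}].
Proof.
move En: (\dim G) => n; elim/ltn_ind: n => n IH in G En *.
move=> clG nilG jacG V r M P sPM nPM stM stP rep nilr.
have [w Mw nPw] := subvP_neq sPM nPM.
have [G0|nzG] := eqVneq G 0%VS.
  exists w; split=> // g; rewrite G0 memv0 => /eqP->.
  by rewrite linear0 zero_lfunE mem0v.
pose Q (H : {vspace T}) := [/\ {in H &, forall x y, b x y \in H}, (H <= G)%VS & H != G].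
have Q0 : Q 0%VS.
  split; rewrite ?sub0v 1?eq_sym // => x y; rewrite !memv0 => /eqP-> _.
  by rewrite linear0 zero_lfunE.
have [H [[clH sHG nHG] _ maxH]] := max_vspace Q0.
have ltH : (\dim H < n)%N by rewrite -En (ltn_leqif (dimv_leqif_eq sHG)).
have HG := subvP sHG.
have {}IH := IH _ ltH H erefl clH.
have nilH : {in H, forall g, exists k, {in H, forall x, iter k (b g) x = 0}}.
  by move=> g /HG/nilG[k Hk]; exists k => x /HG; apply: Hk.
have jacH : {in H & &, forall x y z, b (b x y) z = b x (b y z) - b y (b x z)}.
  by move=> x y z /HG Gx /HG Gy /HG Gz; apply: jacG.
have [||||||y [Gy nHy yH]] := IH nilH jacH T b G H; rewrite //.
- by move=> g v /HG Gg Gv; apply: clG.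
- by move=> x y m /HG Gx /HG Gy Gm; rewrite jacG // subrr mem0v.
- by move=> g /HG/nilG[k Hk]; exists k => m /Hk->; rewrite mem0v.
have eqG : G = (H + <[y]>)%VS.
  have [//|neq] := eqVneq G (H + <[y]>)%VS.
  case/negP: nHy; rewrite -[H](maxH (H + <[y]>)%VS) ?addvSl //.
    by rewrite (subvP (addvSr _ _)) ?memv_line.
  split; rewrite 1?eq_sym // ?subv_add ?sHG -?memvE //.
  move=> _ _ /memv_addP[h Hh [_ /vlineP[k ->] ->]] /memv_addP[h' Hh' [_ /vlineP[k' ->] ->]].
  apply: (subvP (addvSl _ _)).
  rewrite hom_linear1 !linearD !linearZ /= b_alt !scaler0 addr0.
  by rewrite [b y h']alt_anti !memvD ?memvZ ?memvN ?yH ?clH.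
have stMH : {in H & M, forall g v, r g v \in M} by move=> g v /HG; apply: stM.
have stPH : {in H & P, forall g v, r g v \in P} by move=> g v /HG; apply: stP.
have [||w0 [Mw0 nPw0 w0H]] := IH nilH jacH V r M P sPM nPM stMH stPH.
- by move=> x x' m /HG Gx /HG Gx'; apply: rep.
- by move=> g /HG; apply: nilr.
have [k Hk] := nilr y Gy; have {Hk} := Hk _ Mw0.
elim: k w0 Mw0 nPw0 w0H => [|k IHk] v Mv nPv vH; first by rewrite /= (negPf nPv).
have [Pyv _|nPyv] := boolP (r y v \in P).
  exists v; split=> // g; rewrite eqG => /memv_addP[h Hh [_ /vlineP[c ->] ->]].
  by rewrite hom_linear1 memvD ?memvZ ?Pyv ?vH.
rewrite iterSr; apply: IHk => //; first exact: stM.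
move=> h Hh; have Gh := HG h Hh.
have -> : r h (r y v) = r (b h y) v + r y (r h v) -
    (r (b h y) v - (r h (r y v) - r y (r h v))).
  by rewrite opprB [RHS]addrC addrA !subrK.
have P1 : r (b h y) v \in P by apply: vH; apply: yH.
have P2 : r y (r h v) \in P by apply: stP => //; apply: vH.
by rewrite memvB ?rep // memvD.
Qed.

End Engel.

(** The six variables stand for the products of three operators in all orders: [xyz], [yxz], [zxy],
    [zyx], [xzy], [yzx]. *)
Lemma commutator_jacobi (V : zmodType) (a b c d e f : V) :
  a - b - (c - d) = a - e - (f - d) - (b - f - (e - c)).
Proof.
rewrite !opprB [X in _ = X]addrACA !subrKA.
by rewrite addrACA [RHS]addrACA [- _ - _]addrC.
Qed.

Lemma mulr_jacobi (R : pzRingType) (x y z : R) :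
  (x * y - y * x) * z - z * (x * y - y * x) =
  x * (y * z - z * y) - (y * z - z * y) * x -
  (y * (x * z - z * x) - (x * z - z * x) * y).
Proof. by rewrite !mulrBr !mulrBl !mulrA; apply: commutator_jacobi. Qed.

Section LinearEngel.
Variables (F : fieldType) (n : nat).
Implicit Types (G : {vspace 'M[F]_n.+1}) (v : 'cV[F]_n.+1).

(** All products of [k] elements of [G] annihilate [v]; this plays the part of a flag of
    subspaces. *)
Fixpoint killed G k v : Prop :=
  if k is k'.+1 then {in G, forall g, killed G k' (g *m v)} else v = 0.

Lemma killed0 G k : killed G k 0.
Proof. by elim: k => //= k IH g _; rewrite mulmx0. Qed.

Lemma killed_lin G k a u v : killed G k u -> killed G k v -> killed G k (a *: u + v).
Proof.
elim: k u v => [|k IH] u v /=; first by move=> -> ->; rewrite scaler0 addr0.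
by move=> Ku Kv g Gg; rewrite mulmxDr -scalemxAr; apply: IH; [apply: Ku | apply: Kv].
Qed.

Lemma killed_mono G j k v : (j <= k)%N -> killed G j v -> killed G k v.
Proof.
elim: j k v => [|j IH] k v; first by move=> _ /= ->; apply: killed0.
by case: k => // k le /= K g Gg; apply: IH => //; apply: K.
Qed.

(** To a maximal stable subspace [P] with a uniform [k] one could add a vector outside [P] that [G]
    moves into [P], at the cost of one more step. *)
Lemma linear_engel G : {in G &, forall x y, x * y - y * x \in G} ->
  {in G, forall g, exists k, g ^+ k = 0} -> exists k, forall v, killed G k v.
Proof.
move=> clG nilG.
have lin_adm : linear (@adm F n).
  move=> k x y; apply/lfunP => Y; rewrite add_lfunE scale_lfunE !admE.
  rewrite mulrDl mulrDr -scalerAl -scalerAr opprD addrACA scalerBr.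
  by [].
pose b : 'Hom('M[F]_n.+1, 'End('M[F]_n.+1)) := linfun (@adm F n).
have bE x y : b x y = x * y - y * x by rewrite linfunE // admE.
pose mulc (x : 'M[F]_n.+1) : 'End('cV[F]_n.+1) := linfun (mulmx x).
have lin_mulc : linear mulc.
  move=> k x y; apply/lfunP => v; rewrite add_lfunE scale_lfunE !lfunE /=.
  by rewrite mulmxDl scalemxAl.
pose r : 'Hom('M[F]_n.+1, 'End('cV[F]_n.+1)) := linfun mulc.
have rE x v : r x v = x *m v by rewrite linfunE // lfunE.
pose Q (P : {vspace 'cV[F]_n.+1}) :=
  {in G & P, forall g v, g *m v \in P} /\ exists k, {in P, forall v, killed G k v}.
have Q0 : Q 0%VS.
  split=> [g v _|]; first by rewrite !memv0 => /eqP->; rewrite mulmx0.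
  by exists 0%N => v; rewrite memv0 => /eqP.
have [P [[stP [k Kk]] _ maxP]] := max_vspace Q0.
have [Pf|nPf] := eqVneq P fullv.
  by exists k => v; apply: Kk; rewrite Pf memvf.
have : exists v, [/\ v \in fullv, v \notin P & {in G, forall g, r g v \in P}].
  apply: (@engel F _ b); rewrite ?subvf //.
  - by move=> x; rewrite bE subrr.
  - by move=> x y Gx Gy; rewrite bE clG.
  - move=> g /nilG[j gj]; have [i Hi] := nilf_adm gj; exists i => x _.
    suff -> : iter i (b g) x = iter i (adm g) x by apply: Hi.
    by elim: i {Hi} => //= i ->; rewrite bE admE.
  - by move=> x y z _ _ _; rewrite !bE mulr_jacobi.
  - by move=> g v _ _; rewrite memvf.
  - by move=> g v Gg Pv; rewrite rE stP.
  - move=> x y m _ _ _; rewrite !rE bE -!mulmxE mulmxBl !mulmxA subrr mem0v //.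
  - move=> g /nilG[j gj]; exists j => m _.
    suff -> : iter j (r g) m = g ^+ j *m m by rewrite gj mul0mx mem0v.
    elim: j {gj} => [|j IH]; first by rewrite mul1mx.
    by rewrite iterS IH rE exprS -mulmxE mulmxA.
move=> [v [_ nPv Gv]].
case/negP: nPv; rewrite -[P](maxP (P + <[v]>)%VS) ?addvSl //.
  by rewrite (subvP (addvSr _ _)) ?memv_line.
split=> [g _ Gg /memv_addP[p Pp [_ /vlineP[c ->] ->]]|].
  rewrite mulmxDr -scalemxAr; apply: (subvP (addvSl _ _)).
  have Pgv : g *m v \in P by rewrite -rE; apply: Gv.
  by rewrite memvD ?memvZ ?Pgv ?stP.
exists k.+1 => _ /memv_addP[p Pp [_ /vlineP[c ->] ->]].
rewrite addrC; apply: killed_lin; last by apply: killed_mono (Kk _ Pp).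
by move=> g Gg; apply: Kk; rewrite -rE Gv.
Qed.

End LinearEngel.

(** * Actions on subquotients as matrices *)

Section SubquotientRep.
Import VectorInternalTheory.
Variables (F : fieldType) (L V : vectType F).
Implicit Types (f g : 'End(V)) (v : V).

Lemma eq_mulmx_cV n (x y : 'M[F]_n) : (forall u : 'cV_n, x *m u = y *m u) -> x = y.
Proof.
move=> E; apply/matrixP => i j; have := E (delta_mx j 0) => /matrixP/(_ i 0).
have mulE (z : 'M[F]_n) : (z *m delta_mx j 0 :> 'cV_n) i 0 = z i j.
  rewrite mxE (bigD1 j) //= big1 ?addr0 => [|k /negPf ne].
    by rewrite mxE !eqxx mulr1.
  by rewrite mxE ne mulr0.
by rewrite !mulE.
Qed.

(** The additional zero coordinate keeps the matrix size positive, so that matrices form a ring even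
    when [V] is zero. *)
Definition colv v : 'cV[F]_(1 + dim V) := col_mx (0 : 'cV_1) (v2r v)^T.
Definition vcol (u : 'cV[F]_(1 + dim V)) : V := r2v (dsubmx (u : 'cV_(1 + dim V)))^T.
Definition mxf f : 'M[F]_(1 + dim V) :=
  block_mx (0 : 'M_1) 0 0 (lin1_mx (v2r \o f \o r2v))^T.

Lemma colv_lin : linear colv.
Proof.
by move=> k u v; rewrite /colv linearP linearP scale_col_mx add_col_mx scaler0 addr0.
Qed.

Lemma colv_inj : injective colv.
Proof. by move=> u v /eq_col_mx[_ /trmx_inj/v2r_inj]. Qed.

Lemma vcolK v : vcol (colv v) = v.
Proof. by rewrite /vcol /colv col_mxKd trmxK v2rK. Qed.

Lemma mul_mxf f u : mxf f *m u = colv (f (vcol u)).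
Proof.
rewrite -[u](@vsubmxK _ 1 (dim V)) /mxf /colv /vcol.
rewrite (@mul_block_col _ 1 (dim V) 1 (dim V) 1) !mul0mx !addr0 add0r.
rewrite col_mxKd; congr col_mx; apply: trmx_inj.
by rewrite trmx_mul !trmxK mul_rV_lin1.
Qed.

Lemma mxf_lin : linear mxf.
Proof.
move=> k f g; apply: eq_mulmx_cV => u.
rewrite mulmxDl -scalemxAl !mul_mxf add_lfunE scale_lfunE.
by rewrite colv_lin.
Qed.

Lemma end_matrix : exists n (mf : 'End(V) -> 'M[F]_n.+1) (c : V -> 'cV[F]_n.+1)
    (r : 'cV[F]_n.+1 -> V),
  [/\ linear mf, injective c, cancel c r & forall f u, mf f *m u = c (f (r u))] /\ linear c.
Proof.
exists (dim V), mxf, colv, vcol; split; last exact: colv_lin.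
by split; [exact: mxf_lin | exact: colv_inj | exact: vcolK | exact: mul_mxf].
Qed.

Lemma hom_linearP (T : 'Hom(L, 'End(V))) k x y v :
  T (k *: x + y) v = k *: T x v + T y v.
Proof. by rewrite linearP /= add_lfunE scale_lfunE. Qed.

(** The quotient of [M] by [P] is modelled on the image of [v - projv P v]: [c] is the quotient map
    in coordinates and [r] picks representatives in [M]. Stability of [P] enters only in the
    intertwining clause, so [s] is defined and linear on all of [L]. *)
Lemma subquotient_rep (T : 'Hom(L, 'End(V))) (M P : {vspace V}) :
  (P <= M)%VS ->
  exists n (s : 'Hom(L, 'M[F]_n.+1)) (c : V -> 'cV[F]_n.+1) (r : 'cV[F]_n.+1 -> V),
  [/\ linear c, (forall v, v \in M -> (c v = 0 <-> v \in P)),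
      (forall u, r u \in M),
      (forall x, {in P, forall v, T x v \in P} ->
         {in M, forall v, s x *m c v = c (T x v)}) &
      (forall x u, s x *m u = c (T x (r u)))].
Proof.
move=> sPM; pose pm := projv M.
have [pi piE] : exists pi : 'End(V), forall v, pi v = v - projv P v.
  by exists (\1%VF - projv P) => v; rewrite add_lfunE opp_lfunE id_lfunE.
have pi0 v : v \in P -> pi v = 0 by move=> Pv; rewrite piE projv_id // subrr.
pose s0 x := mxf (pi \o T x \o pm)%VF.
have s0_lin : linear s0.
  move=> k x y; rewrite /s0 -mxf_lin; congr mxf.
  apply/lfunP => v; rewrite !(comp_lfunE, add_lfunE, scale_lfunE).
  by rewrite hom_linearP linearP.
exists (dim V), (linfun s0), (colv \o pi), (pm \o vcol).
have col0 : colv 0 = 0 by rewrite -{1}(addr0 0) -[X in X + _](scaler0 V (-1)) colv_lin scaleN1r addNr.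
split=> [k u v|v Mv|u|x stP v Mv|x u] /=.
- by rewrite linearP colv_lin.
- split=> [|Pv]; last by rewrite pi0.
  rewrite -col0 => /colv_inj; rewrite piE => /eqP; rewrite subr_eq0 => /eqP->.
  exact: memv_proj.
- exact: memv_proj.
- rewrite linfunE // mul_mxf vcolK !comp_lfunE; congr colv.
  have -> : pm (pi v) = v - projv P v.
    by rewrite /pm projv_id // piE memvB // (subvP sPM) ?memv_proj.
  by rewrite linearB linearB /= (pi0 (T x (projv P v))) ?subr0 // stP ?memv_proj.
by rewrite linfunE // mul_mxf !comp_lfunE.
Qed.

End SubquotientRep.

(** * Brackets, ideals and the derived series *)

Section LieBasics.
Variables (F : fieldType) (L : vectType F) (br : 'Hom(L, 'End(L))).
Hypothesis br_alt : forall x, br x x = 0.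
Hypothesis br_jac : forall x y z, br (br x y) z = br x (br y z) - br y (br x z).
Implicit Types (B C D I J K M N P R : {vspace L}) (x y z : L).
Local Notation lbr := (fun x y => br x y).

Lemma br_anti x y : br x y = - br y x.
Proof. exact: alt_anti. Qed.

Lemma brP k x y z : br (k *: x + y) z = k *: br x z + br y z.
Proof. exact: hom_linearP. Qed.

Lemma brD x y z : br (x + y) z = br x z + br y z.
Proof. by have := brP 1 x y z; rewrite !scale1r. Qed.

Lemma brN x z : br (- x) z = - br x z.
Proof. by rewrite br_anti linearN /= br_anti opprK br_anti. Qed.

Lemma brB x y z : br (x - y) z = br x z - br y z.
Proof. by rewrite brD brN. Qed.

Lemma br0 z : br 0 z = 0.
Proof. by rewrite br_anti linear0 oppr0. Qed.

Lemma br_leibniz x y z : br x (br y z) = br (br x y) z + br y (br x z).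
Proof. by rewrite br_jac subrK. Qed.

Definition bracketv B C := brackets lbr B C.

Lemma bracketv_sub B C D :
  (forall x y, x \in B -> y \in C -> br x y \in D) -> (bracketv B C <= D)%VS.
Proof.
move=> H; apply/span_subvP => _ /allpairsP[[x y] [/= /vbasis_mem Bx /vbasis_mem Cy ->]].
exact: H.
Qed.

Lemma mem_bracketv B C x y : x \in B -> y \in C -> br x y \in bracketv B C.
Proof.
move=> Bx Cy; rewrite (coord_vbasis Bx) (coord_vbasis Cy).
rewrite linear_sum memv_suml // => j _; rewrite linearZ memvZ //=.
rewrite linear_sum /= sum_lfunE memv_suml // => i _.
rewrite linearZ /= scale_lfunE memvZ // memv_span //.
by apply/allpairsP; exists ((vbasis B)`_i, (vbasis C)`_j); rewrite !mem_nth ?size_tuple.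
Qed.

Lemma bracketvS B C B' C' : (B <= B')%VS -> (C <= C')%VS ->
  (bracketv B C <= bracketv B' C')%VS.
Proof.
move=> /subvP sB /subvP sC; apply: bracketv_sub => x y /sB Bx /sC Cy.
exact: mem_bracketv.
Qed.

Notation subalg := (subalgebra lbr).
Notation ideal := (ideal_of lbr).

Lemma ideal_sub B I : ideal B I -> subalg B -> subalg I.
Proof. by move=> [/subvP sIB idI] clB x y Ix Iy; apply: idI => //; apply: sIB. Qed.

Lemma ideal_full B : subalg B -> ideal B B.
Proof. by move=> clB; split. Qed.

Lemma ideal_r B I x y : ideal B I -> x \in I -> y \in B -> br x y \in I.
Proof. by move=> [_ idI] Ix By; rewrite br_anti memvN idI. Qed.

Lemma idealD B I J : ideal B I -> ideal B J -> ideal B (I + J)%VS.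
Proof.
move=> [sI idI] [sJ idJ]; split; first by rewrite subv_add sI.
move=> x _ Bx /memv_addP[u Iu [v Jv ->]]; rewrite linearD memv_add ?idI ?idJ //.
Qed.

Lemma idealI B I J : ideal B I -> ideal B J -> ideal B (I :&: J)%VS.
Proof.
move=> [sI idI] [sJ idJ]; split; first by apply: subv_trans sI; apply: capvSl.
by move=> x y Bx /memv_capP[Iy Jy]; rewrite memv_cap idI ?idJ.
Qed.

Lemma ideal_bracketv B I J : subalg B -> ideal B I -> ideal B J ->
  ideal B (bracketv I J).
Proof.
move=> clB [/subvP sI idI] [/subvP sJ idJ].
split; first by apply: bracketv_sub => x y Ix Jy; apply: clB; [apply: sI|apply: sJ].
move=> x + Bx; have [U HU] : exists U : {vspace L}, forall y, y \in U <->
    br x y \in bracketv I J.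
  apply: vspace_of_pred => [|k u v Hu Hv]; first by rewrite linear0 mem0v.
  by rewrite linearP memvD ?memvZ.
move=> y Iy; apply/HU; apply: (subvP (bracketv_sub _) _ Iy) => u v Iu Jv.
apply/HU; rewrite br_leibniz memvD // mem_bracketv ?idI ?idJ //.
Qed.

Fixpoint der B k := if k is k'.+1 then bracketv (der B k') (der B k') else B.

Lemma der_ideal B I k : subalg B -> ideal B I -> ideal B (der I k).
Proof. by move=> clB idI; elim: k => //= k IH; apply: ideal_bracketv. Qed.

Lemma der_sub B k : subalg B -> (der B k <= B)%VS.
Proof. by move=> clB; have [] := der_ideal k clB (ideal_full clB). Qed.

Lemma der_shift B k : der (bracketv B B) k = der B k.+1.
Proof. by elim: k => //= k ->. Qed.

(* [B/R] is semisimple: every ideal of [B] that is abelian modulo [R] lies in [R]. *)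
Definition ss B R := ideal B R /\
  forall I, ideal B I -> (bracketv I I <= R)%VS -> (I <= R)%VS.

Lemma ss_der B R I k : subalg B -> ss B R -> ideal B I -> (der I k <= R)%VS ->
  (I <= R)%VS.
Proof.
move=> clB [_ sR] idI; elim: k => //= k IH dR; apply/IH/sR => //.
exact: der_ideal.
Qed.

End LieBasics.

Section CartanCriterion.
Variables (F : fieldType) (charF0 : [pchar F] =i pred0).
Variables (L : vectType F) (br : 'Hom(L, 'End(L))).
Hypothesis br_alt : forall x, br x x = 0.
Hypothesis br_jac : forall x y z, br (br x y) z = br x (br y z) - br y (br x z).
Local Notation lbr := (fun x y => br x y).

(** If [t z] were not nilpotent for some [z] in [[K, K]], its replica [y] would have nonzero trace
    against it. But [adm y] is a polynomial in [adm (t z)] without constant term, so it preserves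
    [t @: K], and invariance reduces the trace to values of the form on [K]. Engel's theorem then
    applies to the image of [[K, K]]. *)
Lemma cartan_criterion n (t : 'Hom(L, 'M[F]_n.+1)) (K : {vspace L}) :
  subalgebra lbr K ->
  {in K &, forall x y, t (br x y) = t x * t y - t y * t x} ->
  {in K &, forall x y, \tr (t x * t y) = 0} ->
  exists k, {in der br K k, forall z, t z = 0}.
Proof.
move=> clK rep tr0; set K1 := bracketv br K K.
have sK1 : {subset K1 <= K} by apply/subvP/bracketv_sub.
pose G := (t @: K1)%VS.
have clG : {in G &, forall x y, x * y - y * x \in G}.
  move=> _ _ /memv_imgP[x Kx ->] /memv_imgP[y Ky ->].
  by rewrite -rep ?sK1 // memv_img // mem_bracketv ?sK1.
have nilG : {in G, forall g, exists k, g ^+ k = 0}.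
  move=> _ /memv_imgP[z K1z ->]; apply: NNPP => /(trace_witness charF0).
  move=> [y [p [/eqP nz Hy]]]; apply: nz.
  have [U HU] : exists U : {vspace L}, forall w, w \in U <-> \tr (t w *m y) = 0.
    apply: vspace_of_pred => [|k u v Hu Hv]; first by rewrite linear0 mul0mx linear0.
    by rewrite linearP mulmxDl -scalemxAl linearP /= Hu Hv mulr0 addr0.
  apply/HU; apply: (subvP (bracketv_sub _) _ K1z) => a b Ka Kb; apply/HU.
  rewrite rep // mulmxBl linearB /= -!mulmxE -[t b *m t a *m y]mulmxA.
  rewrite [X in _ - X]mxtrace_mulC -!mulmxA -linearB /= -mulmxBr.
  have -> : t b *m y - y *m t b = - adm y (t b) by rewrite admE opprB.
  suff [c Kc ->] : exists2 c, c \in K & adm y (t b) = t c.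
    by rewrite mulmxN linearN /= mulmxE tr0 // oppr0.
  apply/memv_imgP; rewrite Hy; have st c : c \in (t @: K)%VS -> adm (t z) c \in (t @: K)%VS.
    move=> /memv_imgP[w Kw ->]; have Kz := sK1 z K1z.
    by rewrite admE -rep // memv_img // clK.
  by apply: evp_stable => //; apply: st; apply: memv_img.
have [k Hk] := linear_engel clG nilG.
exists k.+1; have derK j : {subset der br K j <= K} by apply/subvP/der_sub.
(* An element of derived term [j.+1] shortens the killing length by [j.+1]; a product of two
   shortens it by twice as much, enough for the next term. *)
have key j : {in der br K j.+1, forall z i v,
    killed G (i + j).+1 v -> killed G i (t z *m v)}.
  elim: j => [|j IH] z; first by move=> K1z i v; rewrite addn0; apply; apply: memv_img.
  have [U HU] : exists U : {vspace L}, forall w, w \in U <->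
      forall i v, killed G (i + j.+1).+1 v -> killed G i (t w *m v).
    apply: vspace_of_pred => [i v _|a u w Hu Hw i v Kv].
      by rewrite linear0 mul0mx; apply: killed0.
    by rewrite linearP mulmxDl -scalemxAl; apply: killed_lin; [apply: Hu|apply: Hw].
  move=> Dz; apply/HU; apply: (subvP (bracketv_sub _) _ Dz) => a b Da Db; apply/HU => i v Kv.
  rewrite rep ?(derK j.+1) // mulmxBl addrC -scaleN1r -!mulmxA.
  by apply: killed_lin; apply: (IH) => //; apply: (IH) => //; apply: killed_mono Kv; lia.
move=> z Dz; apply: eq_mulmx_cV => u; rewrite mul0mx.
by apply: (key k z Dz 0%N u); apply: killed_mono (Hk u).
Qed.

End CartanCriterion.

(** * Complete reducibility *)

Section Casimir.
Variables (F : fieldType) (n : nat).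
Implicit Types (x y z : 'M[F]_n.+1).

Lemma mxtrace_invariant x y z : \tr ((x * y - y * x) * z) = \tr (x * (y * z - z * y)).
Proof.
rewrite mulrBl mulrBr !linearB /= -!mulmxE -[y *m x *m z]mulmxA.
by rewrite [X in _ - X]mxtrace_mulC !mulmxA.
Qed.

(** [X] is a basis and [Y] its dual for the trace form. The trace of the sum is the dimension of
    [G]; it commutes with [G] because, by invariance, the coefficients of [[g, X i]] and of
    [[g, Y j]] are opposite. *)
Lemma casimir (G : {vspace 'M[F]_n.+1}) : [pchar F] =i pred0 ->
  {in G &, forall x y, x * y - y * x \in G} ->
  {in G, forall x, (forall y, y \in G -> \tr (x * y) = 0) -> x = 0} -> G != 0%VS ->
  exists X Y : 'I_(\dim G) -> 'M[F]_n.+1,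
  [/\ forall i, X i \in G, forall i, Y i \in G,
      \tr (\sum_i X i * Y i) != 0 &
      {in G, forall g, g * (\sum_i X i * Y i) = (\sum_i X i * Y i) * g}].
Proof.
move=> charF0 clG ndG nzG; pose X (i : 'I_(\dim G)) := (vbasis G)`_i.
have GX i : X i \in G by rewrite vbasis_mem ?mem_nth ?size_tuple.
pose Q := \matrix_(i, j) \tr (X i * X j).
have uQ : Q \in unitmx.
  rewrite -row_free_unit -kermx_eq0; apply/eqP/row_matrixP => i; rewrite row0.
  set u := row i _; have uQ0 : u *m Q = 0.
    by apply/sub_kermxP; apply: row_sub.
  pose g := \sum_j u 0 j *: X j.
  have Gg : g \in G by apply: memv_suml => j _; rewrite memvZ.
  have g0 : g = 0.
    apply: (ndG _ Gg) => y /coord_vbasis->; rewrite mulr_sumr linear_sum big1 //= => k _.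
    rewrite -scalerAr linearZ /= mulr_suml linear_sum /=.
    move/matrixP/(_ 0 k): uQ0; rewrite [RHS]mxE mxE => E0.
    rewrite (_ : \sum_j _ = 0) ?mulr0 // -[RHS]E0; apply: eq_bigr => j _.
    by rewrite -scalerAl linearZ /= [Q _ _]mxE.
  apply/rowP => j; rewrite [RHS]mxE.
  have /freeP fr := basis_free (vbasisP G); exact: (fr (fun j => u 0 j)).
have [Y [GY XY]] : exists Y : 'I_(\dim G) -> 'M[F]_n.+1,
    (forall i, Y i \in G) /\ forall i j, \tr (X i * Y j) = (i == j)%:R.
  exists (fun j => \sum_k invmx Q k j *: X k); split=> [i|i j].
    by apply: memv_suml => j _; rewrite memvZ.
  have := mulmxV uQ => /matrixP/(_ i j); rewrite [RHS]mxE mxE => <-.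
  rewrite mulr_sumr linear_sum; apply: eq_bigr => k _.
  by rewrite -scalerAr linearZ mxE mulrC.
have expX g : g \in G -> g = \sum_j \tr (g * Y j) *: X j.
  move=> Gg; rewrite {1}(coord_vbasis Gg); apply: eq_bigr => j _; congr (_ *: _).
  rewrite [in RHS](coord_vbasis Gg) mulr_suml linear_sum (bigD1 j) //=.
  rewrite -scalerAl linearZ /= XY eqxx mulr1 big1 ?addr0 // => i /negPf ne.
  by rewrite -scalerAl linearZ /= XY ne mulr0.
have expY g : g \in G -> g = \sum_j \tr (X j * g) *: Y j.
  move=> Gg; apply: subr0_eq; apply: ndG => [|y Gy].
    by rewrite memvB // memv_suml // => j _; rewrite memvZ.
  rewrite (expX y Gy) mulr_sumr linear_sum big1 //= => i _.
  rewrite -scalerAr linearZ /= -mulmxE [\tr (_ *m X i)]mxtrace_mulC mulmxE mulrBr linearB /=.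
  rewrite mulr_sumr linear_sum (bigD1 i) //= big1 ?addr0 => [|j ne].
    by rewrite -scalerAr linearZ /= XY eqxx mulr1 subrr mulr0.
  by rewrite -scalerAr linearZ /= XY eq_sym (negPf ne) mulr0.
exists X, Y; split=> //.
  rewrite linear_sum /= (eq_bigr (fun=> 1)) => [|i _]; last by rewrite XY eqxx.
  rewrite sumr_const card_ord; have := nzG; rewrite -dimv_eq0.
  by case: (\dim G) => // d _; apply: natr_neq0.
move=> g Gg; apply: subr0_eq; rewrite mulr_sumr mulr_suml -sumrB.
have E i : g * (X i * Y i) - X i * Y i * g =
    (g * X i - X i * g) * Y i + X i * (g * Y i - Y i * g).
  by rewrite mulrBl mulrBr !mulrA addrA subrK.
under eq_bigr => i _ do rewrite E.
rewrite big_split /=.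
rewrite (eq_bigr (fun i => \sum_j \tr ((g * X i - X i * g) * Y j) *: (X j * Y i))); last first.
  by move=> i _; rewrite {1}(expX _ (clG _ _ Gg (GX i))) mulr_suml;
    apply: eq_bigr => j _; rewrite scalerAl.
rewrite [X in _ + X](eq_bigr (fun i => \sum_j \tr (X j * (g * Y i - Y i * g)) *: (X i * Y j)));
  last first.
  by move=> i _; rewrite {1}(expY _ (clG _ _ Gg (GY i))) mulr_sumr;
    apply: eq_bigr => j _; rewrite scalerAr.
rewrite [X in _ + X]exchange_big -big_split big1 //= => i _.
rewrite -big_split big1 //= => j _; rewrite -scalerDl.
have -> : \tr ((g * X i - X i * g) * Y j) = - \tr (X i * (g * Y j - Y j * g)).
  by rewrite -opprB mulNr linearN /= mxtrace_invariant.
by rewrite addNr scale0r.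
Qed.

End Casimir.

(** * Trace forms on an algebra semisimple modulo an ideal *)

Section SemisimpleQuotient.
Variables (F : fieldType) (charF0 : [pchar F] =i pred0).
Variables (L : vectType F) (br : 'Hom(L, 'End(L))).
Hypothesis br_alt : forall x, br x x = 0.
Hypothesis br_jac : forall x y z, br (br x y) z = br x (br y z) - br y (br x z).
Implicit Types (B C D I J K M N P R : {vspace L}) (x y z : L).
Local Notation lbr := (fun x y => br x y).
Local Notation subalg := (subalgebra lbr).
Local Notation ideal := (ideal_of lbr).
Local Notation ss := (ss br).

Lemma adjoint_quotient_rep B R : subalg B -> ideal B R ->
  exists n (s : 'Hom(L, 'M[F]_n.+1)),
  [/\ {in B &, forall x y, s (br x y) = s x * s y - s y * s x},
      {in R, forall x, s x = 0} &
      {in B, forall x, s x = 0 -> {in B, forall v, br x v \in R}}].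
Proof.
move=> clB [sRB idR]; have [n [s [c [r [lc c0 rB sc su]]]]] := subquotient_rep br sRB.
have Hc x : x \in B -> {in B, forall v, s x *m c v = c (br x v)}.
  by move=> Bx; apply: sc => v Rv; apply: idR.
have RB := subvP sRB.
have cB a b : c (a - b) = c a - c b.
  by have := lc (-1) b a; rewrite !scaleN1r [- b + a]addrC [- c b + _]addrC.
exists n, s; split.
- move=> x y Bx By; apply: eq_mulmx_cV => u; rewrite mulmxBl -!mulmxE -!mulmxA (su _ u) (su x u) (su y u).
  by rewrite !Hc ?clB // br_jac cB.
- move=> x Rx; apply: eq_mulmx_cV => u; rewrite mul0mx su; apply/c0.
    by rewrite clB // RB.
  by apply: (ideal_r br_alt (B := B)); rewrite ?rB.
move=> x Bx x0 v Bv; apply/(c0 _ (clB _ _ Bx Bv)).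
by rewrite -Hc // x0 mul0mx.
Qed.

(** [J] is orthogonal to [I] for the trace form of [B] acting on [B] modulo [R]. By Cartan's
    criterion a derived term of [(I + R) :&: J] acts there by zero, hence lies in [R]. *)
Lemma ss_orthogonal B R I : subalg B -> ss B R -> ideal B I ->
  exists J, [/\ ideal B J, (R <= J)%VS, (I + J = B)%VS & ((I + R) :&: J <= R)%VS].
Proof.
move=> clB ssB idI; have [idR maxR] := ssB.
have [n [s [rep sR s0]]] := adjoint_quotient_rep clB idR.
have [sIB _] := idI; have IB := subvP sIB; have [sRB _] := idR; have RB := subvP sRB.
have [J HJ] : exists J : {vspace L}, forall x, x \in J <->
    x \in B /\ forall y, y \in I -> \tr (s x * s y) = 0.
  apply: vspace_of_pred => [|k u v [Bu Hu] [Bv Hv]].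
    by split=> [|y _]; rewrite ?mem0v // linear0 mul0r linear0.
  split=> [|y Iy]; first by rewrite memvD ?memvZ.
  by rewrite linearP mulrDl -scalerAl linearP /= Hu ?Hv // mulr0 addr0.
have idJ : ideal B J.
  split=> [|x y Bx /HJ[By Hy]]; first by apply/subvP => x /HJ[].
  apply/HJ; split=> [|z Iz]; first exact: clB.
  rewrite rep // -opprB mulNr linearN /= mxtrace_invariant.
  by rewrite -(rep x z Bx (IB z Iz)) Hy ?oppr0 //; case: idI => _; apply.
have sRJ : (R <= J)%VS.
  by apply/subvP => x Rx; apply/HJ; split=> [|y _]; rewrite ?RB ?(sR x Rx) ?mul0r ?linear0.
pose I1 := (I + R)%VS; have idI1 : ideal B I1 by apply: idealD.
have capR : (I1 :&: J <= R)%VS.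
  pose K := (I1 :&: J)%VS; have idK : ideal B K by apply: idealI.
  have KB : {subset K <= B} by apply/subvP; case: idK.
  have [k Hk] : exists k, {in der br K k, forall z, s z = 0}.
    apply: (cartan_criterion charF0) => //.
    - exact: ideal_sub idK clB.
    - by move=> x y Kx Ky; apply: rep; apply: KB.
    - move=> x y /memv_capP[_ /HJ[_ Hx]] /memv_capP[/memv_addP[i Ii [z Rz ->]] _].
      by rewrite linearD /= (sR z) // addr0 Hx.
  apply: (ss_der br_jac clB ssB idK (k := k)).
  have [C HC] : exists C : {vspace L}, forall x, x \in C <->
      x \in B /\ forall y, y \in B -> br x y \in R.
    apply: vspace_of_pred => [|a u v [Bu Hu] [Bv Hv]].
      by split=> [|y _]; rewrite ?mem0v // br0 // mem0v.
    by split=> [|y By]; rewrite ?brP memvD ?memvZ ?Hu ?Hv.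
  apply: (@subv_trans _ _ C).
    apply/subvP => z Kz; apply/HC; have Bz : z \in B.
      by apply: KB; apply: (subvP (der_sub br_jac k (ideal_sub idK clB))).
    by split=> // y By; apply: s0 => //; apply: Hk.
  apply: maxR; last by apply: bracketv_sub => x y /HC[_ Hx] /HC[By _]; apply: Hx.
  split=> [|x y Bx /HC[By Hy]]; first by apply/subvP => x /HC[].
  apply/HC; split=> [|z Bz]; first exact: clB.
  rewrite br_jac memvB //; first by case: idR => _; apply=> //; apply: Hy.
  by apply: Hy; apply: clB.
exists J; split=> //.
have [sJB _] := idJ; have [sI1B _] := idI1.
suff -> : B = (I1 + J)%VS.
  by rewrite /I1 -addvA (_ : R + J = J)%VS //; apply/addv_idPr.
apply/eqP; rewrite eq_sym eqEdim subv_add sI1B sJB /=.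
(* As [R] acts by zero, [\dim N] functionals cut out [J]; this bounds its codimension and gives the
   sum by dimension. *)
pose N := (I1 :\: R)%VS; pose phi0 x := \row_(i < \dim N) \tr (s x * s (vbasis N)`_i).
have lphi : linear phi0.
  move=> k u v; apply/rowP => i; rewrite !mxE linearP mulrDl -scalerAl linearP /=.
  by [].
pose phi : 'Hom(L, 'rV[F]_(\dim N)) := linfun phi0.
have EJ : J = (B :&: lker phi)%VS.
  apply/eqP; rewrite eqEsubv; apply/andP; split; apply/subvP => x.
    move=> /HJ[Bx Hx]; rewrite memv_cap Bx memv_ker linfunE //.
    apply/eqP/rowP => i; rewrite !mxE.
    have /memv_addP[j Ij [z Rz ->]] : (vbasis N)`_i \in I1.
      by rewrite (subvP (diffvSl I1 R)) // vbasis_mem ?mem_nth ?size_tuple.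
    by rewrite linearD /= (sR z) // addr0 Hx.
  rewrite memv_cap memv_ker linfunE // => /andP[Bx /eqP/rowP Hx].
  apply/HJ; split=> // y Iy.
  have : y \in (N + R)%VS by rewrite addv_diff -/I1 (subvP (addvSl _ _)) // (subvP (addvSl _ _)).
  case/memv_addP => w Nw [z Rz ->]; rewrite linearD /= (sR z) // addr0.
  rewrite (coord_vbasis Nw) linear_sum mulr_sumr linear_sum big1 //= => i _.
  by have := Hx i; rewrite !mxE linearZ -scalerAr linearZ /= => ->; rewrite mulr0.
have := limg_ker_dim phi B; rewrite -EJ => D1.
have := dimv_cap_compl I1 R; rewrite (_ : I1 :&: R = R)%VS => [D2|]; last first.
  by apply/capv_idPr; apply: addvSr.
have := dimv_sum_cap I1 J => D3; have := dimvS capR => D4.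
have : (\dim (phi @: B) <= \dim N)%N.
  by rewrite (leq_trans (dimvS (subvf _))) // dimvf dim_matrix mul1r.
by move: D2; rewrite -/N; lia.
Qed.

(** Let [J] be orthogonal to the kernel [I] of [t]. The elements of [J] in the radical of the form
    make an ideal with a derived term in [I :&: J], inside [R]; so this ideal lies in [R], which [t]
    kills. *)
Lemma ss_trace_nondegenerate B R n (t : 'Hom(L, 'M[F]_n.+1)) :
  subalg B -> ss B R ->
  {in B &, forall x y, t (br x y) = t x * t y - t y * t x} ->
  {in R, forall x, t x = 0} ->
  {in B, forall x, (forall y, y \in B -> \tr (t x * t y) = 0) -> t x = 0}.
Proof.
move=> clB ssB rep tR.
have [I HI] : exists I : {vspace L}, forall x, x \in I <-> x \in B /\ t x = 0.
  apply: vspace_of_pred => [|k u v [Bu u0] [Bv v0]]; first by rewrite mem0v linear0.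
  by rewrite memvD ?memvZ // linearP /= u0 v0 scaler0 addr0.
have idI : ideal B I.
  split=> [|x y Bx /HI[By y0]]; first by apply/subvP => x /HI[].
  by apply/HI; split; [apply: clB | rewrite rep // y0 mulr0 mul0r subrr].
have [J [idJ sRJ IJ capR]] := ss_orthogonal clB ssB idI.
have [sJB _] := idJ; have JB := subvP sJB.
have [K HK] : exists K : {vspace L}, forall x, x \in K <->
    x \in J /\ forall y, y \in B -> \tr (t x * t y) = 0.
  apply: vspace_of_pred => [|k u v [Ju Hu] [Jv Hv]].
    by split=> [|y _]; rewrite ?mem0v // linear0 mul0r linear0.
  split=> [|y By]; first by rewrite memvD ?memvZ.
  by rewrite linearP mulrDl -scalerAl linearP /= Hu ?Hv // mulr0 addr0.
have idK : ideal B K.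
  split=> [|x y Bx /HK[Jy Hy]].
    by apply: subv_trans sJB; apply/subvP => x /HK[].
  have By := JB _ Jy; apply/HK; split=> [|z Bz]; first by case: idJ => _; apply.
  rewrite rep // -opprB mulNr linearN /= mxtrace_invariant.
  by rewrite -(rep x z Bx Bz) Hy ?oppr0 //; apply: clB.
have KB : {subset K <= B} by apply/subvP; case: idK.
have [k Hk] : exists k, {in der br K k, forall z, t z = 0}.
  apply: (cartan_criterion charF0) => //.
  - exact: ideal_sub idK clB.
  - by move=> x y Kx Ky; apply: rep; apply: KB.
  - by move=> x y /HK[_ Hx] /KB; apply: Hx.
have /subvP sKR : (K <= R)%VS.
  apply: (ss_der br_jac clB ssB idK (k := k)); apply: subv_trans capR.
  have /subvP sdK := der_sub br_jac k (ideal_sub idK clB).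
  apply/subvP => z Dz; have Kz := sdK z Dz; rewrite memv_cap.
  have /HK[-> _] := Kz; rewrite andbT (subvP (addvSl _ _)) //.
  by apply/HI; split; [apply: KB | apply: Hk].
move=> x; rewrite -{1}IJ => /memv_addP[i /HI[_ i0] [j Jj ->]] Hx.
rewrite linearD /= i0 add0r; apply/tR/sKR/HK; split=> // y By.
by have := Hx y By; rewrite linearD /= i0 add0r.
Qed.

(* The idempotent [e] projects onto the span of the images of the [t b] along
   their common kernel; it exists by maximality, enlarging it either by a Fitting
   idempotent of some [t r] or by one of a Casimir element. *)
Lemma reductive_idempotent B R n (t : 'Hom(L, 'M[F]_n.+1)) :
  subalg B -> ss B R ->
  {in B &, forall x y, t (br x y) = t x * t y - t y * t x} ->
  {in R & B, forall r b, t r * t b = t b * t r} ->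
  {in R, forall r (u : 'cV_n.+1), t r *m (t r *m u) = 0 -> t r *m u = 0} ->
  exists e : 'M[F]_n.+1,
  [/\ {in B, forall b, t b * e = t b}, {in B, forall b, e * t b = t b},
      forall W : {vspace 'M[F]_n.+1},
        (forall b m, b \in B -> t b * m \in W) -> e \in W &
      forall W : {vspace 'M[F]_n.+1},
        (forall b m, b \in B -> m * t b \in W) -> e \in W].
Proof.
move=> clB ssB rep comR t2.
have [idR _] := ssB; have [sRB _] := idR; have RB := subvP sRB.
(* [inl] and [inr] express membership in the right and in the left ideal generated by the [t b],
   tested against all subspaces. *)
pose inl e := forall W : {vspace 'M[F]_n.+1},
  (forall b m, b \in B -> t b * m \in W) -> e \in W.
pose inr e := forall W : {vspace 'M[F]_n.+1},
  (forall b m, b \in B -> m * t b \in W) -> e \in W.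
pose good e := [/\ e * e = e, {in B, forall b, t b * e = e * t b}, inl e & inr e].
pose Fix (U : {vspace 'cV[F]_n.+1}) e := forall u, u \in U <-> e *m u = u.
have [U [[e ge fixU] _ maxU]] : exists U, [/\ exists2 e, good e & Fix U e, (0 <= U)%VS &
    forall W, (exists2 e, good e & Fix W e) -> (U <= W)%VS -> W = U].
  apply: max_vspace; exists 0.
    by split=> [|b _|W _|W _]; rewrite ?mulr0 ?mul0r ?mem0v.
  by move=> u; rewrite memv0 mul0mx; split=> [/eqP-> //|<-].
have [ee ce le re] := ge.
(* Otherwise the Fitting idempotent of [c] is nonzero and orthogonal to [e], and adding it to [e]
   contradicts maximality. *)
have maxe c : {in B, forall b, t b * c = c * t b} -> c * e = 0 -> e * c = 0 ->
    inl c -> inr c -> exists k, c ^+ k = 0.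
  move=> cc c0 c0' lc rc; have [w [ff nil]] := fitting_idempotent c.
  set h := horner_mx c w in ff nil; set f := c * h in ff nil.
  have ch : c * h = h * c by rewrite /h -{1 4}(horner_mx_X c) -!rmorphM mulrC.
  have ch_t b : b \in B -> t b * h = h * t b.
    by move=> Bb; apply: comm_mx_horner; apply: cc.
  have fe : f * e = 0 by rewrite /f ch -mulrA c0 mulr0.
  have ef : e * f = 0 by rewrite /f mulrA c0' mul0r.
  suff f0 : f = 0 by move: nil; rewrite f0 subr0 mul1r.
  have gef : good (e + f).
    split.
    - by rewrite mulrDl !mulrDr ee ef fe ff addr0 add0r.
    - by move=> b Bb; rewrite mulrDr mulrDl ce // /f mulrA cc // -!mulrA ch_t.
    - move=> W HW; rewrite memvD ?le //.
      have [W' HW'] : exists W' : {vspace 'M[F]_n.+1}, forall p, p \in W' <-> p * h \in W.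
        apply: vspace_of_pred => [|k x y Hx Hy]; first by rewrite mul0r mem0v.
        by rewrite mulrDl -scalerAl memvD ?memvZ.
      by apply/HW'; apply: lc => b m Bb; apply/HW'; rewrite -mulrA HW.
    - move=> W HW; rewrite memvD ?re // /f ch.
      have [W' HW'] : exists W' : {vspace 'M[F]_n.+1}, forall p, p \in W' <-> h * p \in W.
        apply: vspace_of_pred => [|k x y Hx Hy]; first by rewrite mulr0 mem0v.
        by rewrite mulrDr -scalerAr memvD ?memvZ.
      by apply/HW'; apply: rc => b m Bb; apply/HW'; rewrite mulrA HW.
  have [U' HU'] : exists U' : {vspace 'cV[F]_n.+1}, Fix U' (e + f).
    apply: vspace_of_pred => [|k x y Hx Hy]; first by rewrite mulmx0.
    by rewrite mulmxDr -scalemxAr Hx Hy.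
  have eqU : U' = U.
    apply: maxU; first by exists (e + f).
    apply/subvP => u /fixU eu; apply/HU'; rewrite mulmxDl eu -[X in f *m X]eu.
    by rewrite (mulmxA f e u) mulmxE fe mul0mx addr0.
  apply: eq_mulmx_cV => u; rewrite mul0mx.
  have : f *m u \in U'.
    apply/HU'; rewrite mulmxDl (mulmxA e f u) (mulmxA f f u).
    by rewrite !mulmxE ef ff mul0mx add0r.
  by rewrite eqU => /fixU <-; rewrite (mulmxA e f u) mulmxE ef mul0mx.
have e1e : (1 - e) * e = 0 by rewrite mulrBl mul1r ee subrr.
have ee1 : e * (1 - e) = 0 by rewrite mulrBr mulr1 ee subrr.
have e11 : (1 - e) * (1 - e) = 1 - e by rewrite mulrBr mulr1 e1e subr0.
have ce1 b : b \in B -> t b * (1 - e) = (1 - e) * t b.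
  by move=> Bb; rewrite mulrBr mulrBl mulr1 mul1r ce.
have inl1 b : b \in B -> inl (t b * (1 - e)) by move=> Bb W; apply.
have inr1 b : b \in B -> inr (t b * (1 - e)).
  by move=> Bb W HW; rewrite ce1 //; apply: HW.
(* This operator is nilpotent by [maxe] and has the same kernel as its square. *)
have tR0 r : r \in R -> t r * (1 - e) = 0.
  move=> Rr; have Br := RB _ Rr; set c := t r * (1 - e).
  have cP (u : 'cV_n.+1) : c *m (c *m u) = 0 -> c *m u = 0.
    have Dc (w : 'cV_n.+1) : c *m w = t r *m ((1 - e) *m w) by rewrite mulmxA.
    have Dcc : c *m (c *m u) = t r *m (t r *m ((1 - e) *m u)).
      rewrite mulmxA mulmxE; have -> : c * c = t r * (t r * (1 - e)).
        by rewrite /c mulrA -[t r * _ * t r]mulrA -ce1 // -!mulrA e11.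
      by rewrite -!mulmxE -!mulmxA.
    by rewrite Dcc Dc => /(t2 _ Rr).
  have [k ck] : exists k, c ^+ k = 0.
    apply: maxe; [|by rewrite /c -mulrA e1e mulr0| |exact: inl1|exact: inr1].
    - by move=> b Bb; rewrite /c mulrA -comR // -!mulrA ce1.
    - by rewrite /c ce1 // mulrA ee1 mul0r.
  apply: eq_mulmx_cV => u; rewrite mul0mx.
  suff pow j (v : 'cV_n.+1) : c ^+ j.+1 *m v = 0 -> c *m v = 0.
    by apply: (pow k); rewrite exprSr ck mul0r mul0mx.
  elim: j v => [|j IH] v; first by rewrite expr1.
  by rewrite exprSr -mulmxE -mulmxA => /IH/cP.
pose t1 : 'Hom(L, 'M[F]_n.+1) := linfun (fun b => t b * (1 - e)).
have t1E b : t1 b = t b * (1 - e).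
  rewrite linfunE // => k x y; by rewrite linearP mulrDl scalerAl.
have t1E' b : b \in B -> t1 b = (1 - e) * t b by move=> Bb; rewrite t1E ce1.
have rep1 : {in B &, forall x y, t1 (br x y) = t1 x * t1 y - t1 y * t1 x}.
  have mul1 x y : x \in B -> y \in B -> t1 x * t1 y = t x * t y * (1 - e).
    by move=> Bx By; rewrite !t1E mulrA -[t x * _ * t y]mulrA -ce1 // -!mulrA e11.
  by move=> x y Bx By; rewrite !mul1 // t1E rep // mulrBl.
have t1R : {in R, forall r, t1 r = 0} by move=> r Rr; rewrite t1E tR0.
pose G := (t1 @: B)%VS.
(* Beyond [e] only the semisimple quotient acts; a Casimir element there would be nilpotent with
   nonzero trace. *)
have G0 : G = 0%VS.
  apply/eqP/negPn/negP => nzG.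
  have clG : {in G &, forall p q, p * q - q * p \in G}.
    move=> _ _ /memv_imgP[x Bx ->] /memv_imgP[y By ->].
    by rewrite -rep1 // memv_img // clB.
  have ndG : {in G, forall p, (forall q, q \in G -> \tr (p * q) = 0) -> p = 0}.
    move=> _ /memv_imgP[x Bx ->] Hx.
    apply: (ss_trace_nondegenerate clB ssB rep1 t1R) => // y By.
    by apply: Hx; apply: memv_img.
  have [X [Y [GX GY nzt com]]] := casimir charF0 clG ndG nzG.
  set c := \sum_i X i * Y i in nzt com.
  have ce0 : c * e = 0.
    rewrite mulr_suml big1 // => i _; have /memv_imgP[b Bb ->] := GY i.
    by rewrite t1E -!mulrA e1e !mulr0.
  have ec0 : e * c = 0.
    rewrite mulr_sumr big1 // => i _; have /memv_imgP[b Bb ->] := GX i.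
    by rewrite t1E' // !mulrA ee1 !mul0r.
  have [|||k ck] := maxe c _ ce0 ec0.
  - move=> b Bb; have -> : t b = t1 b + t b * e by rewrite t1E mulrBr mulr1 subrK.
    rewrite mulrDl mulrDr -mulrA ec0 mulr0 addr0 com ?memv_img // ce // mulrA ce0.
    by rewrite mul0r addr0.
  - move=> W HW; apply: memv_suml => i _; have /memv_imgP[b Bb ->] := GX i.
    by rewrite t1E -mulrA HW.
  - move=> W HW; apply: memv_suml => i _; have /memv_imgP[b Bb ->] := GY i.
    by rewrite t1E' // mulrA HW.
  by move/eqP: nzt; rewrite (nilpotent_trace0 ck).
have te b : b \in B -> t b * e = t b.
  move=> Bb; have : t1 b \in G by apply: memv_img.
  by rewrite G0 memv0 t1E mulrBr mulr1 subr_eq0 => /eqP.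
by exists e; split=> // b Bb; rewrite -?ce // te.
Qed.

End SemisimpleQuotient.

(** * Weyl's theorem, and nilpotency of [[B, I]] for solvable [I] *)

Section Modules.
Variables (F : fieldType) (charF0 : [pchar F] =i pred0).
Variables (L : vectType F) (br : 'Hom(L, 'End(L))).
Hypothesis br_alt : forall x, br x x = 0.
Hypothesis br_jac : forall x y z, br (br x y) z = br x (br y z) - br y (br x z).
Local Notation lbr := (fun x y => br x y).
Local Notation subalg := (subalgebra lbr).
Local Notation ideal := (ideal_of lbr).
Local Notation ss := (ss br).

Lemma linear_sub (V W : vectType F) (f : V -> W) a b : linear f -> f (a - b) = f a - f b.
Proof. by move=> lf; have := lf (-1) b a; rewrite !scaleN1r ![- _ + _]addrC. Qed.

(** Weyl's theorem on [M] modulo [P]. The idempotent projects onto the span of the [T b m] along the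
    invariants; the two conclusions say that these together exhaust [M] and that they meet only in
    [P]. *)
Lemma module_split (V : vectType F) (T : 'Hom(L, 'End(V))) (B R : {vspace L})
    (M P : {vspace V}) :
  subalg B -> ss B R -> (P <= M)%VS ->
  {in B & M, forall b m, T b m \in M} -> {in B & P, forall b m, T b m \in P} ->
  {in B & B & M, forall x y m, T (br x y) m - (T x (T y m) - T y (T x m)) \in P} ->
  {in R & B & M, forall r b m, T r (T b m) - T b (T r m) \in P} ->
  {in R & M, forall r m, T r (T r m) \in P -> T r m \in P} ->
  (forall W : {vspace V}, (P <= W)%VS -> {in B & M, forall b m, T b m \in W} ->
     {in M, forall m, exists m0,
        [/\ m0 \in M, m - m0 \in W & {in B, forall b, T b m0 \in P}]}) /\
  {in M, forall v, {in B, forall b, T b v \in P} ->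
     (forall U : {vspace V}, (P <= U)%VS -> {in B & M, forall b m, T b m \in U} ->
        v \in U) -> v \in P}.
Proof.
move=> clB ssB sPM stM stP rep comR semR.
have [n [s [c [r [lc c0 rM sc su]]]]] := subquotient_rep T sPM.
have [[sRB idR] _] := ssB; have RB := subvP sRB.
have sc' b m : b \in B -> m \in M -> s b *m c m = c (T b m).
  by move=> Bb Mm; apply: sc => // p Pp; apply: stP.
have s2 x y u : x \in B -> y \in B -> s x *m (s y *m u) = c (T x (T y (r u))).
  by move=> Bx By; rewrite (su y) sc' ?stM.
have [||| e [tee ete el er]] := reductive_idempotent charF0 br_alt br_jac clB ssB (t := s).
- move=> x y Bx By; apply: eq_mulmx_cV => u.
  rewrite mulmxBl -!mulmxE -!mulmxA su !s2 // -!(linear_sub _ _ lc).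
  apply: subr0_eq; rewrite -(linear_sub _ _ lc).
  by apply/c0; rewrite ?rep // memvB ?stM // ?memvB ?stM // clB.
- move=> x y Rx By; have Bx := RB _ Rx; apply: eq_mulmx_cV => u.
  rewrite -!mulmxE -!mulmxA !s2 //; apply: subr0_eq; rewrite -(linear_sub _ _ lc).
  by apply/c0; rewrite ?comR // memvB ?stM.
- move=> x Rx u; have Bx := RB _ Rx; rewrite s2 // su.
  by move/(c0 _ (stM _ _ Bx (stM _ _ Bx (rM u)))) => /(semR _ _ Rx (rM u)) H; apply/c0; rewrite ?stM.
split.
  move=> W sPW TW m Mm.
  pose C := (linfun c @: (W :&: M))%VS.
  have [W' HW'] : exists W' : {vspace 'M[F]_n.+1}, forall p, p \in W' <-> p *m c m \in C.
    apply: vspace_of_pred => [|k x y Hx Hy]; first by rewrite mul0mx mem0v.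
    by rewrite mulmxDl -scalemxAl memvD ?memvZ.
  have : e \in W'.
    apply: el => b p Bb; apply/HW'; rewrite -mulmxE -mulmxA su.
    by rewrite -(linfunE lc) memv_img // memv_cap TW ?stM.
  move/HW' => /memv_imgP[w /memv_capP[Ww Mw]]; rewrite linfunE // => Ew.
  exists (m - w); rewrite subKr; split=> // [|b Bb]; first exact: memvB.
  have Mmw : m - w \in M by rewrite memvB.
  apply/(c0 _ (stM _ _ Bb Mmw)); rewrite -sc' // (linear_sub _ _ lc) -Ew mulmxBr.
  by rewrite mulmxA mulmxE tee // subrr.
move=> v Mv Tv HU; apply/(c0 _ Mv).
have ev0 : e *m c v = 0.
  have [W' HW'] : exists W' : {vspace 'M[F]_n.+1}, forall p, p \in W' <-> p *m c v = 0.
    apply: vspace_of_pred => [|k x y Hx Hy]; first by rewrite mul0mx.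
    by rewrite mulmxDl -scalemxAl Hx Hy scaler0 addr0.
  apply/HW'; apply: er => b p Bb; apply/HW'; rewrite -mulmxE -mulmxA sc' //.
  by have /(c0 _ (stM _ _ Bb Mv)) -> := Tv b Bb; rewrite mulmx0.
have [U HU'] : exists U : {vspace V}, forall u, u \in U <-> u \in M /\ e *m c u = c u.
  apply: vspace_of_pred => [|k x y [Mx Hx] [My Hy]].
    have -> : c 0 = 0 by rewrite -(linfunE lc) linear0.
    by rewrite mem0v mulmx0.
  by rewrite memvD ?memvZ // lc mulmxDr -scalemxAr Hx Hy.
have /HU'[_ <-] // : v \in U.
apply: HU => [|b m Bb Mm].
  apply/subvP => p Pp; apply/HU'; have Mp := subvP sPM p Pp.
  by have /(c0 _ Mp) -> := Pp; rewrite mulmx0.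
by apply/HU'; split; [exact: stM | rewrite -sc' // mulmxA mulmxE ete].
Qed.

Definition lower (N : {vspace L}) k (U : {vspace L}) := iter k (bracketv br N) U.

Lemma lowerS N k U W : (U <= W)%VS -> (lower N k U <= lower N k W)%VS.
Proof. by move=> sUW; elim: k => //= k IH; apply: bracketvS. Qed.

(** With [P] a maximal ideal of [B] on which [[B, I]] acts nilpotently and [M] a minimal ideal above
    it, [B] acts irreducibly on [M] modulo [P], and [[B, I]] has to act there by zero. Induction is
    on the derived length of the action; vanishing traces give nilpotency, and kernels that are
    ideals must be all of [M]. *)
Lemma solvable_ideal_bracket_nilpotent B I k : subalg B -> ideal B I ->
  der br I k = 0%VS -> exists j, lower (bracketv br B I) j B = 0%VS.
Proof.
move=> clB idI dI0; set N := bracketv br B I.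
pose Q P := ideal B P /\ exists j, lower N j P = 0%VS.
have Q0 : Q 0%VS.
  split; last by exists 0%N.
  by split=> [|x y _]; rewrite ?sub0v // !memv0 => /eqP->; rewrite linear0.
have [P [[idP [j Pj]] _ maxP]] := max_vspace Q0.
have [sPB stP] := idP.
have [PB|nPB] := eqVneq P B; first by exists j; rewrite -PB.
have [M [[idM sPM nPM] _ minM]] : exists M, [/\ [/\ ideal B M, (P <= M)%VS & M != P],
    (M <= B)%VS & forall W, [/\ ideal B W, (P <= W)%VS & W != P] -> (W <= M)%VS -> W = M].
  by apply: min_vspace; split; rewrite 1?eq_sym //; apply: ideal_full.
have [sMB stM] := idM; have MB := subvP sMB.
suff NM : (bracketv br N M <= P)%VS.
  case/negP: nPM; apply/eqP/maxP => //; split=> //; exists j.+1.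
  apply/eqP; rewrite -subv0 -Pj /lower iterSr; exact: lowerS.
have [n [s [c [r [lc c0 rM sc su]]]]] := subquotient_rep br sPM.
have sc' b m : b \in B -> m \in M -> s b *m c m = c (br b m).
  by move=> Bb Mm; apply: sc => // p Pp; apply: stP.
have s2 x y u : x \in B -> y \in B -> s x *m (s y *m u) = c (br x (br y (r u))).
  by move=> Bx By; rewrite (su y) sc' ?stM.
have rep x y : x \in B -> y \in B -> s (br x y) = s x * s y - s y * s x.
  move=> Bx By; apply: eq_mulmx_cV => u.
  by rewrite mulmxBl -!mulmxE -!mulmxA su !s2 // -!(linear_sub _ _ lc) br_jac.
have triv x : x \in B -> (forall m, m \in M -> br x m \in P) -> s x = 0.
  move=> Bx xM; apply: eq_mulmx_cV => u; rewrite mul0mx su.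
  by apply/c0; rewrite ?stM ?xM.
have nilp z (D : {vspace L}) : z \in D -> {in D, forall w k, \tr (s w * s z ^+ k) = 0} ->
    exists k, s z ^+ k = 0.
  by move=> Dz H; apply: (trace_powers0_nilpotent charF0) => i; rewrite exprS H.
suff main i (I' : {vspace L}) : ideal B I' ->
    {in der br I' i & M, forall z m, br z m \in P} ->
    {in bracketv br B I' & M, forall z m, br z m \in P}.
  apply: bracketv_sub; apply: (main k) => // z m; rewrite dI0 memv0 => /eqP-> _.
  by rewrite br0 // mem0v.
elim: i I' => [|i IH] I' idI' dM.
  move=> z m Nz Mm; apply: dM => //; apply: (subvP (bracketv_sub _) _ Nz) => b a Bb Ia.
  by case: idI' => _; apply.
have I'B : {subset I' <= B} by apply/subvP; case: idI'.
pose I1 := bracketv br I' I'; have idI1 : ideal B I1 by apply: ideal_bracketv.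
have I1B : {subset I1 <= B} by apply/subvP; case: idI1.
have I1I' : {subset I1 <= I'}.
  by apply/subvP/bracketv_sub => a b Ia Ib; case: idI' => _; apply => //; apply: I'B.
have BI1 : {in bracketv br B I1 & M, forall z m, br z m \in P}.
  by apply: IH => //; rewrite /I1 der_shift.
have comI1 b z : b \in B -> z \in I1 -> s b * s z = s z * s b.
  move=> Bb Iz; apply: subr0_eq; rewrite -(rep b z Bb (I1B z Iz)); apply: triv => [|m Mm].
    by apply: clB => //; apply: I1B.
  by apply: BI1 => //; apply: mem_bracketv.
(* [s z] commutes with the image of [B], so traces of its powers against brackets vanish and it is
   nilpotent; its kernel is an ideal. *)
have I1M : {in I1 & M, forall z m, br z m \in P}.
  move=> z m Iz Mm; have Bz := I1B z Iz.
  have [k' nil] : exists k, s z ^+ k = 0.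
    apply: (nilp z I1) => // w I1w e.
    have [U HU] : exists U : {vspace L}, forall w, w \in U <-> \tr (s w * s z ^+ e) = 0.
      apply: vspace_of_pred => [|a u v Hu Hv]; first by rewrite linear0 mul0r linear0.
      by rewrite linearP mulrDl -scalerAl linearP /= Hu Hv mulr0 addr0.
    apply/HU; apply: (subvP (bracketv_sub _) _ I1w) => a b Ia Ib; apply/HU.
    have [Ba Bb] := (I'B a Ia, I'B b Ib).
    rewrite rep // mxtrace_invariant (_ : s b * _ = s z ^+ e * s b) ?subrr ?mulr0 ?linear0 //.
    by apply: commrX; apply: comI1.
  have [U HU] : exists U : {vspace L}, forall v, v \in U <-> v \in M /\ br z v \in P.
    apply: vspace_of_pred => [|a u v [Mu Hu] [Mv Hv]]; first by rewrite linear0 !mem0v.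
    by rewrite linearP !memvD ?memvZ.
  have idU : ideal B U.
    split=> [|b v Bb /HU[Mv Pv]]; first by apply/subvP => v /HU[/MB].
    apply/HU; split; first exact: stM.
    rewrite br_leibniz // (br_anti br_alt z b) brN // memvD ?(stP b) // memvN.
    by apply: BI1 => //; apply: mem_bracketv.
  have sPU : (P <= U)%VS.
    by apply/subvP => p Pp; apply/HU; split; [apply: (subvP sPM) | apply: stP].
  have sUM : (U <= M)%VS by apply/subvP => v /HU[].
  suff UM : U = M by move: Mm; rewrite -UM => /HU[].
  apply: minM => //; split=> //; apply: contra nPM => /eqP UP.
  rewrite eqEsubv sPM andbT; apply/subvP => v Mv.
  have iterM : forall e, iter e (br z) v \in M by elim=> //= e; apply: stM.
  have : iter k' (br z) v \in P.
    apply/c0 => //; suff -> e : c (iter e (br z) v) = s z ^+ e *m c v.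
      by rewrite nil mul0mx.
    elim: e => [|e IHe]; first by rewrite mul1mx.
    by rewrite iterS -sc' // IHe exprS -mulmxE mulmxA.
  elim: {nil} k' => // e IHe Pe; apply: IHe.
  by rewrite -UP; apply/HU.
pose N' := bracketv br B I'; have idN' : ideal B N'.
  by apply: ideal_bracketv => //; apply: ideal_full.
have N'I' : {subset N' <= I'}.
  by apply/subvP/bracketv_sub => b a Bb Ia; case: idI' => _; apply.
have comI' z a : z \in N' -> a \in I' -> s z * s a = s a * s z.
  move=> Nz Ia; have Bz := I'B z (N'I' z Nz); have Ba := I'B a Ia.
  apply: subr0_eq; rewrite -(rep z a Bz Ba); apply: triv => [|m Mm]; first exact: clB.
  by apply: I1M => //; apply: mem_bracketv => //; apply: N'I'.
(* Elements of [[B, I']] are known to commute only with [I'], so single kernels need not be ideals;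
   Engel's theorem supplies a common kernel, which is one. *)
have [||k' Hk] := @linear_engel _ n (s @: N')%VS.
- move=> _ _ /memv_imgP[x Nx ->] /memv_imgP[y Ny ->].
  by rewrite comI' ?subrr ?mem0v //; apply: N'I'.
- move=> _ /memv_imgP[z Nz ->]; apply: (nilp z N') => // w Nw e.
  have [U HU] : exists U : {vspace L}, forall w, w \in U <-> \tr (s w * s z ^+ e) = 0.
    apply: vspace_of_pred => [|a u v Hu Hv]; first by rewrite linear0 mul0r linear0.
    by rewrite linearP mulrDl -scalerAl linearP /= Hu Hv mulr0 addr0.
  apply/HU; apply: (subvP (bracketv_sub _) _ Nw) => b a Bb Ia; apply/HU.
  rewrite (rep b a Bb (I'B a Ia)) mxtrace_invariant (_ : s a * _ = s z ^+ e * s a) ?subrr ?mulr0 ?linear0 //.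
  by apply: commrX; apply/esym/comI'.
have [U HU] : exists U : {vspace L}, forall v, v \in U <->
    v \in M /\ forall z, z \in N' -> br z v \in P.
  apply: vspace_of_pred => [|a u v [Mu Hu] [Mv Hv]].
    by split=> [|z _]; rewrite ?linear0 mem0v.
  by split=> [|z Nz]; rewrite ?linearP memvD ?memvZ ?Hu ?Hv.
have idU : ideal B U.
  split=> [|b v Bb /HU[Mv Pv]]; first by apply/subvP => v /HU[/MB].
  apply/HU; split=> [|z Nz]; first exact: stM.
  rewrite br_leibniz // (br_anti br_alt z b) brN // memvD ?(stP b) ?Pv // memvN.
  by apply: Pv; case: idN' => _; apply.
have sPU : (P <= U)%VS.
  apply/subvP => p Pp; apply/HU; split=> [|z Nz]; first exact: (subvP sPM).
  by apply: stP => //; apply/I'B/N'I'.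
have sUM : (U <= M)%VS by apply/subvP => v /HU[].
suff UM : U = M by move=> z m Nz; rewrite -UM => /HU[_]; apply.
apply: minM => //; split=> //; apply: contra nPM => /eqP UP.
rewrite eqEsubv sPM andbT; apply/subvP => v Mv.
have {Hk} := Hk (c v); elim: k' v Mv => [|e IHe] v Mv /=; first by move/c0; apply.
move=> Kv; rewrite -UP; apply/HU; split=> // z Nz.
have Bz := I'B z (N'I' z Nz); apply: IHe; first exact: stM.
by rewrite -sc' //; apply: Kv; apply: memv_img.
Qed.

End Modules.

(** * The radical of an A-algebra *)

Section EndModule.
Variables (F : fieldType) (L : vectType F) (br : 'Hom(L, 'End(L))).
Hypothesis br_alt : forall x, br x x = 0.
Hypothesis br_jac : forall x y z, br (br x y) z = br x (br y z) - br y (br x z).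
Implicit Types (f g : 'End(L)).

Definition act_end : 'Hom(L, 'End('End(L))) := linfun (fun x => comm_endo (br x)).

Lemma act_endE x f v : act_end x f v = br x (f v) - f (br x v).
Proof.
rewrite /act_end linfunE ?comm_endovE // => k y z; apply/lfunP => g; apply/lfunP => w.
rewrite add_lfunE scale_lfunE add_lfunE scale_lfunE !comm_endovE !brP.
by rewrite linearP scalerBr opprD addrACA.
Qed.

Lemma act_end_rep x y f :
  act_end (br x y) f = act_end x (act_end y f) - act_end y (act_end x f).
Proof.
apply/lfunP => v; rewrite add_lfunE opp_lfunE !act_endE !br_jac.
rewrite [f (_ - _)]linearB [br x (_ - _)]linearB [br y (_ - _)]linearB /=.
exact: commutator_jacobi.
Qed.

End EndModule.

Section AAlgebra.
Variables (F : fieldType) (charF0 : [pchar F] =i pred0).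
Variables (L : vectType F) (br : 'Hom(L, 'End(L))).
Hypothesis br_alt : forall x, br x x = 0.
Hypothesis br_jac : forall x y z, br (br x y) z = br x (br y z) - br y (br x z).
Local Notation lbr := (fun x y => br x y).
Local Notation subalg := (subalgebra lbr).
Local Notation ideal := (ideal_of lbr).
Local Notation ss := (ss br).
Local Notation abelian := (abelian_subalgebra lbr).
Hypothesis Aalg : A_algebra lbr.
Implicit Types (B E I J N R : {vspace L}).

Lemma nilpotent_abelian B j : subalg B -> lower br B j B = 0%VS -> abelian B.
Proof. by move=> clB lB; apply: Aalg; split=> //; exists j. Qed.

Lemma class2_abelian B : subalg B ->
  {in B & B & B, forall x y z, br x (br y z) = 0} -> abelian B.
Proof.
move=> clB H; apply: (@nilpotent_abelian _ 2) => //; apply/eqP; rewrite -subv0.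
apply: bracketv_sub => x w Bx; have [U HU] : exists U : {vspace L}, forall v, v \in U <->
    br x v = 0.
  apply: vspace_of_pred => [|k u v Hu Hv]; first by rewrite linear0.
  by rewrite linearP /= Hu Hv scaler0 addr0.
move=> Ww; rewrite memv0; apply/eqP/HU; apply: (subvP (bracketv_sub _) _ Ww) => y z By Bz.
by apply/HU; apply: H.
Qed.

(** [x], [u] and [br x u] span a Heisenberg algebra or a quotient of one; it is nilpotent, hence
    abelian. *)
Lemma heisenberg_trivial x u : br x (br x u) = 0 -> br u (br x u) = 0 -> br x u = 0.
Proof.
move=> xxu uxu; set w := br x u; pose H := <<[:: x; u; w]>>%VS.
have [Hx Hu Hw] : [/\ x \in H, u \in H & w \in H].
  by split; apply: memv_span; rewrite !inE eqxx ?orbT.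
have w0 z : z \in H -> br w z = 0.
  have [U HU] : exists U : {vspace L}, forall v, v \in U <-> br w v = 0.
    apply: vspace_of_pred => [|k p q Hp Hq]; first by rewrite linear0.
    by rewrite linearP /= Hp Hq scaler0 addr0.
  move=> Hz; apply/HU; apply: (subvP _ _ Hz); apply/span_subvP => y.
  rewrite !inE => /or3P[] /eqP->; apply/HU; rewrite ?br_alt // br_anti // ?xxu ?uxu ?oppr0 //.
have HH y z : y \in H -> z \in H -> br y z \in <[w]>%VS.
  move=> Hy Hz; apply: (subvP _ _ (mem_bracketv br Hy Hz)); apply: bracketv_sub => y1 z1.
  have [U HU] : exists U : {vspace L}, forall v, v \in U <-> forall t, t \in H -> br v t \in <[w]>%VS.
    apply: vspace_of_pred => [t _|k p q Hp Hq t Ht]; first by rewrite br0 // mem0v.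
    by rewrite brP memvD ?memvZ ?Hp ?Hq.
  have [U' HU'] : exists U : {vspace L}, forall v, v \in U <->
      br x v \in <[w]>%VS /\ br u v \in <[w]>%VS.
    apply: vspace_of_pred => [|k p q [Hp Hp'] [Hq Hq']]; first by rewrite !linear0 mem0v.
    by rewrite !linearP !memvD ?memvZ.
  have HU'z t : t \in H -> t \in U'.
    move=> Ht; apply: (subvP _ _ Ht); apply/span_subvP => q; rewrite !inE.
    case/or3P => /eqP->; apply/HU'; rewrite ?br_alt ?xxu ?uxu ?mem0v ?memv_line //.
    by rewrite br_anti // memvN memv_line.
  move=> Hy' Hz'; suff /HU : y1 \in U by apply.
  apply: (subvP _ _ Hy'); apply/span_subvP => q; rewrite !inE.
  case/or3P => /eqP->; apply/HU => t /[dup] Ht /HU'z /HU'[Hx' Hu'] //.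
  by rewrite w0 ?mem0v.
have clH : subalg H.
  by move=> y z Hy Hz; have /vlineP[k ->] := HH y z Hy Hz; rewrite memvZ.
apply: (class2_abelian clH _ Hx Hu) => y z t Hy Hz Ht.
by have /vlineP[k ->] := HH z t Hz Ht; rewrite linearZ /= br_anti // w0 // oppr0 scaler0.
Qed.

(** Brackets in the sum fall into [N :&: I], which commutes with both summands; the sum has class at
    most two. *)
Lemma abelian_ideal_sum B N I : ideal B N -> abelian N -> ideal B I -> abelian I ->
  subalg B -> abelian (N + I)%VS.
Proof.
move=> idN aN idI aI clB; have idS := idealD idN idI.
have [sN stN] := idN; have [sI stI] := idI; have NB := subvP sN; have IB := subvP sI.
have brS x y : x \in (N + I)%VS -> y \in (N + I)%VS -> br x y \in N /\ br x y \in I.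
  move=> /memv_addP[u Nu [v Iv ->]] /memv_addP[u' Nu' [v' Iv' ->]].
  rewrite brD // !linearD /= (aN _ _ Nu Nu') (aI _ _ Iv Iv') add0r addr0.
  have [Bu Bu'] := (NB u Nu, NB u' Nu'); have [Bv Bv'] := (IB v Iv, IB v' Iv').
  rewrite !memvD //; try exact: stN; try exact: stI.
    exact: (ideal_r br_alt idI).
  exact: (ideal_r br_alt idN).
apply: class2_abelian; first exact: ideal_sub idS clB.
move=> x y z Sx Sy Sz; have [Nw Iw] := brS y z Sy Sz.
by case/memv_addP: Sx => u Nu [v Iv ->]; rewrite brD // (aN _ _ Nu Nw) (aI _ _ Iv Iw) addr0.
Qed.

(* [N] is the largest abelian ideal, and [R] the preimage of the centre of [B/N];
   the quotient [B/R] is semisimple because [[B, I]] is nilpotent, hence abelian,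
   for each solvable ideal [I]. *)
Lemma abelian_radical B : subalg B -> exists N R,
  [/\ [/\ ideal B N, abelian N & (N <= R)%VS], ss B R,
      {in R & B, forall r b, br r b \in N} &
      forall I, ideal B I -> abelian I -> (I <= N)%VS].
Proof.
move=> clB; pose Q N := ideal B N /\ abelian N.
have Q0 : Q 0%VS.
  split; last by move=> x y; rewrite memv0 => /eqP-> _; rewrite br0.
  by split=> [|x y _]; rewrite ?sub0v // !memv0 => /eqP->; rewrite linear0.
have [N [[idN aN] _ maxN]] := max_vspace Q0.
have maxN' I : ideal B I -> abelian I -> (I <= N)%VS.
  move=> idI aI; rewrite -(maxN (N + I)%VS) ?addvSl ?addvSr //.
  by split; [apply: idealD | apply: (abelian_ideal_sum idN)].
have [R HR] : exists R : {vspace L}, forall x, x \in R <->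
    x \in B /\ forall y, y \in B -> br x y \in N.
  apply: vspace_of_pred => [|k u v [Bu Hu] [Bv Hv]].
    by split=> [|y _]; rewrite ?br0 // mem0v.
  by split=> [|y By]; rewrite ?brP memvD ?memvZ ?Hu ?Hv.
have [sNB stN] := idN; have NB := subvP sNB.
have sNR : (N <= R)%VS.
  apply/subvP => x Nx; apply/HR; split=> [|y By]; first exact: NB.
  exact: (ideal_r br_alt idN).
have idR : ideal B R.
  split=> [|x y Bx /HR[By Hy]]; first by apply/subvP => x /HR[].
  apply/HR; split=> [|z Bz]; first exact: clB.
  rewrite br_jac memvB //; first by apply: stN => //; apply: Hy.
  by apply: Hy; apply: clB.
exists N, R; split=> //; last by move=> r b /HR[_]; apply.
split=> // I idI dI; have [sIB stI] := idI; have IB := subvP sIB.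
pose K := bracketv br B I; have idK : ideal B K by apply: ideal_bracketv => //; apply: ideal_full.
have [j Hj] : exists j, lower br K j B = 0%VS.
  (* Three derivations suffice: [[I, I]] lies in [R], the next term in [[R, B]] and so in [N], and
     [N] is abelian. *)
  apply: (solvable_ideal_bracket_nilpotent charF0 br_alt br_jac (k := 3)) => //.
  apply/eqP; rewrite -subv0 /=; set D1 := bracketv br I I in dI *.
  have sD2 : (bracketv br D1 D1 <= N)%VS.
    apply: bracketv_sub => x y /(subvP dI)/HR[_ Hx] /(subvP dI)/HR[By _].
    exact: Hx.
  apply: bracketv_sub => x y /(subvP sD2) Nx /(subvP sD2) Ny.
  by rewrite aN // mem0v.
have /maxN' : ideal B K by [].
have aK : abelian K.
  apply: (@nilpotent_abelian _ j); first exact: ideal_sub idK clB.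
  apply/eqP; rewrite -subv0 -Hj; apply: lowerS; by case: idK.
move/(_ aK)/subvP => sKN; apply/subvP => x Ix; apply/HR; split=> [|y By]; first exact: IB.
by rewrite br_anti // memvN; apply: sKN; apply: mem_bracketv.
Qed.

End AAlgebra.

(** * Complementary subalgebras and submodules *)

Section Complements.
Variables (F : fieldType) (charF0 : [pchar F] =i pred0).
Variables (L : vectType F) (br : 'Hom(L, 'End(L))).
Hypothesis br_alt : forall x, br x x = 0.
Hypothesis br_jac : forall x y z, br (br x y) z = br x (br y z) - br y (br x z).
Local Notation lbr := (fun x y => br x y).
Local Notation subalg := (subalgebra lbr).
Local Notation ideal := (ideal_of lbr).
Local Notation ss := (ss br).
Local Notation abelian := (abelian_subalgebra lbr).
Implicit Types (B C D E I J N R : {vspace L}).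

(** An ideal [I] of [C] gives the ideal [I + N] of [B], still abelian modulo [R]. *)
Lemma ss_restrict B C N R : subalg B -> subalg C -> (C <= B)%VS -> ss B R ->
  ideal B N -> (N <= R)%VS -> (B <= C + N)%VS -> ss C (R :&: C).
Proof.
move=> clB clC sCB [[sRB stR] maxR] idN sNR sBCN.
split.
  split=> [|x y Cx /memv_capP[Ry Cy]]; first exact: capvSr.
  by rewrite memv_cap clC // stR // (subvP sCB).
move=> I [sIC stI] dI; rewrite subv_cap sIC andbT.
have [sNB stN] := idN; have CB := subvP sCB.
apply: (@subv_trans _ _ (I + N)%VS); first exact: addvSl.
apply: maxR.
  split=> [|x y /(subvP sBCN)/memv_addP[c Cc [u Nu ->]] /memv_addP[i Ii [v Nv ->]]].
    by rewrite subv_add sNB (subv_trans sIC).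
  rewrite linearD /=; apply: memvD.
    rewrite brD // memv_add ?stI //; apply: (ideal_r br_alt idN) => //.
    exact/CB/(subvP sIC).
  apply: (subvP (addvSr _ _)); apply: stN => //.
  by apply: memvD; [exact: CB | exact: (subvP sNB)].
apply: bracketv_sub => _ _ /memv_addP[i Ii [u Nu ->]] /memv_addP[i' Ii' [v Nv ->]].
have [Bi Bi'] := (CB i (subvP sIC i Ii), CB i' (subvP sIC i' Ii')).
rewrite brD // !linearD /= !memvD //.
- by apply: (subvP (capvSl _ _)); apply: (subvP dI); apply: mem_bracketv.
- by apply: (subvP sNR); apply: stN.
- by apply: (subvP sNR); apply: (ideal_r br_alt idN).
- by apply: (subvP sNR); apply: stN => //; apply: (subvP sNB).
Qed.

(** [M] consists of the maps from [B] to [R] that are scalar on [R], and [P] of those given by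
    [br a] with [a] in [R]. Splitting yields a map [f], invariant modulo [P] and the identity on
    [R]; its stabilizer [D0] supplements [R]. *)
Lemma levi_complement B R : subalg B -> ss B R -> abelian R ->
  exists D, [/\ subalg D, (D <= B)%VS, (D + R)%VS = B & (D :&: R = 0)%VS].
Proof.
move=> clB ssB aR; have [idR maxR] := ssB; have [sRB stR] := idR; have RB := subvP sRB.
pose T := act_end br; have TE := act_endE br.
have [M HM] : exists M : {vspace 'End(L)}, forall f, f \in M <->
    (forall x, x \in B -> f x \in R) /\ exists k, forall x, x \in R -> f x = k *: x.
  apply: vspace_of_pred => [|k f g [fB [a fR]] [gB [b gR]]].
    by split=> [x _|]; [|exists 0 => x _]; rewrite zero_lfunE ?mem0v ?scale0r.
  split=> [x Bx|]; first by rewrite add_lfunE scale_lfunE memvD ?memvZ ?fB ?gB.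
  by exists (k * a + b) => x Rx; rewrite add_lfunE scale_lfunE fR // gR // scalerA scalerDl.
have [P HP] : exists P : {vspace 'End(L)}, forall f, f \in P <->
    f \in M /\ exists2 a, a \in R & forall x, x \in B -> f x = br a x.
  apply: vspace_of_pred => [|k f g [fM [a Ra fa]] [gM [b Rb gb]]].
    by split; [exact: mem0v | exists 0 => [|x _]; rewrite ?mem0v // zero_lfunE br0].
  split; first by rewrite memvD ?memvZ.
  exists (k *: a + b) => [|x Bx]; first by rewrite memvD ?memvZ.
  by rewrite add_lfunE scale_lfunE fa // gb // brP.
have sPM : (P <= M)%VS by apply/subvP => f /HP[].
have TR b f x : b \in B -> f \in M -> x \in R -> T b f x = 0.
  move=> Bb /HM[_ [k fk]] Rx; rewrite TE !fk ?stR // linearZ /= subrr //.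
have stM : {in B & M, forall b f, T b f \in M}.
  move=> b f Bb Mf; have [fB _] := (HM f).1 Mf; apply/HM; split=> [x Bx|].
    by rewrite TE memvB ?(stR b) ?fB // clB.
  by exists 0 => x Rx; rewrite TR // scale0r.
have stP : {in B & P, forall b f, T b f \in P}.
  move=> b f Bb /HP[Mf [a Ra fa]]; apply/HP; split; first exact: stM.
  exists (br b a) => [|x Bx]; first exact: stR.
  by rewrite TE !fa // ?br_jac //; apply: clB.
have TRP a f : a \in R -> f \in M -> T a f \in P.
  move=> Ra Mf; have Ba := RB a Ra; apply/HP; split; first exact: stM.
  have [fB [k fk]] := (HM f).1 Mf; exists (- (k *: a)) => [|x Bx].
    by rewrite memvN memvZ.
  rewrite TE aR ?fB // sub0r fk; last exact: (ideal_r br_alt idR).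
  by rewrite brN // -[k *: a]addr0 brP br0 // addr0.
have [|||split_ _] :=
  module_split charF0 br_alt br_jac (T := T) clB ssB sPM stM stP.
- by move=> x y f _ _ _; rewrite act_end_rep // subrr mem0v.
- move=> r b f Rr Bb Mf; rewrite -act_end_rep //; apply: TRP => //.
  exact: (ideal_r br_alt idR).
- by move=> r f Rr Mf _; apply: TRP.
have [W HW] : exists W : {vspace 'End(L)}, forall f, f \in W <->
    forall x, x \in R -> f x = 0.
  apply: vspace_of_pred => [x _|k f g f0 g0 x Rx]; first by rewrite zero_lfunE.
  by rewrite add_lfunE scale_lfunE f0 ?g0 // scaler0 addr0.
have [|||f [Mf Wf Tf]] := split_ W _ _ (projv R).
- by apply/subvP => f /HP[_ [a Ra fa]]; apply/HW => x Rx; rewrite fa ?aR ?RB.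
- by move=> b f Bb Mf; apply/HW => x Rx; apply: TR.
- apply/HM; split=> [x _|]; first exact: memv_proj.
  by exists 1 => x Rx; rewrite scale1r projv_id.
have fid x : x \in R -> f x = x.
  move=> Rx; move/HW/(_ x Rx)/eqP: Wf.
  by rewrite add_lfunE opp_lfunE projv_id // subr_eq0 => /eqP.
have [fB _] := (HM f).1 Mf.
have [D0 HD0] : exists D0 : {vspace L}, forall x, x \in D0 <->
    x \in B /\ forall y, y \in B -> T x f y = 0.
  apply: vspace_of_pred => [|k u v [Bu Hu] [Bv Hv]].
    by split=> [|y _]; rewrite ?mem0v // linear0 !zero_lfunE.
  split=> [|y By]; first by rewrite memvD ?memvZ.
  by rewrite hom_linearP add_lfunE scale_lfunE Hu // Hv // scaler0 addr0.
have D0B : {subset D0 <= B} by move=> x /HD0[].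
have sD0B : (D0 <= B)%VS by apply/subvP.
have clD0 : subalg D0.
  move=> x y /HD0[Bx Hx] /HD0[By Hy]; apply/HD0; split=> [|z Bz]; first exact: clB.
  rewrite /T act_end_rep // add_lfunE opp_lfunE -/T.
  rewrite [T x (T y f) z]TE [T y (T x f) z]TE.
  by rewrite !Hy ?Hx ?linear0 ?subrr //; apply: clB.
have D0R : (D0 + R)%VS = B.
  apply/eqP; rewrite eqEsubv subv_add sRB sD0B /=; apply/subvP => x Bx.
  have /HP[_ [a Ra Ta]] := Tf x Bx; rewrite -(addrK a x) memv_add ?memvN //.
  apply/HD0; split=> [|y By]; first by rewrite memvD // RB.
  have -> : T (x + a) f y = T x f y + T a f y.
    by have := hom_linearP T 1 x a f; rewrite !scale1r => ->; rewrite add_lfunE.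
  rewrite Ta // TE (aR _ _ Ra (fB y By)) fid ?sub0r ?subrr //.
  exact: (ideal_r br_alt idR).
(* [Z] is central in [B], so [D0] is the direct sum of [Z] and [[D0, D0]], and the second summand is
   the complement. *)
pose Z := (R :&: D0)%VS; have ssZ : ss D0 Z.
  by apply: (ss_restrict clB clD0 sD0B ssB idR) => //; rewrite D0R.
have Z0 z x : z \in Z -> x \in B -> br z x = 0.
  move=> /memv_capP[Rz /HD0[Bz Hz]] Bx; have := Hz x Bx.
  rewrite TE (aR _ _ Rz (fB x Bx)) fid ?(ideal_r br_alt idR Rz Bx) // sub0r => /eqP.
  by rewrite oppr_eq0 => /eqP.
pose D := bracketv br D0 D0; have idD : ideal D0 D.
  by apply: ideal_bracketv => //; apply: ideal_full.
have [||||||splitD uniqD] :=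
  module_split charF0 br_alt br_jac (T := br) (M := D0) (P := 0%VS) clD0 ssZ.
- exact: sub0v.
- by move=> b m; apply: clD0.
- by move=> b m _; rewrite !memv0 => /eqP->; rewrite linear0.
- by move=> x y m _ _ _; rewrite br_jac subrr mem0v.
- move=> r b m Zr Db Dm; rewrite (Z0 r (br b m) Zr (D0B _ (clD0 _ _ Db Dm))).
  by rewrite (Z0 r m Zr (D0B _ Dm)) linear0 subrr mem0v.
- by move=> r m Zr Dm _; rewrite (Z0 r) ?mem0v // D0B.
have ZD : (Z :&: D = 0)%VS.
  apply/eqP; rewrite -subv0; apply/subvP => v /memv_capP[Zv Dv].
  have D0v : v \in D0 by case/memv_capP: Zv.
  apply: uniqD => // [b Db|U _ HU]; first by rewrite br_anti // Z0 ?oppr0 ?mem0v // D0B.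
  exact: (subvP (bracketv_sub HU)).
have D0ZD : (D0 <= Z + D)%VS.
  apply/subvP => x Dx; have [|b m Db Dm|d [Dd Wd Hd]] := splitD D _ _ x Dx.
  - exact: sub0v.
  - exact: mem_bracketv.
  rewrite -(subrK d x) addrC memv_add //.
  have [C HC] : exists C : {vspace L}, forall x, x \in C <->
      x \in D0 /\ forall b, b \in D0 -> br b x = 0.
    apply: vspace_of_pred => [|k u v [Du Hu] [Dv Hv]].
      by split=> [|b _]; rewrite ?mem0v // linear0.
    by split=> [|b Db]; rewrite ?memvD ?memvZ // linearP /= Hu ?Hv // scaler0 addr0.
  have [_ maxZ] := ssZ; have /maxZ sCZ : ideal D0 C.
    split=> [|b c Db /HC[Dc Hc]]; first by apply/subvP => c /HC[].
    by rewrite Hc // mem0v.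
  apply: (subvP (sCZ _)); last first.
    by apply/HC; split=> // b Db; apply/eqP; rewrite -memv0 Hd.
  by apply: bracketv_sub => c c' /HC[Dc _] /HC[_ Hc']; rewrite Hc' // mem0v.
have [sDD0 _] := idD.
exists D; split.
- exact: ideal_sub idD clD0.
- exact: subv_trans sD0B.
- apply/eqP; rewrite eqEsubv subv_add sRB (subv_trans sDD0) //= -{1}D0R subv_add addvSr andbT.
  apply: (subv_trans D0ZD); rewrite addvC; apply: addvS => //; exact: capvSl.
apply/eqP; rewrite -subv0 -ZD; apply/subvP => x /memv_capP[Dx Rx].
by rewrite !memv_cap Rx Dx (subvP sDD0).
Qed.

(** Splitting [R] gives [R = C + N] with [C] central in [B]. A complement of [N] in [R] taken inside
    [C] can be added to a Levi complement. *)
Lemma central_complement B N R : subalg B -> ss B R -> abelian R ->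
  ideal B N -> (N <= R)%VS -> {in R & B, forall r b, br r b \in N} ->
  exists E, [/\ subalg E, (E <= B)%VS, (E + N)%VS = B & (E :&: N = 0)%VS].
Proof.
move=> clB ssB aR idN sNR RBN.
have [D [clD sDB DR DR0]] := levi_complement clB ssB aR.
have [[sRB stR] _] := ssB; have RB := subvP sRB; have DB := subvP sDB.
have [||||||split_ _] :=
  module_split charF0 br_alt br_jac (T := br) (M := R) (P := 0%VS) clB ssB.
- exact: sub0v.
- by move=> b m; apply: stR.
- by move=> b m _; rewrite !memv0 => /eqP->; rewrite linear0.
- by move=> x y m _ _ _; rewrite br_jac subrr mem0v.
- by move=> r b m Rr Bb Rm; rewrite !(aR r) ?stR // linear0 subrr mem0v.
- by move=> r m Rr Rm _; rewrite aR // mem0v.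
have [C HC] : exists C : {vspace L}, forall x, x \in C <->
    x \in R /\ forall b, b \in B -> br b x = 0.
  apply: vspace_of_pred => [|k u v [Du Hu] [Dv Hv]].
    by split=> [|b _]; rewrite ?mem0v // linear0.
  by split=> [|b Bb]; rewrite ?memvD ?memvZ // linearP /= Hu ?Hv // scaler0 addr0.
have sRC : (R <= C + N)%VS.
  apply/subvP => x Rx; have [|b m Bb Rm|d [Rd Wd Hd]] := split_ N _ _ x Rx.
  - exact: sub0v.
  - by rewrite br_anti // memvN RBN.
  rewrite -(subrK d x) addrC memv_add //; apply/HC; split=> // b Bb.
  by apply/eqP; rewrite -memv0 Hd.
pose R' := (C :\: N)%VS.
have R'C : {subset R' <= C} by apply/subvP/diffvSl.
have sCR : (C <= R)%VS by apply/subvP => x /HC[].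
have sR'R : (R' <= R)%VS by apply: subv_trans sCR; apply: diffvSl.
have R'N : (R' + N = R)%VS.
  apply/eqP; rewrite eqEsubv subv_add sR'R sNR /= (subv_trans sRC) //.
  by rewrite /R' addv_diff.
exists (D + R')%VS; split.
- move=> _ _ /memv_addP[d Dd [r Rr ->]] /memv_addP[d' Dd' [r' Rr' ->]].
  have /HC[_ Hr] := R'C r Rr; have /HC[Rr1 Hr'] := R'C r' Rr'.
  rewrite brD // linearD /= (Hr' d) ?addr0 ?DB // (br_anti br_alt r) Hr ?oppr0 ?addr0.
    by apply: (subvP (addvSl _ _)); apply: clD.
  by apply: memvD; [apply: DB | apply: RB].
- by rewrite subv_add sDB (subv_trans sR'R).
- by rewrite -addvA R'N.
apply/eqP; rewrite -subv0; apply/subvP => x /memv_capP[/memv_addP[d Dd [r R'r ->]] Nx].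
have Rd : d \in R.
  by rewrite -(addrK r d) memvB //; [apply: (subvP sNR) | apply: (subvP sR'R)].
have d0 : d = 0 by apply/eqP; rewrite -memv0 -DR0 memv_cap Dd.
by move: Nx; rewrite d0 add0r => Nr; rewrite -(capv_diff C N) memv_cap R'r.
Qed.

(** An equivariant projection of [N] onto [I] is found among maps scalar on [I], modulo those zero
    on [N]. Brackets of [R] with [B] lie in [N] and act by zero; separability keeps the kernel of
    [r] in [R] from growing under squaring. *)
Lemma reductive_submodule_complement B N R I : subalg B -> ideal B N -> abelian N ->
  ss B R -> {in R & B, forall r b, br r b \in N} ->
  {in R, forall r, exists2 q, separable_poly q & {in N, forall u, evp (br r) q u = 0}} ->
  ideal B I -> (I <= N)%VS ->
  exists J, [/\ ideal B J, (J <= N)%VS, (I + J = N)%VS & (I :&: J = 0)%VS].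
Proof.
move=> clB idN aN ssB RBN sepR idI sIN.
have [sNB stN] := idN; have NB := subvP sNB; have [sIB stI] := idI; have IN := subvP sIN.
have [[sRB stR] _] := ssB; have RB := subvP sRB.
pose T := act_end br; have TE := act_endE br.
have [M HM] : exists M : {vspace 'End(L)}, forall f, f \in M <->
    (forall x, x \in N -> f x \in I) /\ exists k, forall x, x \in I -> f x = k *: x.
  apply: vspace_of_pred => [|k f g [fB [a fR]] [gB [b gR]]].
    by split=> [x _|]; [|exists 0 => x _]; rewrite zero_lfunE ?mem0v ?scale0r.
  split=> [x Bx|]; first by rewrite add_lfunE scale_lfunE memvD ?memvZ ?fB ?gB.
  by exists (k * a + b) => x Rx; rewrite add_lfunE scale_lfunE fR // gR // scalerA scalerDl.
have [P HP] : exists P : {vspace 'End(L)}, forall f, f \in P <->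
    f \in M /\ forall x, x \in N -> f x = 0.
  apply: vspace_of_pred => [|k f g [fM f0] [gM g0]].
    by split=> [|x _]; rewrite ?mem0v // zero_lfunE.
  split=> [|x Nx]; first by rewrite memvD ?memvZ.
  by rewrite add_lfunE scale_lfunE f0 ?g0 // scaler0 addr0.
have sPM : (P <= M)%VS by apply/subvP => f /HP[].
have TI b f x : b \in B -> f \in M -> x \in I -> T b f x = 0.
  by move=> Bb /HM[_ [k fk]] Ix; rewrite TE !fk ?stI // linearZ /= subrr.
have stM : {in B & M, forall b f, T b f \in M}.
  move=> b f Bb Mf; have [fN _] := (HM f).1 Mf; apply/HM; split=> [x Nx|].
    by rewrite TE memvB ?(stI b) ?fN // stN.
  by exists 0 => x Ix; rewrite TI // scale0r.
have [||||split_ _] :=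
  module_split charF0 br_alt br_jac (T := T) (M := M) (P := P) clB ssB sPM stM.
- move=> b f Bb /HP[Mf f0]; apply/HP; split=> [|x Nx]; first exact: stM.
  by rewrite TE (f0 x Nx) (f0 _ (stN _ _ Bb Nx)) linear0 subrr.
- by move=> x y f _ _ _; rewrite act_end_rep // subrr mem0v.
- move=> r b f Rr Bb Mf; rewrite -act_end_rep //; have Nrb := RBN r b Rr Bb.
  have [fN _] := (HM f).1 Mf.
  apply/HP; split=> [|x Nx]; first by apply: stM => //; apply: NB.
  by rewrite TE (aN _ _ Nrb Nx) (aN _ _ Nrb (IN _ (fN x Nx))) linear0 subrr.
- move=> r f Rr Mf /HP[_ TT0]; have Br := RB r Rr; apply/HP; split; first exact: stM.
  have [fN _] := (HM f).1 Mf; have [q sq q0] := sepR r Rr.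
  apply: (double_commutator0 (r := br r) (psi := f) sq) => // u Nu.
  - exact: stN.
  - by apply: IN; apply: fN.
  - by apply/eqP; rewrite -subr_eq0 -TE TT0.
have [W HW] : exists W : {vspace 'End(L)}, forall f, f \in W <->
    forall x, x \in I -> f x = 0.
  apply: vspace_of_pred => [x _|k f g f0 g0 x Rx]; first by rewrite zero_lfunE.
  by rewrite add_lfunE scale_lfunE f0 ?g0 // scaler0 addr0.
have [|||f [Mf Wf Tf]] := split_ W _ _ (projv I).
- by apply/subvP => f /HP[_ f0]; apply/HW => x /IN; apply: f0.
- by move=> b f Bb Mf; apply/HW => x Ix; apply: TI.
- apply/HM; split=> [x _|]; first exact: memv_proj.
  by exists 1 => x Ix; rewrite scale1r projv_id.
have fid x : x \in I -> f x = x.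
  move=> Ix; move/HW/(_ x Ix)/eqP: Wf.
  by rewrite add_lfunE opp_lfunE projv_id // subr_eq0 => /eqP.
have [fN _] := (HM f).1 Mf.
exists (N :&: lker f)%VS; split.
- split=> [|b u Bb /memv_capP[Nu]]; first by apply: subv_trans sNB; apply: capvSl.
  rewrite memv_cap stN //= !memv_ker => /eqP fu0.
  have /HP[_ /(_ u Nu)/eqP] := Tf b Bb.
  by rewrite TE fu0 linear0 sub0r oppr_eq0.
- exact: capvSl.
- apply/eqP; rewrite eqEsubv subv_add sIN capvSl /=; apply/subvP => u Nu.
  rewrite -(subrK (f u) u) addrC memv_add ?fN // memv_cap memvB ?(IN _ (fN u Nu)) //=.
  by rewrite memv_ker linearB /= (fid (f u)) ?fN // subrr.
apply/eqP; rewrite -subv0; apply/subvP => u /memv_capP[Iu /memv_capP[_]].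
by rewrite memv_ker fid // memv0.
Qed.

End Complements.

(** * Almost algebraic A-algebras are elementary *)

Section Frattini.
Variables (F : fieldType) (L : vectType F) (br : 'Hom(L, 'End(L))).
Local Notation lbr := (fun x y => br x y).
Local Notation subalg := (subalgebra lbr).
Implicit Types (B D E I J M N : {vspace L}).

Lemma maximal_subalgebra_exists B D : subalg D -> (D <= B)%VS -> D != B ->
  exists2 M, maximal_subalgebra lbr B M & (D <= M)%VS.
Proof.
move=> clD sDB nDB.
pose Q D := [/\ subalg D, (D <= B)%VS & D != B].
have [M [[clM sMB nMB] sDM maxM]] := @max_vspace _ _ Q D (And3 clD sDB nDB).
exists M => //; split=> // K clK sMK sKB.
have [->|nKB] := eqVneq K B; first by right.
by left; apply: maxM.
Qed.

(** The nongenerator property: a proper [J] lies in a maximal subalgebra, which contains [I] too. *)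
Lemma supplement_full B I J : (forall M, maximal_subalgebra lbr B M -> (I <= M)%VS) ->
  subalg J -> (J <= B)%VS -> (B <= J + I)%VS -> J = B.
Proof.
move=> HI clJ sJB sBJI; apply/eqP/negPn/negP => nJB.
have [M maxM sJM] := maximal_subalgebra_exists clJ sJB nJB.
have [_ sMB nMB _] := maxM; case/negP: nMB; rewrite eqEsubv sMB.
by apply: subv_trans sBJI _; rewrite subv_add sJM HI.
Qed.

End Frattini.

Section Forward.
Variables (F : fieldType) (charF0 : [pchar F] =i pred0).
Variables (L : vectType F) (br : 'Hom(L, 'End(L))).
Hypothesis br_alt : forall x, br x x = 0.
Hypothesis br_jac : forall x y z, br (br x y) z = br x (br y z) - br y (br x z).
Local Notation lbr := (fun x y => br x y).
Local Notation subalg := (subalgebra lbr).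
Local Notation ideal := (ideal_of lbr).
Local Notation ss := (ss br).
Local Notation abelian := (abelian_subalgebra lbr).
Hypothesis Aalg : A_algebra lbr.
Implicit Types (B E I J N R : {vspace L}).

Lemma abelian_ad_squared0 B N x u : ideal B N -> abelian N -> x \in B -> u \in N ->
  br x (br x u) = 0 -> br x u = 0.
Proof.
move=> [sN stN] aN Bx Nu xxu; apply: (heisenberg_trivial br_alt Aalg) => //.
by rewrite aN ?stN.
Qed.

(** If [R] centralizes [N], it has class at most two and is abelian. Otherwise some [r] in [R] acts
    nontrivially on [N]; its null component [B'] is a smaller subalgebra with [B = B' + N], and a
    complement of [N :&: B'] in [B'] serves for [N]. *)
Lemma abelian_ideal_complement B N R : subalg B -> ideal B N -> abelian N ->
  (N <= R)%VS -> ss B R -> {in R & B, forall r b, br r b \in N} ->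
  exists E, [/\ subalg E, (E <= B)%VS, (E + N)%VS = B & (E :&: N = 0)%VS].
Proof.
move En: (\dim B) => n; elim/ltn_ind: n => n IH in B N R En *.
move=> clB idN aN sNR ssB RBN; have [idR _] := ssB.
have [[sRB stR] [sNB stN]] := (idR, idN); have RB := subvP sRB; have NB := subvP sNB.
have NR := subvP sNR.
have [[r [u [Rr Nu nzru]]]|none] :=
  classic (exists r u, [/\ r \in R, u \in N & br r u != 0]); last first.
  have RN0 r u : r \in R -> u \in N -> br r u = 0.
    by move=> Rr Nu; apply/eqP/negPn/negP => nz; apply: none; exists r, u.
  apply: (central_complement charF0 br_alt br_jac clB ssB) => //.
  apply: (class2_abelian Aalg); first exact: ideal_sub idR clB.
  by move=> x y z Rx Ry Rz; apply: RN0 => //; apply: RBN => //; apply: RB.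
have Br := RB r Rr.
(* The square suffices: [br r] maps [B] into [N], where its kernel equals that of its square. *)
have [B' HB'] : exists B' : {vspace L}, forall x, x \in B' <->
    x \in B /\ br r (br r x) = 0.
  apply: vspace_of_pred => [|k x y [Bx Hx] [By Hy]]; first by rewrite mem0v !linear0.
  by rewrite memvD ?memvZ // !linearP /= Hx Hy scaler0 addr0.
have sB'B : (B' <= B)%VS by apply/subvP => x /HB'[].
have brN x : x \in B -> br r x \in N by apply: RBN.
have clB' : subalg B'.
  move=> x y /HB'[Bx Hx] /HB'[By Hy]; apply/HB'; split; first exact: clB.
  rewrite (br_leibniz br_jac r x y) linearD /=.
  rewrite (br_leibniz br_jac r (br r x)) (br_leibniz br_jac r x) Hx Hy.
  by rewrite br0 // linear0 (aN (br r x) (br r y)) ?brN // !addr0.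
have sBB'N : (B <= B' + N)%VS.
  apply/subvP => x Bx.
  have [||m0 [m1 [_ Nm1 rm0 E1]]] := @ker_im_split _ _ (br r) N _ _ _ (brN x Bx).
  - by move=> v Nv; apply: stN.
  - by move=> v Nv; apply: (abelian_ad_squared0 idN).
  rewrite -(subrK m1 x) memv_add //; apply/HB'; split; first by rewrite memvB // NB.
  by rewrite linearB /= E1 addrK rm0.
have ltB' : (\dim B' < n)%N.
  rewrite -En (ltn_leqif (dimv_leqif_eq sB'B)); apply: contra nzru => /eqP eqB.
  have /HB'[_ /(abelian_ad_squared0 idN aN Br Nu) ->] // : u \in B'.
  by rewrite eqB NB.
have idN' : ideal B' (N :&: B')%VS.
  split=> [|x y B'x /memv_capP[Ny B'y]]; first exact: capvSr.
  by rewrite memv_cap clB' // stN // (subvP sB'B).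
have [||||E [clE sEB' EN EN0]] := IH _ ltB' B' (N :&: B')%VS (R :&: B')%VS erefl clB' idN'.
- by move=> x y /memv_capP[Nx _] /memv_capP[Ny _]; apply: aN.
- by apply: capvS.
- exact: (ss_restrict br_alt clB clB' sB'B ssB idN).
- move=> x y /memv_capP[Rx B'x] B'y; rewrite memv_cap clB' // andbT RBN //.
  exact: (subvP sB'B).
exists E; split=> //; first exact: subv_trans sB'B.
  apply/eqP; rewrite eqEsubv subv_add (subv_trans sEB') // sNB /=.
  apply: (subv_trans sBB'N); rewrite -{1}EN subv_add addvSr andbT subv_add addvSl.
  by apply: subv_trans (addvSr _ _); apply: capvSl.
apply/eqP; rewrite -subv0 -EN0; apply/subvP => x /memv_capP[Ex Nx].
by rewrite !memv_cap Ex Nx (subvP sEB').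
Qed.

Hypothesis Lalg : almost_algebraic lbr.

(** The nilpotent part of [br x] is some [br z]. Descending through its powers, the Heisenberg
    argument shows that it vanishes on [N], where [br x] thus agrees with its semisimple part. *)
Lemma ad_separable_on_abelian B N x : subalg B -> ideal B N -> abelian N -> x \in B ->
  exists2 q, separable_poly q & {in N, forall u, evp (br x) q u = 0}.
Proof.
move=> clB [sNB stN] aN Bx; have [p nzp p0] := evp_kill (br x).
have [q [g [m sq [dq dX]]]] := jordan_poly charF0 nzp.
pose s := evp (br x) g; pose n := evp (br x) ('X - g).
have s0 : evp s q = 0 by rewrite -evp_comp; apply: evp_dvd p0.
have xE v : br x v = s v + n v.
  by rewrite /n evpB add_lfunE opp_lfunE evpX addrC subrK.
have nm v : iter m n v = 0 by rewrite -evp_exp (evp_dvd dX) ?zero_lfunE.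
have jc : jordan_components (br x) s n.
  split=> //; last by exists m.
    by move=> v; apply: commf_evp2.
  exact: separable_semisimple s0.
have adx : in_adL lbr (br x) by exists x.
have [_ [z Hz]] := Lalg adx jc.
have stx v : v \in N -> br x v \in N by apply: stN.
have nN v : v \in N -> n v \in N by apply: evp_stable.
have n0 u : u \in N -> n u = 0.
  have: iter m n u = 0 by []; elim: m {dX nm} u => [|k IH] u /= Hu Nu.
    by rewrite Hu linear0.
  rewrite Hz; apply: (heisenberg_trivial br_alt Aalg); last by rewrite -Hz aN ?nN.
  rewrite -!Hz; apply: IH; last exact: nN.
  by rewrite -iterSr.
exists q => // u Nu; rewrite -[RHS](zero_lfunE _ u) -s0.
elim/poly_ind: (q) u Nu => [|r c IH] u Nu; first by rewrite !evp0.
rewrite !evpD !add_lfunE !evpMX !evpC IH ?stx //.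
by rewrite xE n0 // addr0.
Qed.

Lemma almost_algebraic_elementary : elementary lbr.
Proof.
move=> B clB I [idI maxI _].
have [N [R [[idN aN sNR] ssB RBN maxN]]] := abelian_radical charF0 br_alt br_jac Aalg clB.
have [E [clE sEB EN EN0]] := abelian_ideal_complement clB idN aN sNR ssB RBN.
have [[sNB stN] [sIB stI]] := (idN, idI); have [[sRB _] _] := ssB.
(* With [J] complementary to [I :&: N] in [N], the subalgebra [E + J] supplements [I] and so is [B];
   as [E] meets [N] trivially, [I :&: N] falls into [J]. *)
have IN0 : (I :&: N = 0)%VS.
  pose I0 := (I :&: N)%VS; have idI0 : ideal B I0 by apply: idealI.
  have [J [[sJB stJ] sJN IJ IJ0]] : exists J,
      [/\ ideal B J, (J <= N)%VS, (I0 + J = N)%VS & (I0 :&: J = 0)%VS].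
    apply: (reductive_submodule_complement charF0 br_alt br_jac clB idN aN ssB RBN) => //.
      by move=> r Rr; apply: (ad_separable_on_abelian clB idN aN); apply: (subvP sRB).
    exact: capvSr.
  have clEJ : subalg (E + J)%VS.
    move=> _ _ /memv_addP[e Ee [j Jj ->]] /memv_addP[e' Ee' [j' Jj' ->]].
    have [Be Be'] := (subvP sEB e Ee, subvP sEB e' Ee').
    rewrite brD // linearD /= -addrA memv_add ?clE //; apply: memvD; first exact: stJ.
    rewrite br_anti // memvN; apply: stJ => //.
    by apply: memvD => //; apply: (subvP sJB).
  have EJB : (E + J)%VS = B.
    apply: (supplement_full maxI clEJ); first by rewrite subv_add sEB.
    rewrite -{1}EN -{1}IJ -addvA addvS // addvC addvS //; exact: capvSl.
  apply/eqP; rewrite -subv0 -IJ0; apply/subvP => x I0x.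
  have [Ix Nx] := memv_capP I0x; have : x \in (E + J)%VS by rewrite EJB (subvP sIB).
  case/memv_addP => e Ee [j Jj Ex]; have e0 : e = 0.
    apply/eqP; rewrite -memv0 -EN0 memv_cap Ee -(addrK j e) -Ex memvB //.
    exact: (subvP sJN).
  by rewrite memv_cap I0x Ex e0 add0r.
(* Brackets of [I :&: R] lie in [I :&: N], so this ideal is abelian. *)
have IR0 : (I :&: R <= N)%VS.
  apply: maxN; first by apply: idealI => //; case: ssB.
  move=> x y /memv_capP[Ix Rx] /memv_capP[Iy _]; have By := subvP sIB y Iy.
  apply/eqP; rewrite -memv0 -IN0 memv_cap RBN // andbT.
  by apply: stI => //; apply: (subvP sIB).
have [J [[sJB stJ] sRJ IJ capR]] := ss_orthogonal charF0 br_alt br_jac clB ssB idI.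
have JB : J = B.
  apply: (supplement_full maxI) => //; last by rewrite addvC IJ.
  by move=> x y Jx Jy; apply: stJ => //; apply: (subvP sJB).
apply/eqP; rewrite -subv0 -IN0 subv_cap subvv /=; apply: subv_trans IR0.
rewrite subv_cap subvv /=; apply: subv_trans capR.
by rewrite subv_cap addvSl JB.
Qed.

End Forward.

(** * Elementary algebras are almost algebraic A-algebras *)

Section Backward.
Variables (F : fieldType) (charF0 : [pchar F] =i pred0).
Variables (L : vectType F) (br : 'Hom(L, 'End(L))).
Hypothesis br_alt : forall x, br x x = 0.
Hypothesis br_jac : forall x y z, br (br x y) z = br x (br y z) - br y (br x z).
Local Notation lbr := (fun x y => br x y).
Local Notation subalg := (subalgebra lbr).
Local Notation ideal := (ideal_of lbr).
Local Notation ss := (ss br).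
Local Notation abelian := (abelian_subalgebra lbr).
Implicit Types (B E I J N R : {vspace L}).

Lemma subalg_add B I M : subalg B -> ideal B I -> subalg M -> (M <= B)%VS ->
  subalg (M + I)%VS.
Proof.
move=> clB [sI stI] clM sMB _ _ /memv_addP[m Mm [i Ii ->]] /memv_addP[m' Mm' [i' Ii' ->]].
have [Bm Bm'] := (subvP sMB m Mm, subvP sMB m' Mm').
rewrite brD // linearD /= -addrA memv_add ?clM //; apply: memvD; first exact: stI.
rewrite br_anti // memvN; apply: stI => //.
by apply: memvD => //; apply: (subvP sI).
Qed.

(* The Jordan components of a derivation are derivations: [ad] intertwines the
   derivation with its commutator action, and the same polynomial gives the
   semisimple part on both sides. *)
Lemma jordan_ad_derivation x : exists q g m,
  [/\ separable_poly q, evp (br x) (q \Po g) = 0, evp (br x) (('X - g) ^+ m) = 0 &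
      forall y v, evp (br x) g (br y v) = br (evp (br x) g y) v + br y (evp (br x) g v)].
Proof.
have [n [mf [c [r [[lmf ci cK mfE] lc]]]]] := end_matrix L.
set a := br x; pose X := mf a.
have mfc f v : mf f *m c v = c (f v) by rewrite mfE cK.
have hornerX p v : horner_mx X p *m c v = c (evp a p v).
  elim/poly_ind: p v => [|p k IH] v.
    rewrite rmorph0 mul0mx evp0 zero_lfunE -[in RHS](scale0r 0).
    by have := lc (-1) 0 0; rewrite scaler0 addr0 scaleN1r addNr scale0r.
  rewrite rmorphD rmorphM /= horner_mx_X horner_mx_C mulmxDl -mulmxE -mulmxA.
  by rewrite mfc IH evpD add_lfunE evpMX evpC mul_scalar_mx [evp a p _ + _]addrC lc addrC.
have evp0P p : horner_mx X p = 0 -> evp a p = 0.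
  move=> p0; apply/lfunP => v; apply: ci; rewrite -hornerX p0 mul0mx zero_lfunE.
  by have := lc (-1) 0 0; rewrite scaler0 addr0 scaleN1r addNr.
have [q [g [m sq [q0 X0 Eg]]]] := jordan_adm charF0 X.
exists q, g, m; split; [by []|exact: evp0P|exact: evp0P|] => y v.
have adX z : adm X (mf (br z)) = mf (br (a z)).
  rewrite admE; apply: eq_mulmx_cV => u; rewrite mulmxBl -!mulmxE -!mulmxA.
  rewrite (mfE (br z) u) (mfE a u) !mfc (mfE (br (a z)) u) -(linear_sub _ _ lc).
  by rewrite /a br_jac.
have evpX p z : evp (adm X) p (mf (br z)) = mf (br (evp a p z)).
  elim/poly_ind: p z => [|p k IH] z.
    rewrite !evp0 !zero_lfunE linear0; have := lmf (-1) 0 0.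
    by rewrite scaler0 addr0 scaleN1r addNr.
  rewrite !evpD !add_lfunE !evpMX !evpC adX IH addrC -lmf; congr mf.
  by rewrite linearD linearZ addrC.
have := congr1 (fun Z => Z *m c v) (Eg (mf (br y))).
rewrite evpX mfc admE mulmxBl -!mulmxE -!mulmxA mfc !hornerX mfc -(linear_sub _ _ lc).
by move/ci => ->; rewrite subrK.
Qed.

Definition derivation (f : 'End(L)) := forall y v, f (br y v) = br (f y) v + br y (f v).

Lemma br_derivation z : derivation (br z).
Proof. by move=> y v; rewrite (br_leibniz br_jac). Qed.

Lemma derivationB f g : derivation f -> derivation g -> derivation (f - g).
Proof.
move=> df dg y v; rewrite !add_lfunE !opp_lfunE df dg brB // linearB /=.
by rewrite opprD addrACA.
Qed.

Lemma act_derivation b f : derivation f -> act_end br b f = - br (f b).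
Proof.
move=> df; apply/lfunP => v; rewrite act_endE df opp_lfunE opprD addrCA subrr.
by rewrite addr0.
Qed.

Lemma act_br b y : act_end br b (br y) = br (br b y).
Proof. by apply/lfunP => v; rewrite act_endE br_jac. Qed.

(** With [C] the centralizer of [N], splitting [<[f]> + br @: C] modulo [br @: N] corrects [f] to a
    derivation [m0] for which every [br (m0 b)] is in [br @: N]. Hence [m0 b] is in [N] up to the
    centre, which [N] contains. *)
Lemma derivation_into_radical B N R f : B = fullv -> subalg B -> ideal B N ->
  abelian N -> (N <= R)%VS -> ss B R -> {in R & B, forall r b, br r b \in N} ->
  (forall I, ideal B I -> abelian I -> (I <= N)%VS) ->
  derivation f -> {in N, forall u, f u = 0} -> {in R, forall r, f r \in N} ->
  exists z, {in N, forall u, (f - br z) u = 0} /\ forall v, (f - br z) v \in N.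
Proof.
move=> EB clB idN aN sNR ssB RBN maxN df fN0 fR; have [sNB stN] := idN.
have inB v : v \in B by rewrite EB memvf.
have [C HC] : exists C : {vspace L}, forall y, y \in C <-> forall u, u \in N -> br y u = 0.
  apply: vspace_of_pred => [u _|k y z Hy Hz u Nu]; first by rewrite br0.
  by rewrite brP // Hy // Hz // scaler0 addr0.
have NC : (N <= C)%VS by apply/subvP => u Nu; apply/HC => w; apply: aN.
have fC v : f v \in C.
  apply/HC => u Nu; have := df v u; rewrite (fN0 _ (stN _ _ (inB v) Nu)) (fN0 _ Nu).
  by rewrite linear0 addr0.
have stC b c : c \in C -> br b c \in C.
  by move=> /HC Cc; apply/HC => u Nu; rewrite br_jac (Cc u Nu) (Cc _ (stN b u (inB b) Nu)) linear0 subrr.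
pose T := act_end br; pose M := (<[f]> + br @: C)%VS; pose P := (br @: N)%VS.
have TM b m : m \in M -> T b m \in (br @: C)%VS.
  move=> /memv_addP[_ /vlineP[k ->] [_ /memv_imgP[c Cc ->] ->]].
  rewrite linearP /= (act_derivation _ df) act_br memvD ?memvZ ?memvN //.
    exact: memv_img.
  by apply/memv_img/stC.
have TP b p : p \in P -> T b p \in P.
  by move=> /memv_imgP[u Nu ->]; rewrite /T act_br; apply/memv_img/stN.
have [||||||split_ _] :=
  module_split charF0 br_alt br_jac (T := T) (M := M) (P := P) clB ssB.
- by apply: subv_trans (addvSr _ _); apply: limgS.
- by move=> b m _ Mm; apply: (subvP (addvSr _ _)); apply: TM.
- by move=> b m _; apply: TP.
- by move=> x y m _ _ _; rewrite /T act_end_rep // subrr mem0v.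
- move=> r b m Rr Bb Mm; rewrite /T -act_end_rep //; have Nu := RBN _ _ Rr Bb.
  case/memv_addP: Mm => _ /vlineP[k ->] [_ /memv_imgP[c Cc ->] ->].
  rewrite linearP /= (act_derivation _ df) fN0 // linear0 oppr0 scaler0 add0r act_br.
  by apply/memv_img/(ideal_r br_alt idN).
- move=> r _ Rr /memv_addP[_ /vlineP[k ->] [_ /memv_imgP[c Cc ->] ->]] _.
  rewrite /T linearP /= (act_derivation _ df) act_br memvD ?memvZ ?memvN //.
    by apply/memv_img/fR.
  by apply/memv_img/RBN.
have [|||m0 [Mm0 W0 H0]] := split_ (br @: C)%VS _ _ f.
- exact: limgS.
- by move=> b m _; apply: TM.
- by apply: (subvP (addvSl _ _)); apply: memv_line.
case/memv_imgP: W0 => z Cz Ez.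
have {}Ez : m0 = f - br z by rewrite -Ez subKr.
exists z; rewrite -Ez; split=> [u Nu|v].
  by rewrite Ez add_lfunE opp_lfunE fN0 // (HC z).1 // subrr.
have dm : derivation m0 by rewrite Ez; apply: derivationB => //; apply: br_derivation.
have [Z HZ] : exists Z : {vspace L}, forall y, y \in Z <-> br y = 0.
  apply: vspace_of_pred => [|k y w Hy Hw]; first exact: linear0.
  by rewrite linearP /= Hy Hw scaler0 addr0.
have sZN : (Z <= N)%VS.
  apply: maxN; last by move=> y w /HZ->; rewrite zero_lfunE.
  split=> [|b y _ /HZ y0]; first by rewrite EB subvf.
  by rewrite br_anti // y0 zero_lfunE oppr0 mem0v.
have := H0 v (inB v); rewrite /T (act_derivation _ dm) memvN => /memv_imgP[w Nw Ew].
rewrite -(subrK w (m0 v)) memvD //; apply: (subvP sZN); apply/HZ.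
by rewrite linearB /= Ew subrr.
Qed.

(** Here [<[f]> + br @: N] is split: an invariant derivation has central values. The condition on
    [E] lets [z] in [R] send every member of this module to some [br (br z w')] with [w'] in [N], so
    the condition on squares reduces to the Heisenberg argument on [N]. *)
Lemma derivation_inner_mod_center B N R E f : B = fullv -> subalg B -> A_algebra lbr ->
  ideal B N -> abelian N -> (N <= R)%VS -> ss B R -> {in R & B, forall r b, br r b \in N} ->
  subalg E -> (E + N)%VS = B -> (E :&: N = 0)%VS ->
  derivation f -> {in N, forall u, f u = 0} -> (forall v, f v \in N) ->
  {in E, forall z, z \in R -> f z \in (br z @: N)%VS} ->
  exists2 u, u \in N & forall v, br ((f - br u) v) = 0.
Proof.
move=> EB clB Aalg idN aN sNR ssB RBN clE EN EN0 df fN0 fN fE; have [sNB stN] := idN.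
have inB v : v \in B by rewrite EB memvf.
pose T := act_end br; pose M := (<[f]> + br @: N)%VS.
have TM b m : m \in M -> T b m \in (br @: N)%VS.
  move=> /memv_addP[_ /vlineP[k ->] [_ /memv_imgP[c Cc ->] ->]].
  rewrite linearP /= (act_derivation _ df) act_br memvD ?memvZ ?memvN //.
    by apply/memv_img/fN.
  by apply/memv_img/stN.
have TN u m : u \in N -> m \in M -> T u m = 0.
  move=> Nu /memv_addP[_ /vlineP[k ->] [_ /memv_imgP[c Cc ->] ->]].
  by rewrite linearP /= (act_derivation _ df) fN0 // act_br aN // !linear0 ?oppr0 ?scaler0 ?addr0.
have [||||||split_ _] :=
  module_split charF0 br_alt br_jac (T := T) (M := M) (P := 0%VS) clB ssB.
- exact: sub0v.
- by move=> b m _ Mm; apply: (subvP (addvSr _ _)); apply: TM.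
- by move=> b m _; rewrite !memv0 => /eqP->; rewrite linear0.
- by move=> x y m _ _ _; rewrite /T act_end_rep // subrr mem0v.
- by move=> r b m Rr Bb Mm; rewrite /T -act_end_rep // TN ?mem0v ?RBN.
- move=> r m Rr Mm; rewrite !memv0.
  have : r \in (E + N)%VS by rewrite EN.
  case/memv_addP => z Ez [u0 Nu0 Er].
  have Rz : z \in R by rewrite -(addrK u0 z) -Er memvB // (subvP sNR).
  have Nzy y : br z y \in N by apply: RBN.
  have -> : T r m = T z m by rewrite Er linearD add_lfunE (TN u0) // addr0.
  have Tzm : exists2 w', w' \in N & T z m = br (br z w').
    case/memv_addP: Mm => _ /vlineP[k ->] [_ /memv_imgP[c Nc ->] ->].
    have : - (k *: f z) + br z c \in (br z @: N)%VS.
      by rewrite memvD ?memvN ?memvZ ?fE // memv_img.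
    case/memv_imgP => w' Nw' Ew'; exists w' => //.
    by rewrite -Ew' linearP /= (act_derivation _ df) act_br linearD scalerN -linearZ -linearN.
  case: Tzm => w' Nw' ->; rewrite Er linearD add_lfunE /T !act_br.
  rewrite (aN u0) ?Nzy // linear0 addr0 => /eqP zz0.
  apply/eqP/lfunP => y; rewrite zero_lfunE.
  have E1 : br (br z w') y = br z (br w' y) by rewrite br_jac (aN w' (br z y)) ?Nzy ?subr0.
  rewrite E1; apply: (abelian_ad_squared0 br_alt Aalg idN aN (inB z)).
    exact: (ideal_r br_alt idN).
  by rewrite -E1 (br_leibniz br_jac) zz0 zero_lfunE add0r aN ?Nzy.
have [|||m0 [Mm0 W0 H0]] := split_ (br @: N)%VS _ _ f.
- exact: sub0v.
- by move=> b m _; apply: TM.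
- by apply: (subvP (addvSl _ _)); apply: memv_line.
case/memv_imgP: W0 => u Nu Eu; exists u => // v.
have {}Eu : m0 = f - br u by rewrite -Eu subKr.
have dm : derivation m0 by rewrite Eu; apply: derivationB => //; apply: br_derivation.
have := H0 v (inB v); rewrite /T (act_derivation _ dm) memvN memv0 -Eu.
by move/eqP.
Qed.

Hypothesis elem : elementary lbr.

(** Among ideals inside all maximal subalgebras one maximal for inclusion is the largest, since sums
    stay in this class; it is the Frattini ideal. *)
Lemma elementary_frattini0 B I : subalg B -> ideal B I ->
  (forall M, maximal_subalgebra lbr B M -> (I <= M)%VS) -> I = 0%VS.
Proof.
move=> clB idI HI; pose Q I := ideal B I /\
  forall M, maximal_subalgebra lbr B M -> (I <= M)%VS.
have [U [[idU HU] sIU maxU]] := @max_vspace _ _ Q I (conj idI HI).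
suff U0 : U = 0%VS by apply/eqP; rewrite -subv0 -U0.
apply: (elem clB); split=> // J idJ HJ.
rewrite -(maxU (U + J)%VS) ?addvSl ?addvSr //; split; first exact: idealD.
by move=> M maxM; rewrite subv_add HU ?HJ.
Qed.

Lemma elementary_complement B I : subalg B -> ideal B I ->
  exists C, [/\ subalg C, (C <= B)%VS, (I + C)%VS = B & (I :&: C = 0)%VS].
Proof.
move=> clB idI; have [sIB stI] := idI.
pose Q C := [/\ subalg C, (C <= B)%VS & (I + C)%VS = B].
have QB : Q B by split=> //; apply/addv_idPr.
have [C [[clC sCB IC] _ minC]] := @min_vspace _ _ Q B QB.
exists C; split=> //; have CB := subvP sCB.
have idJ : ideal C (I :&: C)%VS.
  split=> [|x y Cx /memv_capP[Iy Cy]]; first exact: capvSr.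
  by rewrite memv_cap clC // stI // CB.
apply: (elementary_frattini0 clC idJ) => M maxM; have [clM sMC nMC HM] := maxM.
(* If the sum is [C], then [M] already supplements [I], against minimality of [C]. *)
have [||E|E] := HM (M + (I :&: C))%VS (subalg_add clC idJ clM sMC).
- exact: addvSl.
- by rewrite subv_add sMC; apply: capvSr.
- by rewrite -E addvSr.
case/negP: nMC; apply/eqP; apply: minC => //; split=> //; first exact: subv_trans sCB.
rewrite -IC -[in RHS]E addvC [RHS]addvC -addvA; congr (_ + _)%VS.
by rewrite addvC; apply/esym/addv_idPl; apply: capvSl.
Qed.

(** If a subalgebra [M] satisfies [B = M + [B, B]], then [B] is the sum of [M] and any lower central
    term, so [M = B] when [B] is nilpotent. Thus [[B, B]] lies in all maximal subalgebras. *)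
Lemma elementary_A_algebra : A_algebra lbr.
Proof.
move=> B [clB [k Bk]]; pose D := bracketv br B B.
have idD : ideal B D by apply: ideal_bracketv => //; apply: ideal_full.
suff D0 : D = 0%VS.
  by move=> x y Bx By; apply/eqP; rewrite -memv0 -D0; apply: mem_bracketv.
apply: (elementary_frattini0 clB idD) => M maxM; have [clM sMB nMB HM] := maxM.
have [sDB _] := idD.
have [||E|E] := HM (M + D)%VS (subalg_add clB idD clM sMB).
- exact: addvSl.
- by rewrite subv_add sMB.
- by rewrite -E addvSr.
case/negP: nMB; rewrite eqEsubv sMB /=.
suff H j : (B <= M + lower br B j B)%VS by have := H k; rewrite [lower _ _ _ _]Bk addv0.
elim: j => [|j IH]; first exact: addvSr.
rewrite -{1}E subv_add addvSl; apply: bracketv_sub => x y Bx By.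
case/memv_addP: (subvP IH y By) => m Mm [w Lw ->].
case/memv_addP: (subvP IH x Bx) => m' Mm' [w' Lw' Ex].
have MB := subvP sMB; rewrite linearD /=; apply: memvD.
  rewrite Ex br_anti // memvN linearD /= memv_add ?clM //.
  by apply: mem_bracketv => //; apply: MB.
by apply: (subvP (addvSr _ _)); apply: mem_bracketv.
Qed.

(** [U] is an ideal of [N + <[x]>]; a complementary subalgebra meets [N] in [W]. Modulo [U], which
    acts by zero on [N], [x] belongs to that subalgebra, so [W] is stable. *)
Lemma elementary_stable_complement x N U : abelian N ->
  {in N, forall u, br x u \in N} -> (U <= N)%VS -> {in U, forall u, br x u \in U} ->
  exists W, [/\ (W <= N)%VS, {in W, forall w, br x w \in W},
     (U :&: W = 0)%VS & (N <= U + W)%VS].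
Proof.
move=> aN stN sUN stU; pose H := (N + <[x]>)%VS; have UN := subvP sUN.
have NH : {subset N <= H} by apply/subvP/addvSl.
have brH y z : y \in H -> z \in H -> br y z \in N.
  move=> /memv_addP[u Nu [_ /vlineP[k ->] ->]] /memv_addP[v Nv [_ /vlineP[l ->] ->]].
  rewrite brD // !linearD /= aN // add0r.
  have Z k' y' z' : br (k' *: y') z' = k' *: br y' z'.
    by rewrite -[k' *: y']addr0 brP // br0 // addr0.
  rewrite !Z !linearZ /= br_alt !scaler0 addr0 (br_anti br_alt u).
  by rewrite memvD ?memvZ ?memvN ?stN.
have clH : subalg H by move=> y z Hy Hz; apply/NH/brH.
have idU : ideal H U.
  split=> [|y u]; first exact: subv_trans (addvSl _ _).
  move=> /memv_addP[v Nv [_ /vlineP[k ->] ->]] Uu.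
  have Z : br (k *: x) u = k *: br x u by rewrite -[k *: x]addr0 brP // br0 // addr0.
  by rewrite brD // (aN v u Nv (UN u Uu)) add0r Z memvZ ?stU.
have [C [clC sCH UC UC0]] := elementary_complement clH idU.
exists (C :&: N)%VS; split; first exact: capvSr.
- move=> w /memv_capP[Cw Nw]; rewrite memv_cap stN // andbT.
  have : x \in (U + C)%VS by rewrite UC (subvP (addvSr _ _)) ?memv_line.
  case/memv_addP => u Uu [c Cc ->].
  by rewrite brD // (aN u w (UN u Uu) Nw) add0r clC.
- by rewrite capvA UC0 cap0v.
apply/subvP => u Nu; have : u \in (U + C)%VS by rewrite UC NH.
case/memv_addP => v Uv [c Cc Eu]; rewrite Eu memv_add // memv_cap Cc.
by rewrite -(addKr v c) -Eu memvD // memvN UN.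
Qed.

(** The centre has a complementary subalgebra [C], and every bracket is a bracket of elements of
    [C]. *)
Lemma elementary_center_derived y : br y = 0 -> y \in bracketv br fullv fullv -> y = 0.
Proof.
move=> y0 Dy; have [Z HZ] : exists Z : {vspace L}, forall y, y \in Z <-> br y = 0.
  apply: vspace_of_pred => [|k u w Hu Hw]; first exact: linear0.
  by rewrite linearP /= Hu Hw scaler0 addr0.
have clL : subalg fullv by move=> u v _ _; apply: memvf.
have idZ : ideal fullv Z.
  split=> [|b u _ /HZ u0]; first exact: subvf.
  by rewrite br_anti // u0 zero_lfunE oppr0 mem0v.
have [C [clC _ ZC ZC0]] := elementary_complement clL idZ.
apply/eqP; rewrite -memv0 -ZC0 memv_cap (HZ y).2 //=; apply: (subvP _ _ Dy).
have split_ v : exists z c, [/\ br z = 0, c \in C & v = z + c].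
  have : v \in (Z + C)%VS by rewrite ZC memvf.
  by case/memv_addP => z /HZ z0 [c Cc ->]; exists z, c.
apply: bracketv_sub => u v _ _; have [z [c [z0 Cc ->]]] := split_ u.
have [z' [c' [z0' Cc' ->]]] := split_ v.
rewrite brD // z0 zero_lfunE add0r linearD /= (br_anti br_alt c) z0' zero_lfunE oppr0 add0r.
exact: clC.
Qed.

(* A nilpotent derivation [f] that is a polynomial in [ad x] kills the largest abelian
   ideal [N]; subtracting inner derivations, it is pushed into [N], then into the centre,
   which meets [[L, L]] trivially. *)
Lemma elementary_nilpotent_inner x p : derivation (evp (br x) p) -> nilf (evp (br x) p) ->
  exists z, evp (br x) p = br z.
Proof.
move=> df [k fk]; set f := evp (br x) p in df fk *.
have [[v0 /eqP nz]|Z0] := classic (exists v : L, v <> 0); last first.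
  exists 0; apply/lfunP => v; suff -> : v = 0 by rewrite !linear0.
  by have [//|/eqP nz] := eqVneq v 0; case: Z0; exists v.
have [[v1 /eqP nz1 xv1]|H] := classic (exists2 v, v <> 0 & br x v = 0); last first.
  have x0 : x = 0 by have [//|/eqP nz1] := eqVneq x 0; case: H; exists x.
  by case: H; exists v0; [apply/eqP | rewrite x0 br0].
(* [br x] kills a nonzero vector, namely [x], or any vector if [x = 0]; the nilpotent [f] multiplies
   it by [p.[0]]. *)
have p0 : root p 0.
  have fi i : iter i f v1 = p.[0] ^+ i *: v1.
    elim: i => [|i IH]; first by rewrite scale1r.
    by rewrite /= IH linearZ /= /f evp_ker // scalerA -exprSr.
  have /eqP := fk v1; rewrite fi scaler_eq0 (negPf nz1) orbF expf_eq0 => /andP[_].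
  by rewrite /root.
have [h Eh] := factor_theorem _ _ p0; rewrite subr0 in Eh.
have fE v : f v = evp (br x) h (br x v) by rewrite /f Eh evpMX.
have fst (U : {vspace L}) : (forall v, br x v \in U) -> forall v, f v \in U.
  by move=> sU v; rewrite fE; apply: evp_stable => // u _.
have clL : subalg fullv by move=> u v _ _; apply: memvf.
have Aalg := elementary_A_algebra.
have [N [R [[idN aN sNR] ssL RLN maxN]]] := abelian_radical charF0 br_alt br_jac Aalg clL.
have [_ stN] := idN; have {}stN b u : u \in N -> br b u \in N by apply/stN/memvf.
have RN r b : r \in R -> br r b \in N by move=> Rr; apply: RLN; rewrite ?memvf.
have fN0 : {in N, forall u, f u = 0}.
  apply: semisimple_nilf0; last by exists k.
    by move=> u; apply: stN.
  by move=> U sUN stU; apply: elementary_stable_complement => // u; apply: stN.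
have fR : {in R, forall r, f r \in N}.
  move=> r Rr; rewrite fE; apply: evp_stable => [u|]; first exact: stN.
  by rewrite br_anti // memvN RN.
have [z1 [f1N0 f1N]] :=
  derivation_into_radical erefl clL idN aN sNR ssL RLN maxN df fN0 fR.
have [E [clE _ NE NE0]] := elementary_complement clL idN.
have df1 : derivation (f - br z1) by apply: derivationB => //; apply: br_derivation.
rewrite addvC in NE; rewrite capvC in NE0.
have [|u Nu f2] := derivation_inner_mod_center erefl clL Aalg idN aN sNR ssL RLN
  clE NE NE0 df1 f1N0 f1N.
  (* [[z, E]] lies in [E :&: N], which is zero, so [br z @: N] is the whole image of [br z]; it is
     stable under [br x], hence contains [f z]. *)
  move=> z Ez Rz; have zW y : br z y \in (br z @: N)%VS.
    have : y \in (E + N)%VS by rewrite NE memvf.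
    case/memv_addP => e Ee [n Nn ->]; rewrite linearD /=.
    have -> : br z e = 0 by apply/eqP; rewrite -memv0 -NE0 memv_cap clE // RN.
    by rewrite add0r memv_img.
  rewrite add_lfunE opp_lfunE memvB //; last by rewrite br_anti // memvN.
  rewrite fE; apply: evp_stable; last by rewrite br_anti // memvN.
  move=> _ /memv_imgP[n Nn ->]; rewrite (br_leibniz br_jac) (aN (br x z)) //; last first.
    by rewrite br_anti // memvN RN.
  by rewrite add0r memv_img // stN.
exists (z1 + u); apply/lfunP => v; apply/eqP; rewrite -subr_eq0; apply/eqP.
have E2 : f v - br (z1 + u) v = (f - br z1 - br u) v.
  by rewrite !add_lfunE !opp_lfunE brD // opprD addrA.
rewrite E2; apply: elementary_center_derived; first exact: f2.
rewrite -E2 memvB ?mem_bracketv ?memvf //; apply: fst => w.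
by rewrite mem_bracketv ?memvf.
Qed.

Lemma elementary_almost_algebraic : almost_algebraic lbr.
Proof.
move=> a s n [x ax] jc; have {ax} Ea : a = br x by apply/lfunP.
rewrite {a}Ea in jc; have [q [g [m [sq q0 X0 dg]]]] := jordan_ad_derivation x.
have Es := jordan_components_unique jc sq q0 X0; have [xE _ _ [k nk]] := jc.
have En : n = evp (br x) ('X - g).
  by apply/lfunP => v; rewrite evpB add_lfunE opp_lfunE evpX -Es xE addrC addKr.
have dn : derivation (evp (br x) ('X - g)).
  rewrite evpB; apply: derivationB => // y v; rewrite !evpX; exact: br_derivation.
have [|z Ez] := elementary_nilpotent_inner dn; first by exists k; rewrite -En.
rewrite -En in Ez; split; last by exists z => v; rewrite Ez.
by exists (x - z) => v; rewrite brB // -Ez xE addrK.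
Qed.

End Backward.

(** The bracket becomes the adjoint map, linear into ['End(L)], and the Jacobi identity says that it
    is a representation. The equality of functions allows substitution into the definitions of the
    theorem. *)
Lemma lie_algebra_hom (F : fieldType) (L : vectType F) (br : L -> L -> L) :
  lie_algebra br -> exists A : 'Hom(L, 'End(L)),
    [/\ br = (fun x y => A x y), forall x, A x x = 0 &
        forall x y z, A (A x y) z = A x (A y z) - A y (A x z)].
Proof.
case=> linl linr alt jac; have lr x : linear (br x) by move=> k y z; apply: linr.
have AE x y : linfun (fun x => linfun (br x)) x y = br x y.
  rewrite linfunE ?linfunE // => k u v; apply/lfunP => w.
  by rewrite add_lfunE scale_lfunE !linfunE.
have anti x y : br x y = - br y x.
  have linD u v w : br (u + v) w = br u w + br v w.
    by have := linl 1 u v w; rewrite !scale1r.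
  have linrD u v w : br w (u + v) = br w u + br w v.
    by have := linr 1 w u v; rewrite !scale1r.
  have := alt (x + y); rewrite linD !linrD !alt add0r addr0 => /eqP.
  by rewrite addr_eq0 => /eqP.
exists (linfun (fun x => linfun (br x))); split=> [|x|x y z]; rewrite ?AE //.
  by apply: functional_extensionality => x; apply: functional_extensionality => y.
apply/eqP; rewrite -subr_eq0 -oppr_eq0 -(jac x y z) (anti z (br x y)).
have -> : br y (br z x) = - br y (br x z).
  rewrite (anti z x); have := linr (-1) y (br x z) 0.
  have -> : br y 0 = 0 by have := linr (-1) y 0 0; rewrite scaler0 addr0 scaleN1r addNr.
  by rewrite !addr0 !scaleN1r.
by rewrite opprB.
Qed.

Theorem theorem2p4 (F : fieldType) (L : vectType F) (br : L -> L -> L)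
  (charF0 : [pchar F]%R =i pred0) (HL : lie_algebra br) :
  (almost_algebraic br /\ A_algebra br) <-> elementary br.
Proof.
have [A [-> A_alt A_jac]] := lie_algebra_hom HL; split=> [[Lalg Aalg]|elem].
  exact: almost_algebraic_elementary.
by split; [apply: elementary_almost_algebraic | apply: elementary_A_algebra].
Qed.
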